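(* If $\alpha$ is a composition of $n$ obtained by shuffling a partition and $(1^k)$ for some $k \ge 0$, then $$\mathcal{K}_\alpha = [\mathsf{w_r}(\mathsf{T}_\alpha), \mathsf{w_r}(\tau'_\alpha)]_L.$$
   Context: Let $n$ be a nonnegative integer. A composition $\alpha=(\alpha_1,\dots,\alpha_l)$ of $n$ is a finite sequence of positive integers with sum $n$; $\ell(\alpha)=l$; $\alpha^{\mathrm r}=(\alpha_l,\dots,\alpha_1)$. It is obtained by shuffling a partition $\lambda$ and $(1^k)$ if it is an interleaving of the sequence $\lambda$ (in its weakly decreasing order) with $k$ ones. The composition diagram $\mathtt{cd}(\alpha)$ consists of left-justified rows with $\alpha_i$ cells in the $i$th row from the bottom; $(i,j)$ denotes the cell in the $i$th row from the bottom and $j$th column from the left. For a filling $T$, $\mathsf{w_r}(T)$ is the word obtained by reading the entries of each row from right to left, starting with the bottommost row and going up; it is regarded as a permutation in one-line notation. Left weak Bruhat order: $\sigma\preceq_L\rho$ in $\mathfrak S_n$ iff $\mathrm{Inv}_L(\sigma)\subseteq\mathrm{Inv}_L(\rho)$, where $\mathrm{Inv}_L(\gamma)=\{(i,j)\mid 1\le i<j\le n,\ \gamma(i)>\gamma(j)\}$; $[\sigma,\rho]_L=\{\gamma\mid\sigma\preceq_L\gamma\preceq_L\rho\}$. Insertion. $w_0\in\mathfrak S_n$ is the longest element, so $\sigma w_0$ is the reversed word of $\sigma$. A Young composition tableau is a filling $T$ of a composition diagram with positive integers whose rows weakly increase, whose first column strictly increases from bottom to top, and such that for cells $(i,k+1),(j,k)$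 with $i<j$, if $T(i,k+1)\ge T(j,k)$ then $(j,k+1)$ is a cell and $T(i,k+1)>T(j,k+1)$. For such $T$ and a positive integer $k$, define $k\to T$: list the cells $(c_1,d_1),(c_2,d_2),\dots$ of $T$ (before insertion) by decreasing column index $d$ and, within a column, decreasing row index $c$. Set $k_0:=k$ and process $i=1,2,\dots$: if $(c_i,d_i+1)$ is not a cell and $T(c_i,d_i)\le k_0$, place $k_0$ in a new cell $(c_i,d_i+1)$ and stop; if $(c_i,d_i+1)$ is a cell and $T(c_i,d_i)\le k_0<T(c_i,d_i+1)$, interchange $k_0$ with the entry in $(c_i,d_i+1)$ and continue; otherwise continue. If no stop occurs, create a new row with a single cell containing $k_0$, positioned so that the first column strictly increases from bottom to top. For $\sigma\in\mathfrak S_n$, $\hat{\mathsf P}(\sigma)$ is obtained from the empty tableau by inserting $\sigma(1),\dots,\sigma(n)$ successively. $\hat{\mathsf Q}(\sigma)$ is built simultaneously from the empty filling: at step $k$, if the new cell of $\hat{\mathsf P}$ lies in column $c=1$, add to $\hat{\mathsf Q}$ a new row with a single cell containing $k$, positioned so that the first column increases from bottom to top; if $c>1$, append $k$ at the end of the topmost row of $\hat{\mathsf Q}$ having exactly $c-1$ cells. $\mathsf T_\alpha$ is the filling of $\mathtt{cd}(\alpha)$ with $1,\dots,n$ from left to right in each row, starting with the bottommost row and going up. $\mathcal K_\alpha=\{\sigma\in\mathfrak S_n\mid\mathrm{sh}(\hat{\mathsf P}(\sigma w_0))=\alpha\text{ and }\hat{\mathsf Q}(\sigma w_0)=\mathsf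 T_{\alpha^{\mathrm r}}\}$, where $\mathrm{sh}$ denotes shape. The sequences $\mathsf{seq}_1(\alpha),\mathsf{seq}_2(\alpha)$ of cells of $\mathtt{cd}(\alpha)$, for $\alpha$ a shuffle of a partition and $(1^k)$ (both empty if $\alpha=\varnothing$), are the final values of $c^{(1)},c^{(2)}$ in the following procedure. Let $i$ be the smallest index such that $\alpha_i$ is the largest part of $\alpha$; set $c^{(1)}=((i,\alpha_i))$, $c^{(2)}=\emptyset$. P1: if $\alpha_i\ge3$ go to P2, otherwise go to P3. P2: if $\alpha_j<\alpha_i-1$ for all $i<j\le l$, terminate. Otherwise choose the smallest $j>i$ with $\alpha_j\ge\alpha_i-1$, prepend $(j,\alpha_j)$ to $c^{(1)}$, update $i$ to $j$, and go to P1. P3: choose the largest $j$ with $i\le j\le l$ such that $\alpha_t=\alpha_i$ for all $i\le t\le j$; replace $c^{(1)}$ by the concatenation of $((j,\alpha_j),\dots,(i+2,\alpha_{i+2}),(i+1,\alpha_{i+1}))$ and $c^{(1)}$. Let $\beta:=(\alpha_{j+1},\dots,\alpha_l)$. While $\beta\ne\varnothing$: choose the smallest $1\le t\le\ell(\beta)$ such that $(\beta_t,\dots,\beta_{\ell(\beta)})$ is a partition (weakly decreasing); append $((j+\ell(\beta),\beta_{\ell(\beta)}),\dots,(j+t,\beta_t))$ to the end of $c^{(2)}$; replace $\beta$ by $(\beta_1,\dots,\beta_{t-1},\beta_t-1,\dots,\beta_{\ell(\beta)}-1)$ with trailing zeros dropped. Terminate when $\beta=\varnothing$. Let $D_\alpha$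 be $\mathtt{cd}(\alpha)$ with all cells in $\mathsf{seq}_1(\alpha)$ and $\mathsf{seq}_2(\alpha)$ removed. It is the composition diagram of a composition $\tilde\alpha$, which is again a shuffle of a partition and $(1^{k'})$ for some $k'\ge0$. Let $\mathsf{seq}(\alpha)$ be the concatenation of $\mathsf{seq}_2(\alpha)$ followed by $\mathsf{seq}_1(\alpha)$. The filling $\tau'_\alpha$ of $\mathtt{cd}(\alpha)$ is defined recursively ($\tau'_\varnothing$ is the empty filling): $\tau'_\alpha(C)=\tau'_{\tilde\alpha}(C)$ if $C\in\mathtt{cd}(\tilde\alpha)$, and $\tau'_\alpha(C)=n+1-k$ if $C$ is the $k$th entry of $\mathsf{seq}(\alpha)$, where $n=|\alpha|$. *)

(* Defs.v *)
From HB Require Import structures.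
From mathcomp Require Import all_boot all_fingroup.

Set Implicit Arguments.
Unset Strict Implicit.
Unset Printing Implicit Defensive.

Local Open Scope nat_scope.

Definition is_composition (n : nat) (alpha : seq nat) : bool :=
  all (ltn 0) alpha && (sumn alpha == n).

Definition is_partition (lambda : seq nat) : bool :=
  all (ltn 0) lambda && sorted geq lambda.

Definition is_shuffle (s t u : seq nat) : Prop :=
  exists m : bitseq,
    [/\ size m = size u, mask m u = s & mask (map negb m) u = t].

Definition partition_ones_shuffle (alpha : seq nat) : Prop :=
  exists (lambda : seq nat) (k : nat),
    is_partition lambda /\ is_shuffle lambda (nseq k 1) alpha.

(* Rows are listed from bottom to top, and a cell is
    a pair (row, column) of 1-based indices. *)

Definition cell : Type := (nat * nat)%type.
Definition filling : Type := seq (seq nat).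

Definition part (alpha : seq nat) (i : nat) : nat := nth 0 alpha i.-1.

Definition max_part (alpha : seq nat) : nat := foldr maxn 0 alpha.

Definition cd (alpha : seq nat) : seq cell :=
  [seq (i, j) | i <- iota 1 (size alpha), j <- iota 1 (part alpha i)].

Definition fill (alpha : seq nat) (f : cell -> nat) : filling :=
  [seq [seq f (i, j) | j <- iota 1 (part alpha i)] | i <- iota 1 (size alpha)].

Definition entry (T : filling) (c : cell) : nat :=
  nth 0 (nth [::] T c.1.-1) c.2.-1.

Definition set_entry (T : filling) (c : cell) (k : nat) : filling :=
  set_nth [::] T c.1.-1 (set_nth 0 (nth [::] T c.1.-1) c.2.-1 k).

Definition w_r (T : filling) : seq nat := flatten (map rev T).

Definition T_can (alpha : seq nat) : filling :=
  reshape alpha (iota 1 (sumn alpha)).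

Definition add_row (k : nat) (T : filling) : filling :=
  [seq r <- T | head 0 r < k] ++ [:: k] :: [seq r <- T | k <= head 0 r].

Definition insertion_order (alpha : seq nat) : seq cell :=
  [seq c <- [seq (i, j) | j <- rev (iota 1 (max_part alpha)),
                          i <- rev (iota 1 (size alpha))] | c \in cd alpha].

(* The second component of the result is the column of the new cell.
   An entry (c, d + 1) is modified only when (c, d) is processed, so the
   entries compared below are those of the tableau before insertion. *)
Fixpoint insert_along (cs : seq cell) (k : nat) (T : filling) : filling * nat :=
  if cs is c :: cs' then
    let c' := (c.1, c.2.+1) in
    if c' \notin cd (shape T) then
      if entry T c <= k then (set_entry T c' k, c'.2)
      else insert_along cs' k T
    else
      if entry T c <= k < entry T c' then
        insert_along cs' (entry T c') (set_entry T c' k)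
      else insert_along cs' k T
  else (add_row k T, 1).

Definition insert (k : nat) (T : filling) : filling * nat :=
  insert_along (insertion_order (shape T)) k T.

Fixpoint append_first (m k : nat) (Q : filling) : filling :=
  if Q is r :: Q' then
    if size r == m then rcons r k :: Q' else r :: append_first m k Q'
  else [::].

Definition append_topmost (m k : nat) (Q : filling) : filling :=
  rev (append_first m k (rev Q)).

Definition record (k c : nat) (Q : filling) : filling :=
  if c == 1 then add_row k Q else append_topmost c.-1 k Q.

Definition PQ_step (PQ : filling * filling) (kx : nat * nat) :
    filling * filling :=
  let: (k, x) := kx in
  let: (P', c) := insert x PQ.1 in
  (P', record k c PQ.2).

Definition PQ (w : seq nat) : filling * filling :=
  foldl PQ_step ([::], [::]) (zip (iota 1 (size w)) w).

Definition word (n : nat) (s : 'S_n) : seq nat :=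
  [seq (s i).+1 | i <- enum 'I_n].

(* The identity if w is not the one-line notation of a permutation; see
   [word_perm_of_word]. *)
Definition perm_of_word (n : nat) (w : seq nat) : 'S_n :=
  odflt 1%g [pick s : 'S_n | word s == w].

Definition longest (n : nat) : 'S_n := perm (@rev_ord_inj n).

Definition Inv_L (n : nat) (s : 'S_n) : {set 'I_n * 'I_n} :=
  [set ij : 'I_n * 'I_n | (ij.1 < ij.2) && (s ij.2 < s ij.1)].

Definition le_L (n : nat) (s r : 'S_n) : bool := Inv_L s \subset Inv_L r.

Definition interval_L (n : nat) (s r : 'S_n) : {set 'S_n} :=
  [set g : 'S_n | le_L s g && le_L g r].

Definition P_hat (n : nat) (s : 'S_n) : filling := (PQ (word s)).1.
Definition Q_hat (n : nat) (s : 'S_n) : filling := (PQ (word s)).2.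

(* Products of 'S_n apply the left factor first, hence [longest n * s] for the
   permutation i |-> s (w_0 i); see [word_longest]. *)
Definition K_set (n : nat) (alpha : seq nat) : {set 'S_n} :=
  [set s : 'S_n | (shape (P_hat (longest n * s)%g) == alpha)
               && (Q_hat (longest n * s)%g == T_can (rev alpha))].

Definition drop_trailing_zeros (s : seq nat) : seq nat :=
  rev (drop (find (predC1 0) (rev s)) (rev s)).

(* Returns what the loop of P3 appends to c^(2).  Each round decreases
   [sumn beta], so [sumn beta] is enough fuel. *)
Fixpoint P3_loop (fuel j : nat) (beta : seq nat) : seq cell :=
  if fuel is fuel'.+1 then
    if beta is [::] then [::] else
    let l := size beta in
    let t := (find (fun u => sorted geq (drop u beta)) (iota 0 l)).+1 in
    [seq (j + u, part beta u) | u <- rev (iota t (l - t).+1)]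
    ++ P3_loop fuel' j
         (drop_trailing_zeros (take t.-1 beta ++ map predn (drop t.-1 beta)))
  else [::].

Definition P3 (alpha : seq nat) (i : nat) (c1 : seq cell) :
    seq cell * seq cell :=
  let j := i + find (predC1 (part alpha i)) (drop i alpha) in
  let beta := drop j alpha in
  ([seq (t, part alpha t) | t <- rev (iota i.+1 (j - i))] ++ c1,
   P3_loop (sumn beta) j beta).

(* P1 and P2.  The index i strictly increases, so [size alpha] is enough
   fuel. *)
Fixpoint P12 (fuel : nat) (alpha : seq nat) (i : nat) (c1 : seq cell) :
    seq cell * seq cell :=
  if fuel is fuel'.+1 then
    if 3 <= part alpha i then
      if [seq j <- iota i.+1 (size alpha - i)
            | part alpha i - 1 <= part alpha j] is j :: _
      then P12 fuel' alpha j ((j, part alpha j) :: c1)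
      else (c1, [::])
    else P3 alpha i c1
  else (c1, [::]).

Definition seq12 (alpha : seq nat) : seq cell * seq cell :=
  if alpha is [::] then ([::], [::]) else
  let i := (index (max_part alpha) alpha).+1 in
  P12 (size alpha) alpha i [:: (i, part alpha i)].

Definition seq1 (alpha : seq nat) : seq cell := (seq12 alpha).1.
Definition seq2 (alpha : seq nat) : seq cell := (seq12 alpha).2.
Definition seq_cells (alpha : seq nat) : seq cell := seq2 alpha ++ seq1 alpha.

(* The numbers of cells in the rows of D_alpha; the rows that are emptied are
   the topmost ones. *)
Definition tilde (alpha : seq nat) : seq nat :=
  drop_trailing_zeros
    [seq count (fun j => (i, j) \notin seq_cells alpha)
               (iota 1 (part alpha i)) | i <- iota 1 (size alpha)].

(* If alpha is nonempty, then so is seq_1(alpha), and [tilde alpha] has smaller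
   sum; thus [sumn alpha] is enough fuel. *)
Fixpoint tau'_rec (fuel : nat) (alpha : seq nat) (c : cell) : nat :=
  if fuel is fuel'.+1 then
    if c \in cd (tilde alpha) then tau'_rec fuel' (tilde alpha) c
    else (sumn alpha).+1 - (index c (seq_cells alpha)).+1
  else 0.

Definition tau' (alpha : seq nat) : filling :=
  fill alpha (tau'_rec (sumn alpha) alpha).

Lemma size_word (n : nat) (s : 'S_n) : size (word s) = n.
Proof. by rewrite size_map size_enum_ord. Qed.

Lemma nth_word (n : nat) (s : 'S_n) (i : 'I_n) : nth 0 (word s) i = (s i).+1.
Proof. by rewrite (nth_map i) ?size_enum_ord // nth_ord_enum. Qed.

Lemma word_longest (n : nat) (s : 'S_n) :
  word (longest n * s)%g = rev (word s).
Proof.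
apply: (@eq_from_nth _ 0); first by rewrite size_rev !size_word.
move=> i; rewrite size_word => lt_in.
rewrite nth_rev size_word // (nth_word _ (Ordinal lt_in)) permM permE.
by rewrite (nth_word s (rev_ord (Ordinal lt_in))).
Qed.

Lemma word_inj (n : nat) : injective (@word n).
Proof.
move=> s r eq_sr; apply/permP => i; apply: val_inj; apply: succn_inj.
by rewrite -!nth_word eq_sr.
Qed.

Lemma word_perm_of_word (n : nat) (w : seq nat) :
  perm_eq w (iota 1 n) -> word (perm_of_word n w) = w.
Proof.
move=> w_perm; rewrite /perm_of_word; case: pickP => [s /eqP //|no_s].
have size_w : size w = n by rewrite (perm_size w_perm) size_iota.
have uniq_w : uniq w by rewrite (perm_uniq w_perm) iota_uniq.
have w_gt0 (i : 'I_n) : 0 < nth 0 w i <= n.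
  have : nth 0 w i \in iota 1 n by rewrite -(perm_mem w_perm) mem_nth ?size_w.
  by rewrite mem_iota add1n ltnS.
have w_lt (i : 'I_n) : (nth 0 w i).-1 < n.
  by have /andP[w0 wn] := w_gt0 i; rewrite prednK.
have f_inj : injective (fun i : 'I_n => Ordinal (w_lt i)).
  move=> i j /(congr1 val) /= eq_ij; apply/val_inj/eqP.
  rewrite -(nth_uniq 0 _ _ uniq_w) ?size_w ?ltn_ord //.
  have /andP[wi _] := w_gt0 i; have /andP[wj _] := w_gt0 j.
  by rewrite -(prednK wi) -(prednK wj) eq_ij.
suff eq_w : word (perm f_inj) = w by have := no_s (perm f_inj); rewrite eq_w eqxx.
apply: (@eq_from_nth _ 0); first by rewrite size_word size_w.
move=> i; rewrite size_word => lt_in.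
rewrite (nth_word _ (Ordinal lt_in)) permE /=.
by have /andP[w0 _] := w_gt0 (Ordinal lt_in); rewrite prednK.
Qed.

(* Main.v *)
Require Import Defs.
From mathcomp Require Import all_boot all_fingroup zify.

(* Let T be the filling of cd(alpha), with increasing rows, whose word is sigma.
   Both sides of the equality turn out to say that T satisfies the following
   relations between rows i < j ([compatible]):
     T(i,1) < T(j,1)      if alpha_i = 1,
     T(i,k) < T(j,k)      if alpha_i = alpha_j,
     T(i,k+1) < T(j,k)    if alpha_i > alpha_j and k <= alpha_j.

   For K_alpha, the condition on the recording tableau says that inserting the
   rows of T from top to bottom creates, for each row, new cells in columns
   1, 2, ..., alpha_i. Insertion preserves Young composition tableaux, and a new
   cell is always created in the lowest row of its length; so the final shape
   forces every new cell into the current bottom row. Inserting a row in this way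
   changes only the column in which the bottom row grows, and there only rows of
   the same length as the one being inserted; the relations are then read off
   from the tableau conditions, and conversely they force this behaviour.

   For the interval, tau'_alpha satisfies the relations, and whenever a cell in a
   lower row has a smaller value of tau'_alpha than a cell in a higher row, this
   is forced by the relations. This goes by induction along alpha -> tilde alpha:
   each cell of seq(alpha) exceeds all remaining cells in lower rows, and seq_2,
   seq_1 list these cells from top to bottom except where two cells in rows of
   length 2 are unrelated. *)

(** The obstacle is that the tableau built from the rows of T is not T: bumping moves letters
    between rows. An inserted row is therefore never read back from the tableau; the induction over
    the rows only transports lower bounds. This suffices, because each relation bounds an entry of
    the bottom row by all entries of one column in the rows of one length.

    Increasing rows of T are part of both sides. For the interval they say that sigma lies above the
    word of T_alpha, whose inversions are exactly the pairs within a row. For K_alpha they follow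
    from a form of the row bumping lemma.

    The shuffle hypothesis enters only through [tame]: a part larger than 1 bounds all later parts.
    A bottom row of length at least 2 is thus a longest row, which leaves no room for bumps to the
    right of the growing column; a bottom row of length 1 is treated separately.

    The relations for tilde alpha are consequences of those for alpha, so a filling compatible with
    alpha can be fed to the induction hypothesis. *)

Set Implicit Arguments.
Unset Strict Implicit.
Unset Printing Implicit Defensive.

(** * Bumping letters *)

(* Rows and columns are 0-based here. E r c is an entry, with a bound N of all
   letters standing for an empty cell: then placing a letter is the same as
   interchanging it with N, and the letter N causes no further change. B r c is
   the letter carried along once the cells (r', c.+1) with r' >= r have been
   compared. *)
Definition bump_at (E B : nat -> nat -> nat) (r c : nat) : bool :=
  E r c <= B r.+1 c < E r c.+1.

Record trace (N m M k : nat) (E B : nat -> nat -> nat) : Prop := Trace {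
  trace_le : forall r c, E r c <= N;
  trace_rows : forall r c, m <= r -> E r c = N;
  trace_step : forall r c,
    B r c = if bump_at E B r c then E r c.+1 else B r.+1 c;
  trace_next : forall c, B m c = B 0 c.+1;
  trace_far : forall r c, M <= c -> B r c = k;
  trace_lt : k < N }.

Definition bumped (E B : nat -> nat -> nat) (r c : nat) : nat :=
  if c is c'.+1 then if bump_at E B r c' then B r.+1 c' else E r c else E r c.

(** [syct_tri] is the triple condition in disjunctive form. With N for an empty cell, the clause
    that (j, c.+1) is a cell needs no mention: it follows from E j c.+1 < E i c.+1 < N. *)
Record syct (N m : nat) (E : nat -> nat -> nat) : Prop := Syct {
  syct_row : forall r c, E r c <= E r c.+1;
  syct_col : forall i j, i < j < m -> E i 0 < E j 0;
  syct_tri : forall i j c, i < j -> E i c.+1 < N ->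
    E i c.+1 < E j c \/ E j c.+1 < E i c.+1 }.

Definition distinct (N k : nat) (E : nat -> nat -> nat) : Prop :=
  (forall r c r' c', E r c = E r' c' -> E r c < N -> r = r' /\ c = c')
  /\ (forall r c, E r c <> k).

Lemma syct_rowle N m E r c c' : syct N m E -> c <= c' -> E r c <= E r c'.
Proof.
move=> S; elim: c' => [|c' IH]; first by case: c.
rewrite leq_eqVlt => /orP[/eqP -> //|/IH] le; exact: leq_trans le (syct_row S _ _).
Qed.

Section TraceTheory.

Variables (N m M k : nat) (E B : nat -> nat -> nat).
Hypotheses (tr : trace N m M k E B) (S : syct N m E) (D : distinct N k E).

Lemma trace_mono r r' c : r <= r' -> B r' c <= B r c.
Proof.
elim: r' => [|r' IH]; first by case: r.
rewrite leq_eqVlt => /orP[/eqP -> //|/IH]; apply: leq_trans.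
rewrite [leqRHS](trace_step tr) /bump_at; case: ifP => // /andP[_] /ltnW //.
Qed.

Lemma trace_stable r c : m <= r -> B r c = B m c.
Proof.
move=> le; rewrite -(subnKC le); elim: (r - m) => [|q IH]; first by rewrite addn0.
rewrite -{}IH addnS [RHS](trace_step tr) /bump_at !(trace_rows tr) ?leq_addr //.
by case: ifP => // /andP[/leq_ltn_trans h /h]; rewrite ltnn.
Qed.

(** Each interchange passes on a larger letter, and columns are processed from right to left. *)
Lemma trace_ge c c' r r' :
  c < c' -> B r' c' <= B r c.
Proof.
have base r1 r2 d : B r1 d.+1 <= B r2 d.
  apply: (@leq_trans (B 0 d.+1)); first by apply: trace_mono.
  rewrite -(trace_next tr); case: (leqP m r2) => h.
    by rewrite (trace_stable _ h).
  by apply: trace_mono; lia.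
elim: c' r' => // c' IH r'; rewrite ltnS leq_eqVlt => /orP[/eqP -> //|/IH h].
exact: leq_trans (base _ 0 _) (h _).
Qed.

Lemma trace_ge_init r c : k <= B r c.
Proof.
by rewrite -(trace_far tr (c := maxn M c.+1) 0) ?trace_ge //; lia.
Qed.

(** Induction in the order of processing: columns from right to left and, within a column, rows from
    top to bottom. *)
Lemma trace_ind (Q : nat -> nat -> Prop) :
  (forall r c, M <= c -> Q r c) ->
  (forall r c, m <= r -> Q 0 c.+1 -> Q r c) ->
  (forall r c, r < m -> Q r.+1 c -> Q r c) ->
  forall r c, Q r c.
Proof.
move=> QM Qm Qr r c; move: {1}(M - c) (erefl (M - c)) r => q.
elim: q c => [|q IHc] c ec r; first by apply: QM; lia.
move: {1}(m - r) (erefl (m - r)) => p.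
elim: p r => [|p IHr] r er; first by apply: Qm; [lia|apply: IHc; lia].
by apply: Qr; [lia|apply: IHr; lia].
Qed.

Lemma trace_leN r c : B r c <= N.
Proof.
move: r c; apply: trace_ind => [r c h|r c h|r c h IH].
- by rewrite (trace_far tr) // ltnW // (trace_lt tr).
- by rewrite (trace_stable _ h) (trace_next tr).
- by rewrite (trace_step tr); case: ifP => // _; apply: trace_le tr _ _.
Qed.

(** Excludes ties: a letter comes from outside or from a cell processed earlier, so for distinct
    entries it differs from the entry it may replace. *)
Lemma trace_origin r c : B r c = k \/
  exists r' c', [/\ B r c = E r' c'.+1, c < c' \/ c = c' /\ r <= r' & r' < m].
Proof.
move: r c; apply: trace_ind => [r c h|r c h|r c h].
- by left; rewrite (trace_far tr).
- rewrite (trace_stable _ h) (trace_next tr) => -[->|[r' [c' [-> h1 h2]]]]; first by left.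
  by right; exists r', c'; split=> //; lia.
rewrite (trace_step tr r) => IH; case: ifP => _; first by right; exists r, c; split=> //; right.
case: IH => [->|[r' [c' [-> h1 h2]]]]; first by left.
by right; exists r', c'; split=> //; lia.
Qed.

Lemma trace_neq r c : B r.+1 c < N -> B r.+1 c <> E r c.+1.
Proof.
case: (trace_origin r.+1 c) => [->|[r' [c' [-> h1 h2]]]] lt.
- by move/esym; apply: D.2.
- by move=> e; case: (D.1 _ _ _ _ e) => [|? ?]; lia.
Qed.

Lemma bumped_le r c : bumped E B r c <= E r c.
Proof. by case: c => //= c; rewrite /bump_at; case: ifP => // /andP[_ /ltnW]. Qed.

Lemma bump_after r c : bump_at E B r c -> B r c = E r c.+1.
Proof. by rewrite (trace_step tr r) => ->. Qed.

Lemma nbump_after r c : ~~ bump_at E B r c -> B r c = B r.+1 c.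
Proof. by rewrite (trace_step tr r) => /negbTE ->. Qed.

Lemma nbump_case r c : ~~ bump_at E B r c -> B r.+1 c < N ->
  B r.+1 c < E r c \/ E r c.+1 < B r.+1 c.
Proof.
rewrite /bump_at negb_and -ltnNge -leqNgt => /orP[|h] lt; first by left.
by right; have := trace_neq lt; lia.
Qed.

(* A letter that is smaller than an entry of row i when it enters that entry's
   column stays smaller at least until row i is reached. *)
Lemma letter_above i r c : E i c.+1 < N -> B m c < E i c.+1 -> i < r ->
  B r c < E i c.+1.
Proof.
move=> fin lt; move: {1}(m - r) (erefl (m - r)) => q; elim: q r => [|q IH] r er ir.
  by rewrite (trace_stable (r := r)) //; lia.
have lt1 : B r.+1 c < E i c.+1 by apply: IH; lia.
case: (boolP (bump_at E B r c)) => b; last by rewrite (nbump_after b).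
rewrite (bump_after b); move: b => /andP[le _].
by case: (syct_tri S ir fin); lia.
Qed.

(** A bump in a row r < i passes on E r c.+1, which by the triple condition is either below E i c or
    above E i c.+1. So a letter that was too small for row i never falls into the gap of row i
    further down. *)
Lemma letter_below i r c : r <= i -> B r c < N -> B i c < E i c ->
  B r c < E i c \/ E i c.+1 < B r c.
Proof.
move=> ri fin lt; move: ri fin; move: {1}(i - r) (erefl (i - r)) => q.
elim: q r => [|q IH] r er ri fin.
  by left; have -> : r = i by lia.
case: (boolP (bump_at E B r c)) => b; last first.
  by move: fin; rewrite (nbump_after b) => fin; apply: IH; lia.
move: fin; rewrite (bump_after b) => fin.
by case: (@syct_tri _ _ _ S r i c _ fin); lia.
Qed.

Lemma bumped_row r c : bumped E B r c <= bumped E B r c.+1.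
Proof.
apply: (leq_trans (bumped_le _ _)) => /=.
by case: ifP => [/andP[] //|_]; apply: syct_row S _ _.
Qed.

(** The half of [bumped_tri] that keeps the old entry in column c, so that only the changes in
    column c.+1 matter. *)
Let bumped_tri_source i j c : i < j -> bumped E B i c.+1 < N ->
  bumped E B i c.+1 < E j c \/ bumped E B j c.+1 < bumped E B i c.+1.
Proof.
move=> ij; have := bumped_le j c.+1.
case: (boolP (bump_at E B i c)) => bi; rewrite [bumped E B i c.+1]/= ?bi ?(negbTE bi); last first.
  by move=> le fin; case: (syct_tri S ij fin); lia.
move=> le fin; have mono : B j c <= B i.+1 c by apply: trace_mono.
case: (boolP (bump_at E B j c)) => bj; rewrite /= ?bj ?(negbTE bj).
  right; move: bj => /[dup] bj /andP[_]; rewrite (bump_after bj) in mono; lia.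
rewrite (nbump_after bj) in mono.
case: (nbump_case bj) => [|h|h]; [lia| |right; lia].
by case: (@letter_below j i.+1 c) => //; rewrite ?(nbump_after bj); [lia|left|right].
Qed.

(** After [bumped_tri_source] only a bump of the entry of row j in the left column can do harm. If
    the letter placed there were too small, then the letter passed row i one column earlier without
    bumping, hence below both entries of the gap; by [letter_below] and [letter_above] it is still
    below the left one of them when it reaches row j, and the triple condition of E gives a
    contradiction. *)
Lemma bumped_tri i j c : i < j -> bumped E B i c.+1 < N ->
  bumped E B i c.+1 < bumped E B j c \/
  bumped E B j c.+1 < bumped E B i c.+1.
Proof.
move=> ij fin; case: (bumped_tri_source ij fin) => [lt|]; last by right.
case: c => [|c] in fin lt *; first by left.
case: (boolP (bump_at E B j c)) => bj; last first.
  by left; rewrite [X in _ < X]/= (negbTE bj).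
have -> : bumped E B j c.+1 = B j.+1 c by rewrite /= bj.
case: (ltnP (bumped E B i c.+2) (B j.+1 c)) => [|le]; [by left|exfalso].
have geB r : B r c.+1 <= B j.+1 c by apply: trace_ge.
case: (boolP (bump_at E B i c.+1)) => bi.
  move: le (geB i); rewrite /= bi (bump_after bi); move: bi => /andP[]; lia.
move: le lt fin; rewrite [bumped _ _ _ _]/= (negbTE bi) => le lt fin.
have := geB i; rewrite (nbump_after bi) => geBi.
case: (nbump_case bi) => [|h|h]; [lia| |lia].
have {}h : B 0 c.+1 < E i c.+1.
  by case: (@letter_below i 0 c.+1) => //; rewrite ?(nbump_after bi) //; move: (geB 0); lia.
have rowi := syct_row S i c.+1.
have h1 : B j.+1 c < E i c.+1 by apply: letter_above; rewrite ?(trace_next tr); lia.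
move: bj => /andP[sj _].
by case: (@syct_tri _ _ _ S i j c ij); lia.
Qed.

(** The triple condition between row i and a new row above it, which has no second cell. *)
Lemma bumped_lt_new i : E i 0 < B 0 0 -> B 0 0 < N ->
  bumped E B i 1 < N -> bumped E B i 1 < B 0 0.
Proof.
move=> lt fin; have mono : B i 0 <= B 0 0 by apply: trace_mono.
case: (boolP (bump_at E B i 0)) => bi; rewrite /= ?bi ?(negbTE bi) => fini.
  by rewrite (bump_after bi) in mono; move: bi => /andP[]; lia.
rewrite (nbump_after bi) in mono.
case: (nbump_case bi) => [|h|h]; [lia| |lia].
by case: (@letter_below i 0 0) => //; rewrite ?(nbump_after bi) //; lia.
Qed.

(** A row i < r ending in column c.+1 would have caught the letter with a new cell, unless the
    letter was then below E i c.+1. In that case it stays below E i c.+1 until it leaves row r, but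
    there it is N. *)
Lemma new_cell_lowest r c i : bump_at E B r c -> E r c.+1 = N -> i < r ->
  bumped E B i c.+1 < N -> bumped E B i c.+2 < N.
Proof.
move=> b new ir fin; case: (ltnP (bumped _ _ _ _) N) => // ge.
have Br : B r c = N by rewrite bump_after.
have fin_r : B r.+1 c < N by rewrite -new; case/andP: b.
have v : E i c.+2 = N by have := bumped_le i c.+2; have := trace_le tr i c.+2; lia.
have nbi : ~~ bump_at E B i c.
  have := trace_mono c ir; have := trace_le tr i c.+1.
  by rewrite /bump_at; lia.
move: fin; rewrite /= (negbTE nbi) => fin.
have leB : B i.+1 c.+1 <= B r.+1 c by apply: trace_ge.
have nbi1 : ~~ bump_at E B i c.+1.
  by apply/negP => bi; move: ge; rewrite /= bi; lia.
case: (nbump_case nbi1) => [|h|h]; [lia| |lia].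
have leB0 : B 0 c.+1 <= B r.+1 c by apply: trace_ge.
have {}h : B 0 c.+1 < E i c.+1.
  by case: (@letter_below i 0 c.+1) => //; rewrite ?(nbump_after nbi1) //; lia.
have : B r c < E i c.+1 by apply: letter_above ir; rewrite ?(trace_next tr).
lia.
Qed.

Lemma new_row_lowest i : E i 0 < B 0 0 -> B 0 0 < N -> bumped E B i 1 < N.
Proof.
move=> lt fin; case: (ltnP (bumped _ _ _ _) N) => // ge.
have v : E i 1 = N by have := bumped_le i 1; have := trace_le tr i 1; lia.
have leB : B i.+1 0 <= B 0 0 by apply: trace_mono.
have nbi : ~~ bump_at E B i 0.
  by apply/negP => bi; move: ge; rewrite /= bi; lia.
case: (nbump_case nbi) => [|h|h]; [lia| |lia].
by case: (@letter_below i 0 0) => //; rewrite ?(nbump_after nbi) //; lia.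
Qed.

Lemma new_row_neq r : B 0 0 < N -> B 0 0 <> E r 0.
Proof.
case: (trace_origin 0 0) => [->|[r' [c' [-> h1 h2]]]] lt.
- by move/esym; apply: D.2.
- by move=> e; case: (D.1 _ _ _ _ e).
Qed.

End TraceTheory.

Lemma iota_rcons m n : iota m n.+1 = rcons (iota m n) (m + n).
Proof. by rewrite -cats1 -[in LHS]addn1 iotaD. Qed.

Lemma syct_bumped N m M k E B :
  trace N m M k E B -> syct N m E -> distinct N k E -> syct N m (bumped E B).
Proof.
move=> tr S D; split; first exact: bumped_row B S.
  by move=> i j ij; apply: syct_col S _ _ ij.
by move=> i j c; apply: bumped_tri tr S D _ _ _.
Qed.

Definition new_row (N p f : nat) (E : nat -> nat -> nat) (r c : nat) : nat :=
  if r < p then E r c else if r == p then (if c is 0 then f else N) else E r.-1 c.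

Lemma syct_new_row N m M k p E B (f := B 0 0) :
  trace N m M k E B -> syct N m E -> distinct N k E -> f < N -> p <= m ->
  (forall i, i < p -> E i 0 < f) -> (forall i, p <= i < m -> f < E i 0) ->
  syct N m.+1 (new_row N p f (bumped E B)).
Proof.
move=> tr S D fN pm lt gt; have S' := syct_bumped tr S D.
split.
- move=> r c; rewrite /new_row; case: ifP => _; first exact: bumped_row B S _ _.
  case: ifP => _; first by case: c => //; rewrite ltnW.
  exact: bumped_row B S _ _.
- move=> i j /andP[ij jm]; rewrite /new_row.
  case: (ltngtP i p) => ip; case: (ltngtP j p) => jp; try lia.
  + by apply: syct_col S _ _ _; lia.
  + by apply: syct_col S _ _ _; lia.
  + exact: lt.
  + by apply: syct_col S _ _ _; lia.
  + by apply: gt; lia.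
move=> i j c ij; rewrite /new_row.
case: (ltngtP i p) => ip; case: (ltngtP j p) => jp; try lia.
- exact: syct_tri S' _ _ _ ij.
- by apply: syct_tri S' _ _ _ _; lia.
- case: c => [|c] fin; left=> //.
  exact: (bumped_lt_new tr S D (lt _ ip)).
- by apply: syct_tri S' _ _ _ _; lia.
Qed.

Definition column_step (E : nat -> nat -> nat) (c r b : nat) : nat :=
  if E r c <= b < E r c.+1 then E r c.+1 else b.

(** The explicit value of B 0 c: columns M - 1 down to c have been processed. *)
Definition column_letter (E : nat -> nat -> nat) (m M k c : nat) : nat :=
  foldr (fun c' b => foldr (column_step E c') b (iota 0 m)) k (iota c (M - c)).

Lemma trace_exists N m M k E :
  (forall r c, E r c <= N) -> (forall r c, m <= r -> E r c = N) ->
  (forall r c, M <= c -> E r c = N) -> k < N ->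
  exists B, trace N m M k E B.
Proof.
move=> leN rows cols kN.
pose B r c := foldr (column_step E c) (column_letter E m M k c.+1) (iota r (m - r)).
have far c : M <= c -> column_letter E m M k c = k.
  by rewrite /column_letter -subn_eq0 => /eqP ->.
have Bfar r c : M <= c -> B r c = k.
  move=> Mc; rewrite /B far; last by lia.
  elim: (iota _ _) => //= i s ->; rewrite /column_step cols //.
  by have := leN i c.+1; case: ifP => //; lia.
exists B; split=> //.
- move=> r c; case: (ltnP r m) => rm.
    by rewrite /B /bump_at subnS -(@prednK (m - r)) ?subn_gt0 //= -/(column_step _ _ _ _).
  have -> : bump_at E B r c = false.
    by rewrite /bump_at !rows //; case: leqP => //=; lia.
  by rewrite /B; have [-> ->] : m - r = 0 /\ m - r.+1 = 0 by lia.
move=> c; case: (ltnP c.+1 M) => Mc; last by rewrite (Bfar 0) // /B subnn /= far.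
rewrite /B subnn subn0 /= /column_letter.
by have -> : M - c.+1 = (M - c.+2).+1 by lia.
Qed.

(** * Fillings as arrays padded with N *)

Definition ent (N : nat) (T : filling) (r c : nat) : nat :=
  nth N (nth [::] T r) c.

Lemma ent_lt N T r c : all (gtn N) (flatten T) ->
  (ent N T r c < N) = (c < size (nth [::] T r)).
Proof.
move=> bT; rewrite /ent; case: (ltnP c (size _)) => h; last by rewrite nth_default ?ltnn.
apply: (allP bT); apply/flattenP; exists (nth [::] T r); last by rewrite mem_nth.
by rewrite mem_nth //; case: (ltnP r (size T)) h => // h; rewrite nth_default.
Qed.

Lemma ent_le N T r c : all (gtn N) (flatten T) -> ent N T r c <= N.
Proof.
move=> bT; have := ent_lt r c bT; case: (ltnP c (size _)) => h; first by move/ltnW.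
by rewrite /ent nth_default.
Qed.

Lemma ent_rows N T r c : size T <= r -> ent N T r c = N.
Proof. by move=> h; rewrite /ent (nth_default [::]) // nth_nil. Qed.

Lemma leq_max_part s x : x \in s -> x <= max_part s.
Proof.
elim: s => //= y s IH; rewrite inE => /orP[/eqP ->|/IH]; rewrite /max_part /=; first exact: leq_maxl.
by move/leq_trans; apply; apply: leq_maxr.
Qed.

Lemma ent_cols N T r c : max_part (shape T) <= c -> ent N T r c = N.
Proof.
move=> h; rewrite /ent nth_default //; apply: leq_trans h.
case: (ltnP r (size T)) => rT; last by rewrite nth_default.
by apply: leq_max_part; rewrite -(nth_map _ 0) // mem_nth // size_map.
Qed.

Lemma mem_cd alpha i j : ((i, j) \in cd alpha) = (0 < i) && (0 < j <= part alpha i).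
Proof.
apply/allpairsPdep/idP => [[x [y [h1 h2 [-> ->]]]]|].
  by move: h1 h2; rewrite !mem_iota; lia.
move=> /andP[i0 /andP[j0 jp]]; exists i, j; rewrite !mem_iota; split=> //; last by lia.
case: (ltnP (size alpha) i) => h; last by lia.
by move: jp; rewrite /part nth_default; lia.
Qed.

Lemma mem_cd_ent N T r c : all (gtn N) (flatten T) ->
  ((r.+1, c.+1) \in cd (shape T)) = (ent N T r c < N).
Proof.
move=> bT; rewrite mem_cd ent_lt //= /part /=.
case: (ltnP r (size T)) => rT; first by rewrite (nth_map [::]).
by rewrite !nth_default // size_map.
Qed.

Lemma nth_set_nth_pad (T : Type) (x y z : T) s c i : c <= size s ->
  nth x (set_nth y s c z) i = if i == c then z else nth x s i.
Proof.
elim: s c i => [|w s IH] [|c] [|i] //= h; first by rewrite nth_nil.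
by rewrite IH.
Qed.

Lemma ent_set_entry N T r c k r' c' : c <= size (nth [::] T r) ->
  ent N (set_entry T (r.+1, c.+1) k) r' c' =
  if (r' == r) && (c' == c) then k else ent N T r' c'.
Proof.
move=> h; rewrite /ent /set_entry /= nth_set_nth /=.
by case: (r' =P r) => [->|] //; rewrite nth_set_nth_pad.
Qed.

Lemma shape_set_entry T r c k : r < size T -> c < size (nth [::] T r) ->
  shape (set_entry T (r.+1, c.+1) k) = shape T.
Proof.
move=> rT h; rewrite /set_entry /=; apply: (@eq_from_nth _ 0); rewrite !size_map size_set_nth; first by lia.
move=> i iT; rewrite !(nth_map [::]) ?size_set_nth; try lia.
rewrite nth_set_nth /=; case: (i =P r) => [->|] //.
by rewrite size_set_nth /=; lia.
Qed.

Lemma shape_extend T r k : r < size T ->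
  shape (set_entry T (r.+1, (size (nth [::] T r)).+1) k) =
  set_nth 0 (shape T) r (size (nth [::] T r)).+1.
Proof.
move=> rT; rewrite /set_entry /=; apply: (@eq_from_nth _ 0); rewrite !(size_map, size_set_nth) // => i iT.
rewrite (nth_map [::]) ?size_set_nth // !nth_set_nth /=; case: (i =P r) => [_|_].
  by rewrite size_set_nth /=; lia.
by rewrite (nth_map [::]) //; lia.
Qed.

Lemma perm_set_nth (x k : nat) s c : c < size s ->
  perm_eq (nth x s c :: set_nth 0 s c k) (k :: s).
Proof.
elim: s c => [|w s IH] [|c] //= h.
  by rewrite -![_ :: _ :: s]/([:: _; _] ++ s) perm_cat2r; apply/allP=> y _ /=; lia.
have := IH c h; rewrite -(perm_cons w) => H.
apply: perm_trans (perm_trans _ H) _; apply/allP => y _ /=; lia.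
Qed.

(** * Insertion of one letter *)

Lemma perm_flatten_set_nth (T : filling) r s : r < size T ->
  perm_eq (nth [::] T r ++ flatten (set_nth [::] T r s)) (s ++ flatten T).
Proof.
elim: T r => [|w T IH] [|r] //= h; first by rewrite perm_catCA.
rewrite perm_catCA perm_sym perm_catCA perm_sym perm_cat2l; exact: IH.
Qed.

Lemma perm_add_row k T : perm_eq (flatten (add_row k T)) (k :: flatten T).
Proof.
apply/seq.permP => a; rewrite /add_row flatten_cat count_cat /=.
elim: T => [|r T /=]; first by rewrite addn0.
by rewrite ltnNge; case: (leqP k (head 0 r)) => _ /=; rewrite ?count_cat; lia.
Qed.

Lemma perm_insert_along cs k T : all [in cd (shape T)] cs ->
  perm_eq (flatten (insert_along cs k T).1) (k :: flatten T).
Proof.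
elim: cs k T => [|[i j] cs IH] k T /=; first by rewrite perm_add_row.
case/andP; rewrite mem_cd => /andP[i0 /andP[j0 jp]] csT.
case: i i0 jp => // r _; case: j j0 => // d _; rewrite /part /=.
case: (ltnP r (size T)) => rT; last by rewrite nth_default ?size_map.
rewrite (nth_map [::]) // => dT.
rewrite mem_cd /part /= (nth_map [::]) // -ltnNge ltnS.
case: (leqP (size _) d.+1) => hd; last first.
  case: ifP => _; last by apply: IH.
  have eS : shape (set_entry T (r.+1, d.+2) k) = shape T by apply: shape_set_entry.
  apply: (perm_trans (IH _ _ _)); first by rewrite eS.
  rewrite /entry /set_entry /=.
  have H := perm_flatten_set_nth (set_nth 0 (nth [::] T r) d.+1 k) rT.
  have H1 := perm_set_nth 0 k hd.
  apply/allP => y _ /=.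
  move/seq.permP: H => /(_ (pred1 y)); move/seq.permP: H1 => /(_ (pred1 y)).
  by rewrite !count_cat /=; lia.
case: ifP => _; last by apply: IH.
have ed : d.+1 = size (nth [::] T r) by lia.
have eR : set_nth 0 (nth [::] T r) d.+1 k = nth [::] T r ++ [:: k].
  by rewrite ed; elim: (nth [::] T r) => //= ? ? ->.
rewrite /set_entry /= eR.
have H := perm_flatten_set_nth (nth [::] T r ++ [:: k]) rT.
apply/allP => y _ /=; move/seq.permP: H => /(_ (pred1 y)).
by rewrite !count_cat /=; lia.
Qed.

Lemma insertion_order_cd alpha : all [in cd alpha] (insertion_order alpha).
Proof. by apply/allP => c; rewrite mem_filter => /andP[]. Qed.

Lemma perm_insert k T : perm_eq (flatten (insert k T).1) (k :: flatten T).
Proof. exact: perm_insert_along (insertion_order_cd _). Qed.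

(** Array columns are 0-based, so the cell in array column c.+1 is reported as column c.+2. In the
    second case [T'] is the filling before the new row is added, because [bumped] does not move
    rows. *)
Inductive insert_spec (N : nat) (T : filling) (E B : nat -> nat -> nat) :
    filling * nat -> Prop :=
  | InsertCell r c T' of r < size T & bump_at E B r c & E r c.+1 = N
      & B r.+1 c < N
      & shape T' = set_nth 0 (shape T) r c.+2
      & (forall i j, ent N T' i j = bumped E B i j) : insert_spec N T E B (T', c.+2)
  | InsertRow T' of B 0 0 < N & shape T' = shape T
      & (forall i j, ent N T' i j = bumped E B i j) :
      insert_spec N T E B (add_row (B 0 0) T', 1).

(** The cells still to be processed when the letter is B r c. *)
Definition order_upto (alpha : seq nat) (r c : nat) : seq cell :=
  [seq x <- [seq (i, c.+1) | i <- rev (iota 1 r)] ++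
            [seq (i, j) | j <- rev (iota 1 c), i <- rev (iota 1 (size alpha))]
  | x \in cd alpha].

Lemma insertP N T k (M := max_part (shape T)) B (E := ent N T) :
  all (gtn N) (flatten T) -> trace N (size T) M k E B ->
  insert_spec N T E B (insert k T).
Proof.
move=> bT tr.
have szs : size (shape T) = size T by rewrite size_map.
(* The state of the insertion when the letter is B r c: exactly the cells compared so far carry
   their new entries. *)
pose partial c r Tc := [/\ r <= size T, shape Tc = shape T, B r c < N &
  forall i j, ent N Tc i j = if j is j'.+1 then
    if (c < j') || (c == j') && (r <= i) then bumped E B i j else E i j
    else E i j].
pose good c r := forall Tc, partial c r Tc ->
  insert_spec N T E B (insert_along (order_upto (shape T) r c) (B r c) Tc).
have nbump i c : B i.+1 c = N -> bump_at E B i c = false.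
  by move=> e; rewrite /bump_at e; have := ent_le i c.+1 bT; rewrite /E; case: ltngtP; rewrite ?andbF.
have step c r : good c r -> good c r.+1.
  move=> IH Tc [rT sTc fin eTc].
  have szTc : size Tc = size T by rewrite -szs -sTc size_map.
  have szr i : size (nth [::] Tc i) = size (nth [::] T i).
    case: (ltnP i (size T)) => h; last by rewrite !nth_default ?szTc.
    by have := congr1 (nth 0 ^~ i) sTc; rewrite !(nth_map [::]) ?szTc.
  have bTc : all (gtn N) (flatten Tc).
    apply/allP => x /flattenP[s /(nthP [::])[i iT <-] /(nthP N)[j jT <-]].
    rewrite -/(ent N Tc i j) eTc; have := ent_lt i j bT; rewrite -szr jT -/E.
    by case: j {jT} => // j h; case: ifP => _ //=; apply: leq_ltn_trans (bumped_le E B i j.+1) _.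
  have Er : ent N Tc r c = E r c.
    by rewrite eTc; case: (c) => // c'; case: ifP => //; lia.
  have Er1 : ent N Tc r c.+1 = E r c.+1.
    by rewrite eTc; case: ifP => //; lia.
  have order1 : order_upto (shape T) r.+1 c =
      if E r c < N then (r.+1, c.+1) :: order_upto (shape T) r c
      else order_upto (shape T) r c.
    by rewrite /order_upto -[X in iota 1 X]addn1 iotaD rev_cat /= add1n (mem_cd_ent r c bT).
  have skip : bump_at E B r c = false -> partial c r Tc.
    move=> b; split=> //; [exact: ltnW|by rewrite (nbump_after tr) ?b|].
    move=> i [|j]; rewrite eTc //.
    case: (ltngtP c j) => //= cj; subst j; rewrite [r <= i]leq_eqVlt.
    by case: (r =P i) => //= <-; rewrite ltnn b.
  have skipB : bump_at E B r c = false -> B r.+1 c = B r c.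
    by move=> b; rewrite [RHS](nbump_after tr) ?b.
  rewrite order1; case: (ltnP (E r c) N) => cN; last first.
    have b : bump_at E B r c = false.
      by apply/negbTE; rewrite /bump_at negb_and -ltnNge; lia.
    by rewrite skipB //; apply: IH; apply: skip.
  rewrite /= (mem_cd_ent r c.+1 bTc) Er1.
  have crT : c < size (nth [::] T r) by rewrite -(ent_lt _ _ bT).
  have -> : entry Tc (r.+1, c.+1) = E r c.
    by rewrite -Er /entry /ent /=; apply: set_nth_default; rewrite szr.
  case: (ltnP (E r c.+1) N) => c1N /=.
    have -> : entry Tc (r.+1, c.+2) = E r c.+1.
      rewrite -Er1 /entry /ent /=; apply: set_nth_default.
      by rewrite szr -(ent_lt _ _ bT).
    rewrite -/(bump_at E B r c); case: ifP => b; last first.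
      by rewrite skipB //; apply: IH; apply: skip.
    rewrite -(bump_after tr b); apply: IH; split.
    - exact: ltnW.
    - by rewrite shape_set_entry ?szTc ?szr -?(ent_lt _ _ bT).
    - by rewrite (bump_after tr b).
    move=> i j; rewrite ent_set_entry ?szr //.
    case: j => [|j]; first by rewrite andbF eTc.
    rewrite eqSS; case: (i =P r) => [->|ir] /=.
      rewrite eq_sym leqnn andbT; case: (c =P j) => [<-|cj] /=; first by rewrite orbT b.
      by rewrite orbF eTc; move/eqP/negbTE: cj => ->; rewrite orbF.
    rewrite eTc; have -> : (r < i) = (r <= i) by lia.
    by [].
  have Ern : E r c.+1 = N by have := ent_le r c.+1 bT; rewrite -/E; lia.
  case: leqP => le; last first.
    have b : bump_at E B r c = false by rewrite /bump_at leqNgt le.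
    by rewrite skipB //; apply: IH; apply: skip.
  have b : bump_at E B r c by rewrite /bump_at le Ern.
  (* The insertion stops at a new cell, whereas the trace goes on with the letter N; the two agree
     because N bumps nothing. *)
  have BN i j : (j < c) || (j == c) && (i <= r) -> B i j = N.
    have BrN : B r c = N by rewrite (bump_after tr b).
    move=> ij; apply/eqP; rewrite eqn_leq (trace_leN tr) /= -BrN.
    have [jc|jc] : j < c \/ j = c /\ i <= r by lia.
      by apply: (trace_ge tr).
    by case: jc => -> ir; apply: (trace_mono tr).
  have ec : c.+1 = size (nth [::] T r).
    by apply/eqP; rewrite eqn_leq crT leqNgt -(ent_lt _ _ bT) -/E Ern ltnn.
  apply: (InsertCell (r := r)) => //.
    by rewrite ec -szr shape_extend ?szTc // sTc szr -ec.
  move=> i j; rewrite ent_set_entry; last by rewrite szr ec.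
  case: j => [|j]; first by rewrite andbF eTc.
  rewrite eqSS; case: (i =P r) => [->|ir] /=.
    case: (j =P c) => [->|cj] /=; first by rewrite b.
    rewrite eTc; case: (ltngtP c j) => //= ej; last by case: cj.
    by rewrite nbump //; apply: BN; lia.
  rewrite eTc; case: (ltngtP c j) => //= cj; first by rewrite nbump //; apply: BN; lia.
  subst j; case: ifP => //= h; rewrite nbump //; apply: BN; lia.
have main c r : good c r.
  elim: c r => [|c IHc]; elim=> [|r IHr]; try exact: step.
    move=> Tc [_ sTc fin eTc]; rewrite /order_upto /=; apply: InsertRow => // i [|j] //.
    by rewrite eTc /= leq0n andbT; case: j.
  move=> Tc [_ sTc fin eTc].
  have -> : order_upto (shape T) 0 c.+1 = order_upto (shape T) (size T) c.
    rewrite /order_upto; have -> : iota 1 c.+1 = rcons (iota 1 c) c.+1.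
      by rewrite -cats1 -[X in iota 1 X]addn1 iotaD add1n.
    by rewrite rev_rcons szs.
  rewrite -(trace_next tr) in fin *; apply: IHc; split=> // i [|j]; rewrite eTc //.
  rewrite leq0n andbT; case: (ltngtP c j) => //= cj.
    - by have -> : (c.+1 < j) || (c.+1 == j) by lia.
    - by have -> : (c.+1 < j) || (c.+1 == j) = false by lia.
  subst j; have -> : (c.+1 < c) || (c.+1 == c) = false by lia.
  case: ifP => //= h.
  by rewrite /bump_at !(trace_rows tr) //; case: ltngtP.
have eo : insertion_order (shape T) = order_upto (shape T) 0 M by [].
rewrite /insert eo.
have <- : B 0 M = k by rewrite (trace_far tr).
apply: main; split=> //; first by rewrite (trace_far tr) // (trace_lt tr).
move=> i [|j] //; case: ifP => // h.
rewrite /bumped; case: ifP => // /andP[].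
rewrite [E i j]ent_cols; last by lia.
by have := ent_le i j.+1 bT; rewrite -/E; lia.
Qed.

(** * Insertion preserves tableaux *)

Lemma ent_inj N T T' : shape T = shape T' ->
  (forall i j, ent N T i j = ent N T' i j) -> T = T'.
Proof.
move=> sTT eTT; have sz : size T = size T' by rewrite -!(size_map size) -/(shape _) sTT.
apply: (@eq_from_nth _ [::]) => // i iT.
have szi : size (nth [::] T i) = size (nth [::] T' i).
  by have := congr1 (nth 0 ^~ i) sTT; rewrite !(nth_map [::]) -?sz.
by apply: (@eq_from_nth _ N) => // j _; apply: eTT.
Qed.

Lemma ent_mem N T r c : ent N T r c < N -> ent N T r c \in flatten T.
Proof.
rewrite /ent => lt; apply/flattenP; exists (nth [::] T r).
  case: (ltnP r (size T)) => rT; first exact: mem_nth.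
  by move: lt; rewrite (nth_default [::]) // nth_nil ltnn.
case: (ltnP c (size (nth [::] T r))) => h; first exact: mem_nth.
by move: lt; rewrite nth_default // ltnn.
Qed.

Lemma distinct_ent N T k : uniq (flatten T) -> k < N -> k \notin flatten T ->
  distinct N k (ent N T).
Proof.
move=> uT kN kT; split=> [|r c]; last first.
  move=> e; move/negP: kT; apply; rewrite -e; apply: ent_mem; rewrite e; exact: kN.
elim: T uT {k kN kT} => [_ r c r' c' _|w T IH]; first by rewrite /ent nth_nil nth_nil ltnn.
rewrite /= cat_uniq => /and3P[uw /hasPn h uT] [|r] c [|r'] c' /= e lt.
- move: e lt; rewrite /ent /= => e lt.
  have cw : c < size w by case: (ltnP c (size w)) lt => // ?; rewrite nth_default ?ltnn.
  have cw' : c' < size w by rewrite e in lt; case: (ltnP c' (size w)) lt => // ?; rewrite nth_default ?ltnn.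
  by move/eqP: e; rewrite nth_uniq // => /eqP ->.
- have lt' : ent N T r' c' < N by rewrite (_ : ent N T r' c' = ent N (w :: T) r'.+1 c') // -e.
  have := h _ (ent_mem lt'); move: e lt; rewrite /ent /= => <- lt /negP[].
  by apply: mem_nth; case: (ltnP c (size w)) lt => // ?; rewrite nth_default ?ltnn.
- have := h _ (@ent_mem N T r c lt); move: e lt; rewrite /ent /= => -> lt /negP[].
  by apply: mem_nth; case: (ltnP c' (size w)) lt => // ?; rewrite nth_default ?ltnn.
by case: (IH uT r c r' c' e lt) => -> ->.
Qed.

Definition tableau (N : nat) (T : filling) : Prop :=
  [/\ all (gtn N) (flatten T), 0 \notin shape T, uniq (flatten T)
    & syct N (size T) (ent N T)].

Lemma head_ent N T i : 0 \notin shape T -> i < size T ->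
  head 0 (nth [::] T i) = ent N T i 0.
Proof.
move=> sT iT; rewrite /ent; case e: (nth [::] T i) => [|x s] //=.
by case/negP: sT; apply/(nthP 0); exists i; rewrite ?size_map // (nth_map [::]) // e.
Qed.

Lemma add_row_split N T f : 0 \notin shape T ->
  (forall i j, i < j < size T -> ent N T i 0 < ent N T j 0) ->
  exists p, [/\ p <= size T, add_row f T = take p T ++ [:: f] :: drop p T,
    forall i, i < p -> ent N T i 0 < f & forall i, p <= i < size T -> f <= ent N T i 0].
Proof.
elim: T => [|w T IH] h0 inc; first by exists 0; split.
have h0' : 0 \notin shape T by move: h0; rewrite inE negb_or => /andP[].
have hw : head 0 w = ent N (w :: T) 0 0 by rewrite -(head_ent N (i := 0) h0).
case: (leqP f (head 0 w)) => fw.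
  have all_ge : all (fun r => f <= head 0 r) T.
    apply/allP => r /(nthP [::])[i iT <-]; rewrite (head_ent N) //.
  by apply: (leq_trans fw); rewrite hw; apply: ltnW; apply: (inc 0 i.+1).
  exists 0; split=> //=; last first.
    move=> i iT; rewrite -(head_ent N) //; case: i iT => //= i iT.
    by apply: (allP all_ge); rewrite mem_nth.
  rewrite /add_row /= ltnNge fw /=.
  have /all_filterP -> := all_ge.
  rewrite (_ : [seq _ <- _ | _] = [::]) //.
  apply/eqP; rewrite -(negbK (_ == _)) -has_filter; apply/hasPn => r /(allP all_ge).
  by rewrite -leqNgt.
case: (IH h0' _) => [i j ij|p [pT e lt ge]]; first by apply: (inc i.+1 j.+1).
exists p.+1; split=> //.
- by rewrite /add_row /= fw leqNgt fw /= -/(add_row f T) e.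
- by move=> [|i] ip; [rewrite -hw|apply: lt].
by move=> [|i] // ip; apply: ge.
Qed.

Lemma ent_insert_row N T p f i j : p <= size T ->
  ent N (take p T ++ [:: f] :: drop p T) i j = new_row N p f (ent N T) i j.
Proof.
move=> pT; rewrite /ent /new_row nth_cat size_takel //.
case: ltngtP => ip; first by rewrite nth_take.
  by case: i ip => // i ip; rewrite subSn //= nth_drop subnKC.
by rewrite ip subnn /=; case: j => [|[|j]].
Qed.

Lemma size_shape (T : filling) : size (shape T) = size T.
Proof. exact: size_map. Qed.

Lemma tableau_trace N T k : tableau N T -> k < N ->
  exists B, trace N (size T) (max_part (shape T)) k (ent N T) B.
Proof.
case=> bT _ _ _ kN; apply: trace_exists => //.
- by move=> r c; apply: ent_le.
- by move=> r c; apply: ent_rows.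
- by move=> r c; apply: ent_cols.
Qed.

Lemma nth_shape (T : filling) i : nth 0 (shape T) i = size (nth [::] T i).
Proof.
case: (ltnP i (size T)) => iT; first by rewrite (nth_map [::]).
by rewrite !nth_default // size_shape.
Qed.

Lemma syct_ext N m E E' : (forall i j, E' i j = E i j) -> syct N m E -> syct N m E'.
Proof.
by move=> e [h1 h2 h3]; split=> [r c|i j ij|i j c ij]; rewrite !e; auto.
Qed.

(* The new cell determines the previous shape: it lies in the lowest row of its
   length. *)
Variant insert_shape (N : nat) (T T' : filling) : nat -> Prop :=
  | GrowRow r of r < size T & shape T' = set_nth 0 (shape T) r (nth 0 (shape T) r).+1
      & (forall i, i < r -> nth 0 (shape T') i <> (nth 0 (shape T) r).+1) :
      insert_shape N T T' (nth 0 (shape T) r).+1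
  | GrowColumn p of p <= size T
      & shape T' = take p (shape T) ++ 1 :: drop p (shape T)
      & (forall i, i < p -> nth 0 (shape T) i <> 1) : insert_shape N T T' 1.

Lemma insert_tableau N T k : tableau N T -> k < N -> k \notin flatten T ->
  tableau N (insert k T).1 /\ insert_shape N T (insert k T).1 (insert k T).2.
Proof.
move=> tT kN kT; have [bT sT uT S] := tT.
have [B tr] := tableau_trace tT kN; have D := distinct_ent uT kN kT.
have perm := perm_insert k T.
have uT' : uniq (flatten (insert k T).1) by rewrite (perm_uniq perm) /= kT.
have bT' : all (gtn N) (flatten (insert k T).1).
  by rewrite (perm_all _ perm) /= kN.
have S' := syct_bumped tr S D.
case: (insertP bT tr) uT' bT' {perm}
  => [r c T' rT b new fin sT' eT'|T' fin sT' eT'] /= uT' bT'.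
- have ec : nth 0 (shape T) r = c.+1.
    rewrite nth_shape; apply/eqP; rewrite eqn_leq [X in X && _]leqNgt.
    rewrite -(ent_lt r c.+1 bT) new ltnn -(ent_lt r c bT).
    by case/andP: b => + _; move: fin; lia.
  have szT' : size T' = size T by rewrite -!size_shape sT' size_set_nth size_shape; lia.
  split.
    split=> //.
      rewrite sT'; apply/(nthP 0) => -[i iT]; rewrite nth_set_nth /=; case: (i =P r) => // _.
      rewrite size_set_nth size_shape in iT.
      by move/negP: sT => nsT e; apply: nsT; rewrite -e mem_nth // size_shape; lia.
    by rewrite szT'; apply: syct_ext S' => i j; rewrite eT'.
  rewrite -ec in sT' *; apply: GrowRow => // i ir; rewrite ec nth_shape => e.
  have := @new_cell_lowest _ _ _ _ _ _ tr S D r c i b new ir.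
  by rewrite -!eT' !ent_lt // e ltnn leqnn => /(_ isT).
have szT' : size T' = size T by rewrite -!size_shape sT'.
have nsT' : 0 \notin shape T' by rewrite sT'.
have [|p [pT eA lt ge]] := @add_row_split N T' (B 0 0) nsT'.
  by move=> i j; rewrite szT' !eT'; apply: (syct_col S').
have gt i : p <= i < size T -> B 0 0 < ent N T i 0.
  move=> pi; have := ge i; rewrite szT' eT' => /(_ pi) /=.
  by rewrite leq_eqVlt => /orP[/eqP/(new_row_neq tr D fin)|].
have {}lt i : i < p -> ent N T i 0 < B 0 0 by move=> /lt; rewrite eT'.
have eTnew i j : ent N (add_row (B 0 0) T') i j = new_row N p (B 0 0) (bumped (ent N T) B) i j.
  by rewrite eA ent_insert_row // /new_row !eT'.
have sT1 : shape (add_row (B 0 0) T') = take p (shape T) ++ 1 :: drop p (shape T).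
  by rewrite eA /shape map_cat /= map_take map_drop -/(shape _) sT'.
split.
  split=> //.
    rewrite sT1 mem_cat inE /= negb_or; apply/andP; split; apply/negP => h; case/negP: sT.
      exact: mem_take h.
    exact: mem_drop h.
  have -> : size (add_row (B 0 0) T') = (size T).+1.
    by rewrite eA size_cat /= addnS -size_cat cat_take_drop szT'.
  rewrite szT' in pT.
  by apply: syct_ext (syct_new_row tr S D fin pT lt gt) => i j; rewrite eTnew.
apply: GrowColumn sT1 _; first by rewrite -szT'.
move=> i ip; rewrite -sT' nth_shape => e.
have := new_row_lowest tr S D (lt _ ip) fin.
by rewrite -eT' ent_lt // ?e //; move: bT'; rewrite (perm_all _ (perm_add_row _ _)) => /andP[].
Qed.

(** * Growing the bottom row *)

Lemma trace_no_bump N m M k E B : trace N m M k E B ->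
  (forall r c, ~~ (E r c <= k < E r c.+1)) -> forall r c, B r c = k.
Proof.
move=> tr nb; apply: (@trace_ind m M) => [r c h|r c h IH|r c h IH].
- exact: trace_far tr _ _ h.
- by rewrite (trace_stable tr _ h) (trace_next tr).
by rewrite (trace_step tr) /bump_at IH (negbTE (nb _ _)).
Qed.

Lemma insert_new_row N T k : tableau N T -> k < N ->
  (forall i, i < size T -> k < ent N T i 0) -> insert k T = ([:: k] :: T, 1).
Proof.
move=> tT kN lt; have [bT sT uT S] := tT.
have [B tr] := tableau_trace tT kN.
have nb r c : ~~ (ent N T r c <= k < ent N T r c.+1).
  rewrite negb_and -ltnNge; apply/orP; left.
  case: (ltnP r (size T)) => rT; last by rewrite ent_rows.
  exact: leq_trans (lt r rT) (syct_rowle r S (leq0n c)).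
have eB := trace_no_bump tr nb.
case: (insertP bT tr) => [r c T' rT b|T' _ sT' eT'].
  by case/negP: (nb r c); move: b; rewrite /bump_at eB.
have eTT : T' = T.
  apply: (@ent_inj N) => // i [|j]; rewrite eT' //=.
  by rewrite /bump_at eB (negbTE (nb _ _)).
rewrite eTT eB; congr (_, _).
have all_gt : all (fun r => k <= head 0 r) T.
  by apply/allP => r /(nthP [::])[i iT <-]; rewrite (head_ent N) // ltnW ?lt.
have all_gt' : all (predC (fun r => head 0 r < k)) T.
  by apply: sub_all all_gt => r /=; rewrite -leqNgt.
rewrite /add_row; have /all_filterP -> := all_gt.
rewrite (_ : [seq _ <- _ | _] = [::]) //.
by apply/eqP; rewrite -(negbK (_ == _)) -has_filter -all_predC.
Qed.

(** If k exceeded the lowest first entry, the new row would be created above row 0, which would have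
    length 1 by the assumed shape; [new_row_lowest] forbids this. *)
Lemma insert_bottom_row N T k T' beta : tableau N T -> k < N -> k \notin flatten T ->
  insert k T = (T', 1) -> shape T' = 1 :: beta ->
  [/\ T' = [:: k] :: T, shape T = beta & forall i, i < size T -> k < ent N T i 0].
Proof.
move=> tT kN kT eI sT1; have [bT sT uT S] := tT.
have [B tr] := tableau_trace tT kN; have D := distinct_ent uT kN kT.
have lt i : i < size T -> k < ent N T i 0.
  move=> iT; suff lt0 : k < ent N T 0 0.
    apply: leq_trans lt0 _; case: i iT => // i iT.
    by apply: ltnW; apply: (syct_col S); rewrite iT.
  have sz : 0 < size T by case: (size T) iT.
  rewrite ltn_neqAle eq_sym; apply/andP; split; first by apply/eqP; apply: D.2.
  move: eI sT1; case: (insertP bT tr) => // U fin sU eU [<-].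
  case eqU : U => [|w V]; first by move: sz; rewrite -size_shape -sU eqU.
  apply: contra_eqT; rewrite -ltnNge => k_gt.
  have ltB : ent N T 0 0 < B 0 0 by apply: leq_trans k_gt (trace_ge_init tr _ _).
  have hw : head 0 w = ent N T 0 0.
    transitivity (ent N U 0 0); last exact: eU.
    by rewrite -(@head_ent N) ?sU -?size_shape ?sU ?size_shape // eqU.
  rewrite /add_row /= hw ltB /=; apply/eqP => -[ew _].
  have := new_row_lowest tr S D ltB fin; rewrite -eU.
  by rewrite eqU /ent /= nth_default ?ew // ltnn.
move: eI; rewrite (insert_new_row tT kN lt) => -[eT']; split=> //.
by move: sT1; rewrite -eT' => -[].
Qed.

(** A new cell in a higher row would leave the bottom row below it with the same length, against
    [new_cell_lowest]. *)
Lemma insert_bottom_cell N T k T' d beta :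
  tableau N T -> k < N -> k \notin flatten T ->
  insert k T = (T', d.+2) -> shape T' = d.+2 :: beta ->
  shape T = d.+1 :: beta /\
  exists B, [/\ trace N (size T) (max_part (shape T)) k (ent N T) B,
    bump_at (ent N T) B 0 d, ent N T 0 d.+1 = N, B 1 d < N &
    forall i j, ent N T' i j = bumped (ent N T) B i j].
Proof.
move=> tT kN kT eI sT1; have [bT sT uT S] := tT.
have [B tr] := tableau_trace tT kN; have D := distinct_ent uT kN kT.
have bT' : all (gtn N) (flatten T').
  by have := perm_insert k T; rewrite eI => /perm_all ->; rewrite /= kN.
move: eI; case: (insertP bT tr) => // r c U rT b new fin sU eU [eUT ec].
subst U c; case: r => [|r] in rT b new fin sU *.
  split; last by exists B.
  move: sU; rewrite sT1; case eT : T rT => [|w V] //= _ [->].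
  congr cons; apply/eqP; rewrite eqn_leq.
  move: b new; rewrite /bump_at eT /ent /= => /andP[h _] new; apply/andP; split.
    rewrite leqNgt; apply/negP => h1; have := ent_lt 0 d.+1 bT.
    by rewrite eT /ent /= new ltnn h1.
  rewrite ltnNge; apply/negP => h1; move: h; rewrite nth_default //.
  by rewrite leqNgt fin.
have := @new_cell_lowest _ _ _ _ _ _ tr S D r.+1 d 0 b new (ltn0Sn _).
by rewrite -!eU !ent_lt // -nth_shape sT1 /= ltnn => /(_ (ltnSn _)).
Qed.

(** The first change of the letter is made by k itself. This reduces questions about letters to
    comparisons of k with entries of E. *)
Lemma bump_first N m M k E B : trace N m M k E B -> forall r c,
  B r c = k \/ exists r' c', [/\ bump_at E B r' c', B r'.+1 c' = k,
     E r' c' <= k, c <= c' & c = c' -> r <= r'].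
Proof.
move=> tr; apply: (@trace_ind m M) => [r c h|r c h|r c h].
- by left; apply: (trace_far tr).
- rewrite (trace_stable tr _ h) (trace_next tr) => -[->|[r' [c' [h1 h2 h3 h4 h5]]]].
    by left.
  by right; exists r', c'; split=> //; lia.
move=> [e|[r' [c' [h1 h2 h3 h4 h5]]]]; last first.
  by right; exists r', c'; split=> // /h5; lia.
rewrite (trace_step tr r); case: ifP => b; last by left.
by right; exists r, c; split=> //; move: b; rewrite /bump_at e => /andP[].
Qed.

(** A row bumping lemma for adjacent new cells of the bottom row. If y < x, the letters of the
    second insertion stay strictly below those of the first in all columns right of d, so y would
    arrive at the bottom row below the entry that x has left at its end. *)
Lemma increasing_letters N m M M' x y E B B' d :
  trace N m M x E B -> distinct N x E ->
  trace N m M' y (bumped E B) B' ->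
  bump_at E B 0 d -> E 0 d.+1 = N -> B 1 d < N ->
  bump_at (bumped E B) B' 0 d.+1 -> x <= y.
Proof.
move=> tr D tr' b new fin b'; rewrite leqNgt; apply/negP => yx.
have finB r c : d < c -> B r c < N.
  by move=> dc; apply: leq_ltn_trans fin; apply: (trace_ge tr).
have key r c : d < c -> B' r c < B r c.
  move: r c; apply: (@trace_ind m (maxn M M')) => [r c h _|r c h IH dc|r c h IH dc].
  - by rewrite (trace_far tr) ?(trace_far tr') //; lia.
  - rewrite (trace_stable tr _ h) (trace_stable tr' _ h) (trace_next tr) (trace_next tr').
    by apply: IH; lia.
  have {IH} lt := IH dc.
  case: (boolP (bump_at E B r c)) => b1.
    rewrite (bump_after tr b1); move: (b1) => /andP[h1 h2].
    rewrite (trace_step tr') /=; case: ifP => _; last by lia.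
    by rewrite b1.
  rewrite (nbump_after tr b1) (trace_step tr' r); case: ifP => // b2.
  move: (b2); rewrite /bump_at /= (negbTE b1) => /andP[h1 h2].
  case: (nbump_case tr D b1 (finB _ _ dc)) => // h3.
  case: c => // c in dc lt b1 b2 h1 h2 h3 *.
  move: h1 => /=; case: ifP => b3 h1; last by lia.
  by have := @trace_ge _ _ _ _ _ _ tr c c.+1 r.+1 r.+1 (leqnn _); lia.
have := key 1 d.+1 (leqnn _); move: b'; rewrite /bump_at /= b => /andP[h1 h2].
by have := @trace_ge _ _ _ _ _ _ tr d d.+1 1 1 (leqnn _); lia.
Qed.

(** * Inserting a whole row *)

Lemma bracket (f : nat -> nat) y lo hi : lo < hi -> f lo <= y -> y < f hi ->
  exists j, lo <= j < hi /\ f j <= y < f j.+1.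
Proof.
elim: hi => // hi IH; rewrite ltnS leq_eqVlt => /orP[/eqP e|lt] h1 h2.
  by exists lo; rewrite e leqnn ltnSn -e h1 e.
case: (ltnP y (f hi)) => h3; last by exists hi; rewrite h3 h2 ltnSn ltnW.
by case: (IH lt h1 h3) => j [h4 h5]; exists j; split=> //; lia.
Qed.

(** Here d is the current length of the bottom row; for d = 0 that row does not exist yet. *)
Fixpoint bottom_run (beta : seq nat) (d : nat) (T : filling) (xs : seq nat)
    (F : filling) : Prop :=
  if xs is x :: xs' then
    [/\ (insert x T).2 = d.+1, shape (insert x T).1 = d.+1 :: beta
      & bottom_run beta d.+1 (insert x T).1 xs' F]
  else F = T.

Definition fresh (N : nat) (xs : seq nat) (T : filling) : bool :=
  all (gtn N) xs && uniq (xs ++ flatten T).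

Lemma fresh_insert N x xs T : fresh N (x :: xs) T ->
  [/\ x < N, x \notin flatten T & fresh N xs (insert x T).1].
Proof.
rewrite /fresh /= mem_cat negb_or -!andbA => /and5P[xN xsN xxs xT u]; split=> //.
rewrite xsN /=; have := perm_insert x T => p.
rewrite (perm_uniq (perm_cat (perm_refl xs) p)).
rewrite (perm_uniq (permEl (perm_catC _ _))) /= mem_cat negb_or xT xxs /=.
by rewrite (perm_uniq (permEl (perm_catC _ _))).
Qed.

Lemma run_increasing N beta d T x y xs F : tableau N T -> fresh N (x :: y :: xs) T ->
  bottom_run beta d T (x :: y :: xs) F -> x < y.
Proof.
move=> tT fr [c1 s1 [c2 s2 _]].
have [xN xT fr1] := fresh_insert fr; have [yN yT1 _] := fresh_insert fr1.
have [tT1 _] := insert_tableau tT xN xT; have [bT sT uT S] := tT.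
have xy : x != y by move: fr; rewrite /fresh /= inE !negb_or -!andbA => /and5P[_ _ _].
rewrite ltn_neqAle xy /=.
case eI1 : (insert x T) c1 s1 c2 s2 tT1 yT1 {fr1} => [T1 c] /= ec s1 c2 s2 tT1 yT1; subst c.
case eI2 : (insert y T1) c2 s2 => [T2 c] /= ec s2; subst c.
have [sT1 [B' [tr' b' new' fin' _]]] := insert_bottom_cell tT1 yN yT1 eI2 s2.
case: d => [|d] in eI1 s1 s2 eI2 sT1 b' new' fin' *.
  have [eT1 _ lt] := insert_bottom_row tT xN xT eI1 s1.
  subst T1; rewrite leqNgt; apply/negP => yx.
  (* For d = 0 the letter x is itself the new bottom row and the smallest first entry, so a letter y
     < x bumps nothing and cannot extend that row. *)
  have nb r c : ~~ (ent N ([:: x] :: T) r c <= y < ent N ([:: x] :: T) r c.+1).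
    rewrite negb_and -ltnNge; apply/orP; left.
    case: r => [|r]; first by case: c => [|[|c]].
    case: (ltnP r (size T)) => rT; last by rewrite ent_rows.
    apply: ltn_trans yx (leq_trans (lt r rT) _).
    exact: (syct_rowle r S (leq0n c)).
  by case/negP: (nb 0 0); move: b'; rewrite /bump_at (trace_no_bump tr' nb).
have [_ [B [tr b new fin eT1]]] := insert_bottom_cell tT xN xT eI1 s1.
have D := distinct_ent uT xN xT.
have sz : size T1 = size T.
  have [+ _] := insert_bottom_cell tT xN xT eI1 s1.
  by rewrite -!size_shape s1 => ->.
have tr1 : trace N (size T) (max_part (shape T1)) y (bumped (ent N T) B) B'.
  case: tr' => h1 h2 h3 h4 h5 h6; split=> //.
  - by move=> r c; rewrite -eT1.
  - by move=> r c; rewrite -eT1 -sz; apply: h2.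
  - by move=> r c; rewrite h3 /bump_at !eT1.
  - by move=> c; rewrite -sz.
by apply: (increasing_letters tr D tr1 b new fin); rewrite /bump_at -!eT1.
Qed.

(** As B 1 d is not N, no new cell has been made before the bottom row is reached in column d. *)
Lemma bump_inside N m M k E B d : trace N m M k E B -> B 1 d < N ->
  forall c e, d < e \/ d = e /\ 0 < c -> bump_at E B c e -> E c e.+1 < N.
Proof.
move=> tr fin c e h b; rewrite -(bump_after tr b); apply: leq_ltn_trans fin.
case: h => [h|[<- h]]; first by apply: (trace_ge tr).
by apply: (trace_mono tr).
Qed.

Lemma ent_shape N T r c : all (gtn N) (flatten T) ->
  (ent N T r c < N) = (c < nth 0 (shape T) r).
Proof. by move=> bT; rewrite ent_lt // nth_shape. Qed.

(* If x bumped an entry beyond the column in which the bottom row grows, then so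
   would each of the following, larger, letters, further and further to the
   right; the row lengths leave no room for that. *)
Lemma no_far_bump N beta a xs x d T F : tableau N T -> fresh N (x :: xs) T ->
  shape T = d.+1 :: beta -> bottom_run beta d.+1 T (x :: xs) F ->
  all (geq a) beta -> d.+1 + (size xs).+1 = a ->
  forall c e, 0 < c -> d < e -> ent N T c e <= x < ent N T c e.+1 ->
  ent N T c e.+1 = N.
Proof.
elim: xs x d T => [|y xs IH] x d T tT fr sT run le_a ea c e c0 de h.
  have [bT _ _ _] := tT; apply/eqP; rewrite eqn_leq ent_le //= leqNgt ent_shape // sT.
  rewrite -leqNgt; case: c c0 h => // c _ _ /=.
  case: (ltnP c (size beta)) => h; last by rewrite nth_default.
  by have := allP le_a _ (mem_nth 0 h); rewrite /= in ea *; lia.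
apply/eqP; rewrite eqn_leq ent_le ?(tT.1) //=; last by case: tT.
rewrite leqNgt; apply/negP => finE.
have xy := run_increasing tT fr run.
have [xN xT fr1] := fresh_insert fr.
have [tT1 _] := insert_tableau tT xN xT; have [bT _ uT S] := tT.
case: run; case eI1 : (insert x T) tT1 fr1 => [T1 c1] /= tT1 fr1 ec s1 run; subst c1.
have [_ [B [tr b new fin eT1]]] := insert_bottom_cell tT xN xT eI1 s1.
have [c' [e' [b' eB ee' c0']]] : exists c' e', [/\ bump_at (ent N T) B c' e',
    B c'.+1 e' = x, e <= e' & 0 < c'].
  have aux c' e' : e <= e' -> bump_at (ent N T) B c' e' -> 0 < c'.
    case: c' => // ee' /andP[h1 _].
    have lt1 : B 1 e' <= B 1 d by apply: (trace_ge tr); apply: leq_trans ee'.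
    have : ent N T 0 e' < N by lia.
    by rewrite ent_shape // sT /=; lia.
  case: (bump_first tr c.+1 e) => [eB|[c' [e' [h1 h2 _ h4 _]]]].
    by exists c, e; split=> //; rewrite /bump_at eB.
  by exists c', e'; split=> //; apply: aux h4 h1.
have b1T : ent N T1 c' e'.+1 = x by rewrite eT1 /= b' eB.
have bT1 : all (gtn N) (flatten T1) by case: tT1.
have [yN yT1 _] := fresh_insert fr1.
case: (run); case eI2 : (insert y T1) => [T2 c2] /= ec s2 _; subst c2.
have [_ [B' [tr' bb' new' fin' _]]] := insert_bottom_cell tT1 yN yT1 eI2 s2.
pose len := nth 0 (shape T1) c'.
have len_gt : e'.+1 < len by rewrite -(@ent_shape N) // b1T.
have [j [jlt jb]] : exists j, e'.+1 <= j < len /\ ent N T1 c' j <= y < ent N T1 c' j.+1.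
  apply: bracket => //; first by rewrite b1T ltnW.
  suff -> : ent N T1 c' len = N by [].
  by apply/eqP; rewrite eqn_leq ent_le //= leqNgt ent_shape // ltnn.
have dj : d.+1 < j.
  by case/andP: jlt => h1 _; apply: leq_trans h1; apply: leq_trans de ee'.
have jN : ent N T1 c' j.+1 = N.
  by apply: (IH y d.+1 T1 tT1 fr1 s1 run le_a) jb => //; rewrite -ea /= !addSn !addnS.
have finj : B' c'.+1 j < N.
  by apply: leq_ltn_trans fin'; apply: (trace_ge tr').
have bj : bump_at (ent N T1) B' c' j.
  rewrite /bump_at jN finj andbT; apply: leq_trans (trace_ge_init tr' _ _).
  by case/andP: jb.
by have := bump_inside tr' fin' (or_introl dj) bj; rewrite jN ltnn.
Qed.

(** An entry at most x to the right of column d would leave a place for x in row c, by [no_far_bump]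
    at the end of the row. Whatever letter arrives there is at least x and would create a cell
    before the bottom row is reached. *)
Lemma run_large N beta a xs x d T F : tableau N T -> fresh N (x :: xs) T ->
  shape T = d.+1 :: beta -> bottom_run beta d.+1 T (x :: xs) F ->
  all (geq a) beta -> d.+1 + (size xs).+1 = a ->
  forall c e, 0 < c -> d < e -> x < ent N T c e.
Proof.
move=> tT fr sT run le_a ea c e c0 de.
have noH := no_far_bump tT fr sT run le_a ea.
have [xN xT fr1] := fresh_insert fr; have [bT _ uT S] := tT.
case: (run); case eI1 : (insert x T) => [T1 c1] /= ec s1 _; subst c1.
have [_ [B [tr b new fin eT1]]] := insert_bottom_cell tT xN xT eI1 s1.
rewrite ltnNge; apply/negP => h.
pose len := nth 0 (shape T) c.
have len_gt : e < len by rewrite -(@ent_shape N) //; apply: leq_ltn_trans h xN.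
have [j [jlt jb]] : exists j, e <= j < len /\ ent N T c j <= x < ent N T c j.+1.
  apply: bracket => //.
  suff -> : ent N T c len = N by [].
  by apply/eqP; rewrite eqn_leq ent_le //= leqNgt ent_shape // ltnn.
have dj : d < j by case/andP: jlt => h1 _; apply: leq_trans de h1.
have jN : ent N T c j.+1 = N by apply: noH jb.
have finj : B c.+1 j < N.
  by apply: leq_ltn_trans fin; apply: (trace_ge tr).
have bj : bump_at (ent N T) B c j.
  rewrite /bump_at jN finj andbT; apply: leq_trans (trace_ge_init tr _ _).
  by case/andP: jb.
by have := bump_inside tr fin (or_introl dj) bj; rewrite jN ltnn.
Qed.

(** To the left of the new cell the letter is N; to the right of it nothing is bumped by
    assumption. *)
Lemma bumped_other_columns N m M k E B d :
  trace N m M k E B -> bump_at E B 0 d -> E 0 d.+1 = N ->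
  (forall r c, d < c -> ~~ bump_at E B r c) ->
  forall r c, c != d.+1 -> bumped E B r c = E r c.
Proof.
move=> tr b new nb r [|c] //=; rewrite eqSS => cd.
case: ifP => // b1; case: (ltngtP c d) cd => // cd _; last by case/negP: (nb r c cd).
have eN : B r.+1 c = N.
  apply/eqP; rewrite eqn_leq (trace_leN tr) /= -{1}new -(bump_after tr b).
  by apply: (trace_ge tr).
by move: b1; rewrite /bump_at eN => /andP[_]; have := trace_le tr r c.+1; lia.
Qed.

(** Downward induction on c. The empty cell (j, b) excludes the second alternative of the triple
    condition in the last column of row j, and each column then excludes it in the previous one.
    This is the source of the relation between rows i < j with alpha_i > alpha_j. *)
Lemma short_row_gt N m E i j b : syct N m E -> i < j -> E i b < N -> E j b = N ->
  forall c, c < b -> E i c.+1 < E j c.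
Proof.
move=> S ij fin_i end_j c cb.
have fin c' : c' <= b -> E i c' < N.
  by move=> h; apply: leq_ltn_trans fin_i; apply: syct_rowle S h.
move: {1}(b - c.+1) (erefl (b - c.+1)) => q; elim: q c cb => [|q IH] c cb eq.
  have e : c.+1 = b by lia.
  by case: (syct_tri S ij (fin c.+1 cb)) => //; rewrite e end_j; lia.
have h : E i c.+2 < E j c.+1 by apply: IH; lia.
case: (syct_tri S ij (fin c.+1 cb)) => //.
by have := syct_row S i c.+1; lia.
Qed.

(** Letter i of the run acts only on column d.+1 + i: before the run it is smaller than the entries
    above the bottom row there, and after the run it is the minimum of that column. [run_in] names
    no row, since the letter need not end in the bottom row. *)
Record run_spec (N a d : nat) (T : filling) (xs : seq nat) (F : filling) : Prop :=
  RunSpec {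
    run_left : forall r c, c <= d -> ent N F r c = ent N T r c;
    run_lt : forall r i, 0 < r -> i < size xs -> nth 0 xs i < ent N T r (d.+1 + i);
    run_ge : forall r i, i < size xs -> nth 0 xs i <= ent N F r (d.+1 + i);
    run_in : forall i, i < size xs -> exists r, ent N F r (d.+1 + i) = nth 0 xs i;
    run_short : forall r c, 0 < r -> nth 0 (shape T) r < a ->
      ent N F r c = ent N T r c }.

Lemma bottom_run_tableau N beta xs d T F : tableau N T -> fresh N xs T ->
  bottom_run beta d T xs F -> tableau N F.
Proof.
elim: xs d T => [|x xs IH] d T tT fr /=; first by move=> ->.
case=> _ _; have [xN xT fr1] := fresh_insert fr.
by apply: IH => //; case: (insert_tableau tT xN xT).
Qed.

Lemma bottom_run_shape beta xs d T F : shape T = d.+1 :: beta ->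
  bottom_run beta d.+1 T xs F -> shape F = (d.+1 + size xs) :: beta.
Proof.
elim: xs d T => [|x xs IH] d T sT /=; first by move=> ->; rewrite addn0.
by case=> _ s1 /(IH _ _ s1) ->; rewrite addnS.
Qed.

Lemma run_specP N beta a xs d T F : tableau N T -> fresh N xs T ->
  shape T = d.+1 :: beta -> bottom_run beta d.+1 T xs F ->
  all (geq a) beta -> d.+1 + size xs = a -> run_spec N a d T xs F.
Proof.
elim: xs d T => [|x xs IH] d T tT fr sT run le_a ea.
  by move: run => /= ->; split.
have large := run_large tT fr sT run le_a ea.
have tF := bottom_run_tableau tT fr run; have sF := bottom_run_shape sT run.
have [xN xT fr1] := fresh_insert fr.
have [tT1 _] := insert_tableau tT xN xT; have [bT _ uT S] := tT.
case: (run); case eI1 : (insert x T) tT1 fr1 => [T1 c1] /= tT1 fr1 ec s1 run1; subst c1.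
have [_ [B [tr b new fin eT1]]] := insert_bottom_cell tT xN xT eI1 s1.
have finB r c : d < c -> B r c < N.
  by move=> dc; apply: leq_ltn_trans fin; apply: (trace_ge tr).
have row0N c : d < c -> ent N T 0 c = N.
  move=> dc; apply/eqP; rewrite eqn_leq ent_le //= leqNgt ent_shape // sT /=.
  by rewrite -leqNgt.
have eBx r c : d < c -> B r c = x.
  move=> dc; case: (bump_first tr r c) => // -[r' [c' [b1 eB h le cc']]].
  have dc' : d < c' by apply: leq_trans dc le.
  case: r' => [|r'] in b1 eB h cc' *.
    by move: h; rewrite row0N // leqNgt xN.
  by move: h; rewrite leqNgt large.
have nb r c : d < c -> ~~ bump_at (ent N T) B r c.
  move=> dc; rewrite /bump_at eBx // negb_and -!ltnNge; case: r => [|r].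
    by rewrite row0N // xN.
  by rewrite large.
have eBm : B (size T) d = x by rewrite (trace_next tr) eBx.
have other := bumped_other_columns tr b new nb.
have IHF := IH d.+1 T1 tT1 fr1 s1 run1 le_a.
case: IHF => [|F1 F2 F3 F4 F5]; first by rewrite -ea /= addSnnS.
have sz0 : nth 0 (shape F) 0 = a by rewrite sF -ea.
split.
- move=> r c cd; rewrite F1 ?eT1 ?other //; last by apply: leq_trans cd _.
  by apply: contraTneq cd => ->; rewrite ltnn.
- move=> r [|i] r0 /= ilt; first by rewrite addn0 large.
  have := F2 r i r0 ilt; rewrite addSnnS => h; apply: leq_trans h _.
  by rewrite eT1 bumped_le.
- move=> r [|i] /= ilt; last by rewrite -addSnnS; apply: F3.
  rewrite addn0 F1 // eT1 /=; case: ifP => _; first exact: trace_ge_init tr _ _.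
  case: r => [|r]; first by rewrite new ltnW.
  by rewrite ltnW ?large.
- move=> [|i] /= ilt; last by have [r e] := F4 i ilt; exists r; rewrite -addSnnS.
  (* The letter leaves row 0 as N, so it changes in column d.+1; its first change puts x there. *)
  have h : B 0 d = N by rewrite (bump_after tr b).
  suff [r [b1 e]] : exists r, bump_at (ent N T) B r d /\ B r.+1 d = x.
    by exists r; rewrite addn0 F1 // eT1 /= b1 e.
  case: (bump_first tr 0 d) => [e|[r [c [b1 e _ le _]]]].
    by move: xN; rewrite -e h ltnn.
  have ec : c = d.
    by apply/eqP; rewrite eqn_leq le andbT leqNgt; apply/negP => lt; case/negP: (nb r c lt).
  by exists r; rewrite -ec.
move=> r c r0 short.
have shortT1 : nth 0 (shape T1) r < a by move: short; rewrite s1 sT; case: (r) r0.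
rewrite F5 // eT1; case: (eqVneq c d.+1) => [->|]; last exact: other.
rewrite /=; case: ifP => // b1; exfalso; case/andP: b1 => h1 h2.
have bF : all (gtn N) (flatten F) by case: tF.
have SF : syct N (size F) (ent N F) by case: tF.
have eF : ent N F r d = ent N T r d.
  by rewrite F5 // eT1 other // neq_ltn ltnSn.
have endr : ent N F r (nth 0 (shape F) r) = N.
  by apply/eqP; rewrite eqn_leq ent_le //= leqNgt ent_shape // ltnn.
have sFr : nth 0 (shape F) r < a by move: short; rewrite sF sT; case: (r) r0.
have dF : d < nth 0 (shape F) r.
  rewrite -(@ent_shape N) // eF; apply: leq_ltn_trans h1 _; apply: leq_trans h2 _.
  exact: ent_le.
(* In the final tableau the bottom row is longer than row r, so its entry in column d.+1, namely B 1
   d, is smaller than the entry (r, d). A bump in row r would make the letter at least that entry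
   before it reaches the bottom row. *)
have := short_row_gt SF r0 _ endr dF; rewrite ent_shape // sz0 => /(_ sFr).
rewrite eF F1 // eT1 /= b => h3.
have : B r.+1 d <= B 1 d by apply: (trace_mono tr).
by move: h1 h3; clear; lia.
Qed.

Lemma insert_bottom N T k d beta B : tableau N T -> shape T = d.+1 :: beta ->
  trace N (size T) (max_part (shape T)) k (ent N T) B ->
  (forall r c, d < c -> ~~ bump_at (ent N T) B r c) ->
  (forall r, 0 < r -> bump_at (ent N T) B r d -> ent N T r d.+1 < N) ->
  bump_at (ent N T) B 0 d -> ent N T 0 d.+1 = N ->
  [/\ (insert k T).2 = d.+2, shape (insert k T).1 = d.+2 :: beta &
      forall i j, ent N (insert k T).1 i j = bumped (ent N T) B i j].
Proof.
move=> [bT _ _ _] sT tr nb inner b new.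
have BN : B 0 d = N by rewrite (bump_after tr b).
case: (insertP bT tr) => [r c T' rT b' new' fin sT' eT'|T' fin _ _] /=; last first.
  have : B 0 d <= B 0 0 by case: d {sT nb inner b new} BN => // d _; apply: (trace_ge tr).
  by rewrite BN leqNgt fin.
have ec : c = d.
  case: (ltngtP c d) => // h; last by case/negP: (nb r c h).
  have : B 0 d <= B r.+1 c by apply: (trace_ge tr).
  by rewrite BN leqNgt fin.
subst c; case: r => [|r] in rT b' new' fin sT' *; last first.
  by have := inner r.+1 isT b'; rewrite new' ltnn.
by split=> //; rewrite sT' sT.
Qed.

(** Row by row from the top: if x bumps E r d.+1, the letter left there is at most the one that the
    next insertion brings to row r one column further right. That one either bumps or exceeds the
    entry in column d.+2, which is at least E r d.+1. *)
Lemma next_letter_ge N m M M' x y E B B' d :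
  trace N m M x E B -> trace N m M' y (bumped E B) B' -> syct N m E ->
  B m d = x -> x < y -> forall r, B r d <= B' r d.+1.
Proof.
move=> tr tr' S eB xy r.
move: {1}(m - r) (erefl (m - r)) => q; elim: q r => [|q IH] r er.
  rewrite (trace_stable tr (r := r)); last by lia.
  by rewrite eB ltnW //; apply: leq_trans xy (trace_ge_init tr' _ _).
have {}IH : B r.+1 d <= B' r.+1 d.+1 by apply: IH; lia.
case: (boolP (bump_at E B r d)) => b; last first.
  by rewrite (nbump_after tr b); apply: leq_trans IH (trace_mono tr' _ (leqnSn _)).
have h : E r d.+1 <= bumped E B r d.+2.
  by rewrite /=; case: ifP => [/andP[]|_] //; apply: syct_row S _ _.
rewrite (bump_after tr b) (trace_step tr').
case: ifPn => // b'; apply: leq_trans h _; rewrite leqNgt; apply: contra b' => h.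
by rewrite /bump_at [X in X <= _]/= b IH.
Qed.

(** The two bounds on entries of T stand for the relations with all upper rows and with the rows
    shorter than a. The last hypothesis is an invariant of the run, renewed by [next_letter_ge]: a
    letter larger than the previous one reaches the bottom row with a value at least its last entry,
    and so is appended there. *)
Lemma run_exists N beta a xs d x T : tableau N T -> fresh N xs T ->
  shape T = d.+1 :: beta -> all (geq a) beta -> d.+1 + size xs = a ->
  (forall i j, i < j -> 1 < nth 0 beta i -> nth 0 beta j <= nth 0 beta i) ->
  path ltn x xs ->
  (forall r i, i < size xs -> nth 0 xs i < ent N T r.+1 (d.+1 + i)) ->
  (forall r i, nth 0 beta r < a -> i < size xs -> nth 0 xs i < ent N T r.+1 (d + i)) ->
  (forall y M B, x < y -> trace N (size T) M y (ent N T) B -> ent N T 0 d <= B 1 d) ->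
  exists F, bottom_run beta d.+1 T xs F.
Proof.
elim: xs d x T => [|y xs IH] d x T tT fr sT le_a ea sh srt lt1 lt2 J; first by exists T.
have [yN yT fr1] := fresh_insert fr; have [tT1 _] := insert_tableau tT yN yT.
have [bT _ _ S] := tT; have [B tr] := tableau_trace tT yN.
move: srt => /= /andP[xy srt].
have da : d.+1 < a by rewrite -ea /= -addSnnS ltn_addr.
have large r c : d < c -> y < ent N T r.+1 c.
  by move=> dc; have := lt1 r 0 isT; rewrite addn0 => /leq_trans; apply; apply: syct_rowle S dc.
have row0N c : d < c -> ent N T 0 c = N.
  move=> dc; apply/eqP; rewrite eqn_leq ent_le //= leqNgt ent_shape // sT /=.
  by rewrite -leqNgt.
have lenT r : nth 0 (shape T) r.+1 = nth 0 beta r by rewrite sT.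
have eBy r c : d < c -> B r c = y.
  move=> dc; case: (bump_first tr r c) => // -[r' [c' [b1 eB h le cc']]].
  have dc' : d < c' by apply: leq_trans dc le.
  case: r' => [|r'] in b1 eB h cc' *.
    by move: h; rewrite row0N // leqNgt yN.
  by move: h; rewrite leqNgt large.
have nb r c : d < c -> ~~ bump_at (ent N T) B r c.
  move=> dc; rewrite /bump_at eBy // negb_and -!ltnNge; case: r => [|r].
    by rewrite row0N // yN.
  by rewrite large.
have eBm : B (size T) d = y by rewrite (trace_next tr) eBy.
(* A letter bumping a short row r has been changed before, and y made the first change in a higher
   row r' of length at least a. By tameness row r then has length 1, so d = 0, and the increasing
   first column contradicts that y is below the entry of row r and not below that of row r'. *)
have short r : nth 0 beta r < a -> ~~ bump_at (ent N T) B r.+1 d.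
  move=> ra; apply/negP => /andP[h1 h2].
  have yE : y < ent N T r.+1 d by have := lt2 r 0 ra isT; rewrite addn0.
  have rfin : ent N T r.+1 d < N.
    by apply: leq_ltn_trans h1 (leq_trans h2 (ent_le _ _ bT)).
  case: (bump_first tr r.+2 d) => [e|[r' [c' [b1 e h3 dc' rr']]]].
    by move: yE; rewrite ltnNge -e h1.
  have ec : c' = d.
    by apply/eqP; rewrite eqn_leq dc' andbT leqNgt; apply/negP => lt; case/negP: (nb r' c' lt).
  subst c'; have {}rr' := rr' erefl; case: r' => // r' in b1 e h3 rr' *.
  have lr' : a <= nth 0 beta r'.
    rewrite leqNgt; apply/negP => lt.
    by have := lt2 r' 0 lt isT; rewrite addn0 ltnNge h3.
  have r1 : nth 0 beta r <= 1.
    rewrite leqNgt; apply/negP => lt; have := sh r r' rr' lt.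
    by rewrite leqNgt (leq_trans ra lr').
  have d0 : d = 0.
    by move: rfin; rewrite ent_shape // lenT => h; apply/eqP; rewrite -leqn0 -ltnS (leq_trans h).
  subst d; have := @syct_col _ _ _ S r.+1 r'.+1 _.
  have -> : r.+1 < r'.+1 < size T.
    rewrite rr' /= -size_shape sT ltnS ltnNge; apply/negP => h.
    by move: lr'; rewrite nth_default // leqNgt (leq_ltn_trans _ da).
  by move=> /(_ isT); rewrite ltnNge (leq_trans h3) // ltnW.
have inner r : 0 < r -> bump_at (ent N T) B r d -> ent N T r d.+1 < N.
  case: r => // r _ b; rewrite ent_shape // lenT; apply: leq_trans da _.
  by rewrite leqNgt; apply: contraL b; apply: short.
have fin1 : B 1 d < N.
  suff H q r : 0 < r -> q = (size T - r) -> B r d < N by exact: (H (size T - 1) 1).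
  elim: q r => [|q IHq] r r0 er.
    rewrite (trace_stable tr (r := r)); first by rewrite eBm.
    by rewrite -subn_eq0 er.
  case: (boolP (bump_at (ent N T) B r d)) => b.
    by rewrite (bump_after tr b); apply: inner.
  by rewrite (nbump_after tr b); apply: IHq => //; rewrite subnS -er.
have b : bump_at (ent N T) B 0 d by rewrite /bump_at (J _ _ _ xy tr) row0N.
have new : ent N T 0 d.+1 = N by rewrite row0N.
have [c1 s1 eT1] := insert_bottom tT sT tr nb inner b new.
have other := bumped_other_columns tr b new nb.
have ea1 : d.+2 + size xs = a by rewrite -ea /= addSnnS.
have [r i il|r i ra il|z M B' yz tr'|F run] := IH d.+1 y _ tT1 fr1 s1 le_a ea1 sh srt.
- rewrite eT1 other; last by rewrite gtn_eqF // ltn_addr.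
  by have := lt1 r i.+1 il; rewrite -addSnnS.
- rewrite eT1; case: i il => [|i] il; last first.
    rewrite other; last by rewrite gtn_eqF // addnS ltnS leq_addr.
    by have := lt2 r i.+2 ra il; rewrite -addSnnS.
  rewrite addn0 /= (negbTE (short _ ra)).
  by have := lt2 r 1 ra il; rewrite addn1.
- rewrite eT1 /= b; have szT1 : size (insert y T).1 = size T.
    by rewrite -!size_shape s1 sT.
  have tr1 : trace N (size T) M z (bumped (ent N T) B) B'.
    case: tr' => h1 h2 h3 h4 h5 h6; split=> //.
    + by move=> r c; rewrite -eT1.
    + by move=> r c; rewrite -eT1 -szT1; apply: h2.
    + by move=> r c; rewrite h3 /bump_at !eT1.
    + by move=> c; rewrite -szT1.
  exact: next_letter_ge tr tr1 S eBm yz _.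
by exists F.
Qed.

(** * Compatible fillings *)

Definition inserts (P : filling) (xs : seq nat) : filling :=
  foldl (fun P k => (insert k P).1) P xs.

(** Rows are listed from the bottom, so [foldr] inserts the top row first. *)
Definition build (T : filling) : filling :=
  foldr (fun x P => inserts P x) [::] T.

Fixpoint runs (T : filling) : Prop :=
  if T is x :: T' then
    runs T' /\ bottom_run (shape T') 0 (build T') x (build T)
  else True.

Lemma bottom_run_inserts beta d T xs F : bottom_run beta d T xs F -> F = inserts T xs.
Proof. by elim: xs d T => [|x xs IH] d T //= [_ _ /IH]. Qed.

Lemma bottom_run_sorted N beta d T xs F : tableau N T -> fresh N xs T ->
  bottom_run beta d T xs F -> sorted ltn xs.
Proof.
elim: xs d T => [|x [|y xs] IH] d T tT fr run //.
have [xN xT fr1] := fresh_insert fr; have [tT1 _] := insert_tableau tT xN xT.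
apply/andP; split; first exact: run_increasing tT fr run.
by case: run => _ _ run1; apply: IH run1.
Qed.

(** What is kept of a shuffle of a partition with ones: ones may stand anywhere, but a larger part
    bounds everything after it. *)
Definition tame (alpha : seq nat) : Prop :=
  (0 \notin alpha) /\
  forall i j, i < j -> 1 < nth 0 alpha i -> nth 0 alpha j <= nth 0 alpha i.

Record compatible (alpha : seq nat) (g : nat -> nat -> nat) : Prop := Compatible {
  compatible_row : forall i j, j.+1 < nth 0 alpha i -> g i j < g i j.+1;
  compatible_one : forall i i', i < i' < size alpha -> nth 0 alpha i = 1 ->
    g i 0 < g i' 0;
  compatible_eq : forall i i' j, i < i' -> nth 0 alpha i = nth 0 alpha i' ->
    j < nth 0 alpha i' -> g i j < g i' j;
  compatible_gt : forall i i' j, i < i' -> nth 0 alpha i' < nth 0 alpha i ->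
    j < nth 0 alpha i' -> g i j.+1 < g i' j }.

Lemma tame_tail a alpha : tame (a :: alpha) -> tame alpha.
Proof.
case=> h0 h; split; first by move: h0; rewrite inE negb_or => /andP[].
by move=> i j ij; apply: (h i.+1 j.+1).
Qed.

Lemma tame_head a alpha : tame (a :: alpha) -> a = 1 \/ 1 < a /\ all (geq a) alpha.
Proof.
case; rewrite inE negb_or => /andP[a0 _] h.
have [->|a1] : a = 1 \/ 1 < a by lia.
  by left.
right; split=> //; apply/allP => b /(nthP 0)[i _ <-]; exact: (h 0 i.+1).
Qed.

(* Inserting T row by row permutes the entries within a column, but only among
   the rows of equal length; what survives of this is that the two fillings
   have the same lower bounds for each column and row length. *)
Definition same_bounds (N : nat) (T P : filling) : Prop := forall b c y, y < N ->
  (forall r, nth 0 (shape T) r = b -> y < ent N P r c) <->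
  (forall r, nth 0 (shape T) r = b -> y < ent N T r c).

Lemma same_bounds_cons N T P x : same_bounds N T P -> 
  same_bounds N (x :: T) (x :: P).
Proof.
move=> h b c y yN; split=> lt [|r] /= e; try exact: (lt 0).
  by apply: (proj1 (h b c y yN)) e => r' e'; apply: (lt r'.+1).
by apply: (proj2 (h b c y yN)) e => r' e'; apply: (lt r'.+1).
Qed.

Lemma ent_cons N x T r c : ent N (x :: T) r.+1 c = ent N T r c.
Proof. by []. Qed.

(** Shorter rows keep their entries, and longer ones do not exist. For rows of length a both sides
    say that y is smaller than the letter inserted in that column: it is the minimum over these
    rows, in F by [run_ge] and [run_in], in the new T by [run_lt] and the bounds for P. *)
Lemma same_bounds_run N a x0 xs T P F :
  same_bounds N T P -> shape P = shape T -> all (geq a) (shape T) ->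
  a = (size xs).+1 -> all (gtn N) (flatten T) -> all (gtn N) (flatten F) ->
  shape F = a :: shape T -> all (gtn N) (x0 :: xs) ->
  run_spec N a 0 ([:: x0] :: P) xs F -> same_bounds N ((x0 :: xs) :: T) F.
Proof.
move=> sb sP le_a ea bT bF sF bx [F1 F2 F3 F4 F5] b c y yN.
have len r : nth 0 (shape T) r <= a.
  case: (ltnP r (size (shape T))) => h; last by rewrite nth_default.
  by apply: (allP le_a); rewrite mem_nth.
have xsN i : i < size xs -> nth 0 xs i < N.
  by move=> h; move: bx => /= /andP[_ /allP]; apply; rewrite mem_nth.
case: (ltngtP b a) => ba.
- split=> lt [|r] /= e; try by move: ba; rewrite -e ea /= ltnn.
    apply: (proj1 (sb b c y yN)) e => r' e'.
    have := lt r'.+1 e'; rewrite F5 //= sP; by rewrite e'.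
  rewrite F5 //=; last by rewrite sP e.
  apply: (proj2 (sb b c y yN)) e => r' e'; exact: (lt r'.+1).
- split=> _ [|r] /= e; try by move: ba; rewrite -e ea /= ltnn.
    by move: (len r); rewrite e leqNgt ba.
  by move: (len r); rewrite e leqNgt ba.
subst b; case: c => [|c].
  split=> lt [|r] /= e.
  - by have := lt 0 _; rewrite F1 // => -> //; rewrite /= ea.
  - apply: (proj1 (sb a 0 y yN)) e => r' e'.
    by have := lt r'.+1 e'; rewrite F1.
  - by rewrite F1 //; apply: (lt 0).
  - by rewrite F1 //; apply: (proj2 (sb a 0 y yN)) e => r' e'; exact: (lt r'.+1).
case: (ltnP c (size xs)) => cx; last first.
  have large U r : all (gtn N) (flatten U) -> nth 0 (shape U) r = a -> y < ent N U r c.+1.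
    move=> bU e; suff -> : ent N U r c.+1 = N by [].
    by apply/eqP; rewrite eqn_leq ent_le //= leqNgt ent_shape // e ea ltnS -leqNgt.
  split=> _ r e; apply: large => //.
  - by move: bx; rewrite /= all_cat bT andbT.
  - by rewrite sF; case: r e => //= <-.
have e0 : ent N ((x0 :: xs) :: T) 0 c.+1 = nth 0 xs c by apply: set_nth_default.
split=> lt.
  have yx : y < nth 0 xs c.
    have [r e] := F4 c cx; rewrite -e add1n; case: r e => [|r] e.
      by apply: lt; rewrite /= ea.
    case: (ltnP (nth 0 (shape T) r) a) => ra; last first.
      by apply: (lt r.+1); apply/eqP; rewrite /= eqn_leq len.
    have := F2 r.+1 c isT cx; rewrite -F5 //=; last by rewrite sP.
    by rewrite e ltnn.
  move=> [|r] e; first by rewrite e0.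
  apply: ltn_trans yx _; apply: (proj1 (sb a c.+1 _ (xsN _ cx))) e => r' e'.
  by have := F2 r'.+1 c isT cx; rewrite add1n.
have yx : y < nth 0 xs c by rewrite -e0; apply: lt; rewrite /= ea.
by move=> r _; apply: leq_trans yx _; have := F3 r c cx; rewrite add1n.
Qed.

Lemma perm_inserts xs P : perm_eq (flatten (inserts P xs)) (xs ++ flatten P).
Proof.
elim: xs P => //= x xs IH P; apply: (perm_trans (IH _)).
rewrite -[x :: _]cat1s perm_sym perm_catCA perm_cat2l perm_sym; exact: perm_insert.
Qed.

Lemma perm_build T : perm_eq (flatten (build T)) (flatten T).
Proof.
elim: T => //= x T IH; apply: (perm_trans (perm_inserts _ _)).
by rewrite perm_cat2l.
Qed.

Lemma compatible_tail a alpha g : compatible (a :: alpha) g ->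
  compatible alpha (fun i j => g i.+1 j).
Proof.
case=> h1 h2 h3 h4; split.
- by move=> i j; apply: (h1 i.+1).
- by move=> i i' ii; apply: (h2 i.+1 i'.+1).
- by move=> i i' j ii; apply: (h3 i.+1 i'.+1).
- by move=> i i' j ii; apply: (h4 i.+1 i'.+1).
Qed.

Lemma compatible_cons a alpha g : compatible alpha (fun i j => g i.+1 j) ->
  (forall j, j.+1 < a -> g 0 j < g 0 j.+1) ->
  (forall r, r < size alpha -> a = 1 -> g 0 0 < g r.+1 0) ->
  (forall r j, a = nth 0 alpha r -> j < a -> g 0 j < g r.+1 j) ->
  (forall r j, nth 0 alpha r < a -> j < nth 0 alpha r -> g 0 j.+1 < g r.+1 j) ->
  compatible (a :: alpha) g.
Proof.
case=> h1 h2 h3 h4 k1 k2 k3 k4; split.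
- by case.
- by move=> [|i] [|i'] //= ii; [apply: k2|apply: h2].
- by move=> [|i] [|i'] j //= ii e; [rewrite -e; apply: k3|apply: h3].
- by move=> [|i] [|i'] j //= ii e; [apply: k4|apply: h4].
Qed.

Lemma row_exists N T r c y : all (gtn N) (flatten T) ->
  (c < nth 0 (shape T) r -> y < ent N T r c) -> y < N -> y < ent N T r c.
Proof.
move=> bT h yN; case: (ltnP (ent N T r c) N) => lt.
  by apply: h; rewrite -(@ent_shape N).
exact: leq_trans yN lt.
Qed.

Lemma runsP N T : tame (shape T) -> all (gtn N) (flatten T) -> uniq (flatten T) ->
  runs T ->
  [/\ tableau N (build T), shape (build T) = shape T, same_bounds N T (build T)
    & compatible (shape T) (ent N T)].
Proof.
elim: T => [|x T IH] tame_x bxT uxT /=.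
  move=> _; split=> //.
    by split=> //; split=> [r c|i j /andP[_] //|i j c _]; rewrite /ent !(nth_nil, ltnn).
  by split=> [i j|i i'|i i' j _ _|i i' j _ _]; rewrite ?nth_nil // ltn0 andbF.
have [bx bT] : all (gtn N) x /\ all (gtn N) (flatten T) by apply/andP; rewrite -all_cat.
have uT : uniq (flatten T) by move: uxT; rewrite /= cat_uniq => /and3P[].
case=> rT run; have [tP sP sb cT] := IH (tame_tail tame_x) bT uT rT.
set P := build T in run tP sP sb *.
set F := inserts P x in run *; clearbody F.
have pP : perm_eq (flatten P) (flatten T) by apply: perm_build.
have fr : fresh N x P.
  by rewrite /fresh bx /= (perm_uniq (perm_cat (perm_refl x) pP)).
have tF := bottom_run_tableau tP fr run.
case: x => [|x0 xs] in tame_x bxT uxT bx fr run tF *.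
  by case: tame_x.
have srt := bottom_run_sorted tP fr run.
have [x0N x0P fr1] := fresh_insert fr; have [tP1 _] := insert_tableau tP x0N x0P.
case: run; case eI : (insert x0 P) tP1 fr1 => [P1 c1] /= tP1 fr1 ec s1 run; subst c1.
have [eP1 _ lt0] := insert_bottom_row tP x0N x0P eI s1; subst P1.
have row0 : forall j, j < (size xs).+1 -> ent N ((x0 :: xs) :: T) 0 j = nth 0 (x0 :: xs) j.
  by move=> j jx; apply: set_nth_default.
have krow j : j.+1 < (size xs).+1 -> ent N ((x0 :: xs) :: T) 0 j < ent N ((x0 :: xs) :: T) 0 j.+1.
  move=> jx; rewrite !row0 //; last exact: ltnW.
  by move: srt => /(pathP 0) /(_ j); apply.
have sizeP : size P = size T by rewrite -!size_shape sP.
have lt0P r b : nth 0 (shape T) r = b -> x0 < ent N P r 0.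
  move=> _; case: (ltnP r (size P)) => h; first exact: lt0.
  by rewrite ent_rows.
have k0 r : x0 < ent N T r 0.
  by apply: (proj1 (sb (nth 0 (shape T) r) 0 x0 x0N)) => // r' e; apply: lt0P e.
have sF := bottom_run_shape s1 run; rewrite add1n in sF.
have bP : all (gtn N) (flatten P) by rewrite (perm_all _ pP).
have [bF _ _ SF] := tF.
case: (tame_head tame_x) => [a1|[a1 le_a]].
  case: xs => // in tame_x bxT uxT bx fr run tF srt fr1 sF bF SF row0 krow a1 *.
  move: run => /= eF; subst F; split=> //.
    exact: same_bounds_cons.
  apply: compatible_cons => //.
  - by move=> r _ _; apply: k0.
  - by move=> r j; rewrite /= => _; rewrite ltnS leqn0 => /eqP ->; apply: k0.
  - by move=> r [|j] //=; rewrite ltnS leqn0 => /eqP ->.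
have spec := run_specP tP1 fr1 s1 run le_a (add1n _).
split=> //.
  exact: (same_bounds_run sb sP le_a (erefl _) bT bF sF bx spec).
have xsN i : i < size xs -> nth 0 xs i < N.
  by move=> h; move: bx => /= /andP[_ /allP]; apply; rewrite mem_nth.
apply: compatible_cons => //.
- by move=> r _ e; move: a1; rewrite /= e.
- move=> r j; rewrite ent_cons => e; case: j => [|j] jx; first exact: k0.
  rewrite row0 //=; rewrite /= ltnS in jx.
  apply: (proj1 (sb _ j.+1 _ (xsN _ jx))) (erefl _) => r' e'.
  by have := run_lt spec (ltn0Sn r') jx; rewrite add1n.
move=> r j ra jr; rewrite ent_cons.
have jx : j < size xs by move: ra; rewrite /= ltnS; apply: leq_trans.
rewrite row0 //=; apply: (proj1 (sb _ j _ (xsN _ jx))) (erefl _) => r' e'.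
(* The bottom row of the final tableau mediates: its entry is at least the letter and, by
   [short_row_gt], smaller than the entry of the shorter row, which the run has not changed. *)
apply: leq_ltn_trans (run_ge spec 0 jx) _; rewrite add1n.
have -> : ent N P r' j = ent N F r'.+1 j.
  by rewrite (run_short spec) //= sP e'.
apply: (short_row_gt SF (ltn0Sn r') (b := nth 0 (shape T) r)) => //.
  by rewrite ent_shape // sF.
by apply/eqP; rewrite eqn_leq ent_le //= leqNgt ent_shape // sF /= e' ltnn.
Qed.

Lemma compatible_runs N T : tame (shape T) -> all (gtn N) (flatten T) ->
  uniq (flatten T) -> compatible (shape T) (ent N T) -> runs T.
Proof.
elim: T => [|x T IH] tame_x bxT uxT //= cx.
have [bx bT] : all (gtn N) x /\ all (gtn N) (flatten T) by apply/andP; rewrite -all_cat.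
have uT : uniq (flatten T) by move: uxT; rewrite /= cat_uniq => /and3P[].
have rT : runs T := IH (tame_tail tame_x) bT uT (compatible_tail cx).
split=> //.
have [tP sP sb cT] := runsP (tame_tail tame_x) bT uT rT.
set P := build T in tP sP sb *.
have pP : perm_eq (flatten P) (flatten T) by apply: perm_build.
have fr : fresh N x P.
  by rewrite /fresh bx /= (perm_uniq (perm_cat (perm_refl x) pP)).
case: x => [|x0 xs] in tame_x bxT uxT bx fr cx *; first by case: tame_x.
have [x0N x0P fr1] := fresh_insert fr; have [tP1 _] := insert_tableau tP x0N x0P.
have row0 : forall j, j < (size xs).+1 -> ent N ((x0 :: xs) :: T) 0 j = nth 0 (x0 :: xs) j.
  by move=> j jx; apply: set_nth_default.
have bP : all (gtn N) (flatten P) by rewrite (perm_all _ pP).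
have xsN i : i < size xs -> nth 0 xs i < N.
  by move=> h; move: bx => /= /andP[_ /allP]; apply; rewrite mem_nth.
have k0 r : r < size T ->
    ent N ((x0 :: xs) :: T) 0 0 < ent N ((x0 :: xs) :: T) r.+1 0.
  move=> rT'; have r0 : 0 < nth 0 (shape T) r.
    case: tame_x => /= h _; rewrite lt0n; apply: contra h => /eqP <-.
    by rewrite inE mem_nth ?orbT // size_shape.
  case: (tame_head tame_x) => [a1|[a1 le_a]].
    by apply: (compatible_one cx (i := 0) (i' := r.+1)); rewrite /= ?size_shape.
  have := allP le_a (nth 0 (shape T) r); rewrite mem_nth ?size_shape // => /(_ isT) /=.
  rewrite leq_eqVlt => /orP[/eqP e|lt].
    by apply: (compatible_eq cx (i := 0) (i' := r.+1)) => //; apply: esym e.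
  apply: (@ltn_trans (ent N ((x0 :: xs) :: T) 0 1)).
    exact: (compatible_row cx (i := 0)).
  exact: (compatible_gt cx (i := 0) (i' := r.+1)).
have lt0 r : r < size P -> x0 < ent N P r 0.
  move=> _; apply: (proj2 (sb (nth 0 (shape T) r) 0 x0 x0N)) => // r' _.
  case: (ltnP r' (size T)) => h; first exact (k0 r' h).
  by rewrite ent_rows.
have eI := insert_new_row tP x0N lt0.
suff [F run] : exists F, bottom_run (shape T) 0 P (x0 :: xs) F.
  by have e := bottom_run_inserts run; subst F; apply: run.
rewrite eI /= in tP1 fr1.
have s1 : shape ([:: x0] :: P) = 1 :: shape T by rewrite /= -/(shape P) sP.
suff [F run] : exists F, bottom_run (shape T) 1 ([:: x0] :: P) xs F.
  by exists F; rewrite /= eI.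
case: (tame_head tame_x) => [a1|[a1 le_a]].
  exists ([:: x0] :: P); suff -> : xs = [::] by []; move: a1 => /=; by case: (xs).
apply: (run_exists tP1 fr1 s1 le_a (add1n _) (tame_tail tame_x).2 (x := x0)).
- apply/(pathP 0) => i ix; have := compatible_row cx (i := 0) (j := i).
  rewrite !row0 /=; [apply|..] => //; exact: ltnW.
- move=> r i ix; rewrite ent_cons add1n.
  apply: (proj2 (sb (nth 0 (shape T) r) i.+1 _ (xsN _ ix))) => // r' _.
  apply: row_exists (xsN _ ix) => // ir.
  have r'T : r' < size (shape T) by rewrite ltnNge; apply: contraL ir => h; rewrite nth_default.
  have := allP le_a (nth 0 (shape T) r') (mem_nth 0 r'T).
  rewrite /= leq_eqVlt => /orP[/eqP e|lt].
    have := compatible_eq cx (i := 0) (i' := r'.+1) (j := i.+1) isT (esym e) ir.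
    by rewrite row0.
  have ix2 : i.+2 < (size xs).+1 by apply: leq_ltn_trans ir lt.
  apply: (@ltn_trans (ent N ((x0 :: xs) :: T) 0 i.+2)).
    by have := compatible_row cx (i := 0) ix2; rewrite row0.
  exact: (compatible_gt cx (i := 0) (i' := r'.+1)).
- move=> r i ra ix; rewrite ent_cons add0n.
  apply: (proj2 (sb (nth 0 (shape T) r) i _ (xsN _ ix))) => // r' er.
  apply: row_exists (xsN _ ix) => // ir.
  have := compatible_gt cx (i := 0) (i' := r'.+1) (j := i) isT _ ir.
  by rewrite row0 //; apply; rewrite /= er.
(* At the start of the run the bottom row is x0 alone, and letters never fall below the inserted
   one. *)
move=> y M B xy tr; apply: leq_trans (trace_ge_init tr _ _); exact: ltnW.
Qed.

(** * The recording tableau *)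

Fixpoint new_columns (P : filling) (xs : seq nat) : seq nat :=
  if xs is x :: xs' then (insert x P).2 :: new_columns (insert x P).1 xs' else [::].

Definition records (k : nat) (cs : seq nat) (Q : filling) : filling :=
  foldl (fun Q kc => record kc.1 kc.2 Q) Q (zip (iota k (size cs)) cs).

Lemma size_new_columns P xs : size (new_columns P xs) = size xs.
Proof. by elim: xs P => //= x xs IH P; rewrite IH. Qed.

Lemma foldl_PQ k P Q xs :
  foldl PQ_step (P, Q) (zip (iota k (size xs)) xs) =
  (inserts P xs, records k (new_columns P xs) Q).
Proof.
elim: xs k P Q => //= x xs IH k P Q; rewrite /records /=.
by case: (insert x P) => P' c /=; rewrite IH.
Qed.

Lemma PQE w : PQ w = (inserts [::] w, records 1 (new_columns [::] w) [::]).
Proof. exact: foldl_PQ. Qed.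

Lemma inserts_cat P xs ys : inserts P (xs ++ ys) = inserts (inserts P xs) ys.
Proof. exact: foldl_cat. Qed.

Lemma new_columns_cat P xs ys :
  new_columns P (xs ++ ys) = new_columns P xs ++ new_columns (inserts P xs) ys.
Proof. by elim: xs P => //= x xs IH P; rewrite IH. Qed.

Lemma records_cat k cs ds Q :
  records k (cs ++ ds) Q = records (k + size cs) ds (records k cs Q).
Proof.
rewrite /records size_cat iotaD zip_cat ?size_iota //; exact: foldl_cat.
Qed.

Lemma build_inserts T : build T = inserts [::] (flatten (rev T)).
Proof. by elim: T => //= x T ->; rewrite rev_cons flatten_rcons inserts_cat. Qed.

Lemma bottom_run_columns beta d T xs F : bottom_run beta d T xs F ->
  new_columns T xs = iota d.+1 (size xs).
Proof. by elim: xs d T => //= x xs IH d T [-> _ /IH ->]. Qed.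

(** Read backwards: the final shape and the column of the last new cell force that cell into the
    bottom row, which gives the shape before it, and so on. *)
Lemma bottom_run_back N beta d P xs : tableau N P -> fresh N xs P ->
  new_columns P xs = iota d.+2 (size xs) ->
  shape (inserts P xs) = (d.+1 + size xs) :: beta ->
  shape P = d.+1 :: beta /\ bottom_run beta d.+1 P xs (inserts P xs).
Proof.
elim: xs d P => [|x xs IH] d P tP fr /=; first by rewrite addn0.
have [xN xP fr1] := fresh_insert fr; have [tP1 _] := insert_tableau tP xN xP.
move=> [c1 cs]; rewrite addnS -addSn => sF.
have [s1 run1] := IH _ _ tP1 fr1 cs sF.
split=> //; case eI : (insert x P) c1 s1 {IH cs sF run1 tP1 fr1} => [P1 c] /= e s1.
by subst c; case: (insert_bottom_cell tP xN xP eI s1).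
Qed.

Lemma bottom_run_back0 N beta P xs : tableau N P -> fresh N xs P -> xs != [::] ->
  new_columns P xs = iota 1 (size xs) ->
  shape (inserts P xs) = size xs :: beta ->
  shape P = beta /\ bottom_run beta 0 P xs (inserts P xs).
Proof.
case: xs => // x xs tP fr _ /=.
have [xN xP fr1] := fresh_insert fr; have [tP1 _] := insert_tableau tP xN xP.
move=> [c1 cs] sF; have [s1 run1] := bottom_run_back tP1 fr1 cs sF.
split=> //; case eI : (insert x P) c1 s1 {cs sF run1 tP1 fr1} => [P1 c] /= e s1.
by subst c; case: (insert_bottom_row tP xN xP eI s1).
Qed.

(** The columns of the new cells when rows of lengths gamma are grown one after another. *)
Definition staircase (gamma : seq nat) : seq nat := flatten [seq iota 1 a | a <- gamma].

Lemma size_staircase gamma : size (staircase gamma) = sumn gamma.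
Proof. by elim: gamma => //= a g IH; rewrite size_cat size_iota IH. Qed.

Lemma build_tableau N T : all (gtn N) (flatten T) -> uniq (flatten T) -> tableau N (build T).
Proof.
have nil : tableau N [::].
  by split=> //; split=> [r c|i j /andP[_] //|i j c _]; rewrite /ent !(nth_nil, ltnn).
have aux xs P : tableau N P -> fresh N xs P -> tableau N (inserts P xs).
  elim: xs P => //= x xs IH P tP fr; have [xN xP fr1] := fresh_insert fr.
  by apply: IH => //; case: (insert_tableau tP xN xP).
elim: T => //= x T IH; rewrite all_cat cat_uniq => /andP[bx bT] /and3P[ux h uT].
apply: aux; first exact: IH.
by rewrite /fresh bx (perm_uniq (perm_cat (perm_refl x) (perm_build T))) cat_uniq ux h.
Qed.

Lemma runsE N T : 0 \notin shape T -> all (gtn N) (flatten T) -> uniq (flatten T) ->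
  runs T <-> shape (build T) = shape T /\
    new_columns [::] (flatten (rev T)) = staircase (rev (shape T)).
Proof.
move=> h0 bT uT; split.
  elim: T h0 {bT uT} => // x T IH h0 /= [rT run].
  have {}h0 : size x != 0 /\ 0 \notin shape T.
    by move: h0; rewrite /= inE negb_or eq_sym => /andP[].
  have [sT cT] := IH h0.2 rT; split.
    have := run; case: (x) h0 => [[]//|x0 xs] _ /= [_ s1 run1].
    by rewrite /= -/(inserts _ _) (bottom_run_shape s1 run1).
  rewrite !rev_cons flatten_rcons new_columns_cat cT /staircase map_rcons flatten_rcons.
  by rewrite -build_inserts (bottom_run_columns run).
elim: T h0 bT uT => // x T IH h0 bxT uxT /=.
have {}h0 : size x != 0 /\ 0 \notin shape T.
  by move: h0; rewrite /= inE negb_or eq_sym => /andP[].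
have [bx bT] : all (gtn N) x /\ all (gtn N) (flatten T) by apply/andP; rewrite -all_cat.
have uT : uniq (flatten T) by move: uxT; rewrite /= cat_uniq => /and3P[].
have fr : fresh N x (build T).
  by rewrite /fresh bx (perm_uniq (perm_cat (perm_refl x) (perm_build T))).
rewrite !rev_cons flatten_rcons new_columns_cat -build_inserts.
rewrite /staircase map_rcons flatten_rcons -/(staircase _) => -[sF].
move/eqP; rewrite eqseq_cat => [/andP[/eqP cT /eqP cx]|]; last first.
  by rewrite size_new_columns size_staircase size_flatten /shape map_rev.
have x0 : x != [::] by case: (x) h0 => [[]|].
have [sT run] := bottom_run_back0 (build_tableau bT uT) fr x0 cx sF.
by split=> //; apply: IH => //; case: h0.
Qed.

(** Entry v of the recording tableau lies in the column of the v-th new cell. Hence the recording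
    tableau determines the sequence of columns, although it does not remember in which row the
    insertion tableau grew. *)
Definition columns_agree (cs : seq nat) (Q : filling) : Prop :=
  forall r, r \in Q -> all (fun v => 0 < v <= size cs) r /\
    [seq nth 0 cs v.-1 | v <- r] = iota 1 (size r).

Lemma mem_append_first m k Q r : r \in append_first m k Q ->
  r \in Q \/ exists2 r', r' \in Q & size r' = m /\ r = rcons r' k.
Proof.
elim: Q => //= q Q IH; case: ifP => [/eqP e|_]; rewrite !inE.
  by case/orP=> [/eqP ->|->]; [right; exists q; rewrite ?inE ?eqxx|left; rewrite orbT].
case/orP=> [->|/IH [->|[r' r'Q [e1 e2]]]]; [by left|by left; rewrite orbT|].
by right; exists r'; rewrite // inE r'Q orbT.
Qed.

Lemma columns_agree_record cs c Q : 0 < c -> columns_agree cs Q ->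
  columns_agree (rcons cs c) (record (size cs).+1 c Q).
Proof.
move=> c0 ag.
have old r : r \in Q -> all (fun v => 0 < v <= (size cs).+1) r /\
    [seq nth 0 (rcons cs c) v.-1 | v <- r] = iota 1 (size r).
  move=> /ag[h1 h2]; split; first by apply: sub_all h1 => v; lia.
  rewrite -h2; apply/eq_in_map => v /(allP h1) h; rewrite nth_rcons.
  by have -> : v.-1 < size cs by lia.
move=> r; rewrite size_rcons /record; case: eqP => [e|c1].
  subst c; rewrite /add_row mem_cat inE !mem_filter => /or3P[/andP[_ /old]|/eqP ->|/andP[_ /old]] //.
  by rewrite /= leqnn nth_rcons ltnn eqxx.
rewrite /append_topmost mem_rev => /mem_append_first[|[r']]; rewrite mem_rev; first exact: old.
move=> /old[h1 h2] [e ->]; rewrite all_rcons h1 /= leqnn; split=> //.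
rewrite map_rcons h2 size_rcons iota_rcons nth_rcons ltnn eqxx e add1n.
by case: (c) c0.
Qed.

Lemma columns_agree_records cs : all (ltn 0) cs -> columns_agree cs (records 1 cs [::]).
Proof.
elim/last_ind: cs => // cs c IH; rewrite all_rcons => /andP[c0 /IH ag].
rewrite -cats1 records_cat cats1; exact: columns_agree_record.
Qed.

Lemma flatten_T_can gamma : flatten (T_can gamma) = iota 1 (sumn gamma).
Proof. by rewrite reshapeKr // size_iota. Qed.

Lemma shape_T_can gamma : shape (T_can gamma) = gamma.
Proof. by rewrite reshapeKl // size_iota. Qed.

Lemma records_T_can cs gamma : all (ltn 0) cs -> size cs = sumn gamma ->
  records 1 cs [::] = T_can gamma -> cs = staircase gamma.
Proof.
move=> pos sz e; have := columns_agree_records pos; rewrite e => ag.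
transitivity [seq nth 0 cs v.-1 | v <- flatten (T_can gamma)].
  rewrite flatten_T_can -sz (iotaDl 1 0) -map_comp.
  apply: (@eq_from_nth _ 0); first by rewrite size_map size_iota.
  by move=> i ic; rewrite (nth_map 0) ?size_iota // nth_iota.
rewrite map_flatten /staircase -[in RHS](shape_T_can gamma) /shape -map_comp.
by congr flatten; apply/eq_in_map => r /ag[].
Qed.

Lemma T_can_rcons gamma a :
  T_can (rcons gamma a) = rcons (T_can gamma) (iota (sumn gamma).+1 a).
Proof.
rewrite /T_can reshape_rcons; last by rewrite size_iota sumn_rcons.
by rewrite take_iota drop_iota sumn_rcons addKn (minn_idPl _) ?leq_addr // addn1.
Qed.

Lemma add_row_last k Q : all (fun r => head 0 r < k) Q -> add_row k Q = rcons Q [:: k].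
Proof.
move=> h; rewrite /add_row; have /all_filterP -> := h.
rewrite (_ : [seq _ <- _ | _ <= _] = [::]) ?cats1 //.
apply/eqP; rewrite -(negbK (_ == _)) -has_filter -all_predC.
by apply: sub_all h => r /=; rewrite -ltnNge.
Qed.

Lemma append_topmost_last d k Q r : size r = d ->
  append_topmost d k (rcons Q r) = rcons Q (rcons r k).
Proof. by move=> e; rewrite /append_topmost rev_rcons /= e eqxx rev_cons revK. Qed.

Lemma records_row k d a Q : records (k + d.+1) (iota d.+2 a) (rcons Q (iota k d.+1)) =
  rcons Q (iota k (d.+1 + a)).
Proof.
elim: a d => [|a IH] d; first by rewrite addn0.
rewrite -(addSnnS d.+1); have := IH d.+1; rewrite iota_rcons; move: (size_iota k d.+1).
move: (iota k d.+1) => r sz; rewrite /records /= /record /= append_topmost_last //.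
by rewrite !(addnS k).
Qed.

Lemma records_staircase gamma : 0 \notin gamma ->
  records 1 (staircase gamma) [::] = T_can gamma.
Proof.
elim/last_ind: gamma => // gamma a IH.
rewrite mem_rcons inE negb_or eq_sym => /andP[a0 h0].
have sz := size_staircase gamma.
rewrite /staircase map_rcons flatten_rcons -/(staircase gamma) records_cat IH // sz add1n.
rewrite T_can_rcons.
case: a a0 => // a _; rewrite -[iota 1 a.+1]/([:: 1] ++ iota 2 a) records_cat addn1.
rewrite {2}/records /= /record /= add_row_last.
  by have := records_row (sumn gamma).+1 0 a (T_can gamma); rewrite addn1 add1n.
apply/allP => r rT; rewrite ltnS.
have : head 0 r \in flatten (T_can gamma) \/ r = [::].
  by case: r rT => [|x r] rT; [right|left; apply/flattenP; exists (x :: r); rewrite ?inE ?eqxx].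
by case=> [|-> //]; rewrite flatten_T_can mem_iota => /andP[_]; rewrite add1n ltnS.
Qed.

(** * The cells of seq_2 *)

Lemma drop_trailing_zerosP s : exists k,
  s = drop_trailing_zeros s ++ nseq k 0 /\
  (drop_trailing_zeros s = [::] \/ last 0 (drop_trailing_zeros s) != 0).
Proof.
rewrite /drop_trailing_zeros; set r := rev s; set k := find _ r.
exists k; split.
  rewrite -[LHS]revK -/r -{1}(cat_take_drop k r) rev_cat; congr (_ ++ _).
  have -> : take k r = nseq k 0.
    have kr : k <= size r by apply: find_size.
    apply: (@eq_from_nth _ 0); rewrite size_takel ?size_nseq // => i ik.
    rewrite nth_take // nth_nseq ik; apply/eqP; rewrite -[_ == _]negbK.
    by have := before_find 0 ik => /= ->.
  by apply: (@eq_from_nth _ 0); rewrite size_rev // => i; rewrite size_nseq => ik;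
    rewrite nth_rev size_nseq // !nth_nseq ik; case: ifP => //; lia.
case: (ltnP k (size r)) => kr; last by left; rewrite drop_oversize.
right; rewrite (drop_nth 0) // rev_cons last_rcons.
by apply: (@nth_find _ 0 (predC1 0) r); rewrite has_find.
Qed.

Lemma nth_drop_trailing_zeros s i : nth 0 (drop_trailing_zeros s) i = nth 0 s i.
Proof.
have [k [e _]] := drop_trailing_zerosP s; rewrite [in RHS]e nth_cat.
by case: ltnP => // h; rewrite nth_nseq if_same nth_default.
Qed.

Lemma sumn_drop_trailing_zeros s : sumn (drop_trailing_zeros s) = sumn s.
Proof.
have [k [e _]] := drop_trailing_zerosP s.
by rewrite [in RHS]e sumn_cat sumn_nseq addn0.
Qed.

Lemma drop_trailing_zeros_pos s :
  (forall i j, i < j -> nth 0 s i = 0 -> nth 0 s j = 0) ->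
  0 \notin drop_trailing_zeros s.
Proof.
move=> h; apply/negP => /(nthP 0)[i it e0].
have [k [_ [e|ne]]] := drop_trailing_zerosP s; first by move: it; rewrite e.
move: ne; rewrite -nth_last => /negP[].
move: it e0; set t := drop_trailing_zeros s => it e0.
have h' : i < (size t).-1 -> nth 0 t (size t).-1 = 0.
  by move=> lt; rewrite nth_drop_trailing_zeros; apply: (h i) => //; rewrite -nth_drop_trailing_zeros.
case: (ltngtP i (size t).-1) => [/h' -> //|gt|<-]; last by rewrite e0.
by move: gt; case: (size t) it => //= m; rewrite ltnS leqNgt => /negbTE ->.
Qed.

Definition twos (alpha : seq nat) (i j : nat) : bool :=
  all (fun u => part alpha u == 2) (iota i (j.+1 - i)).

(* For cells of rows of length at most 2: these are the only pairs of cells in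
   different rows that are not related by [compatible]. *)
Definition unrelated (alpha : seq nat) (A B : cell) : bool :=
  [&& A.2 == 2, B.2 == 1 & twos alpha A.1 B.1].

(** The order in which the loop of P3 may list two cells: from top to bottom and from right to left,
    except that an unrelated pair is listed with the cell of column 2 first, though it is the lower
    one. *)
Definition precedes (alpha : seq nat) (A B : cell) : bool :=
  if A.1 < B.1 then unrelated alpha A B
  else if A.1 == B.1 then B.2 < A.2 else ~~ unrelated alpha B A.

Lemma twosP alpha i j :
  reflect (forall u, i <= u <= j -> part alpha u = 2) (twos alpha i j).
Proof.
apply: (iffP allP) => [h u iu|h u]; first by apply/eqP/h; rewrite mem_iota; lia.
by rewrite mem_iota => iu; apply/eqP/h; lia.
Qed.

(** One round of the loop of P3, with p = t - 1. *)
Definition peeled (beta : seq nat) (p : nat) : seq nat :=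
  drop_trailing_zeros (take p beta ++ map predn (drop p beta)).

Lemma nth_decremented beta p i :
  nth 0 (take p beta ++ map predn (drop p beta)) i = nth 0 beta i - (p <= i).
Proof.
rewrite nth_cat size_take.
case: (ltnP p (size beta)) => ps; last first.
  case: ltnP => ib; last by rewrite !nth_default // size_map size_drop; lia.
  rewrite nth_take; last by lia.
  by rewrite leqNgt (leq_trans ib ps) subn0.
case: (ltnP i p) => ip; first by rewrite nth_take // subn0.
case: (ltnP i (size beta)) => ib.
  by rewrite (nth_map 0) ?nth_drop ?subnKC ?subn1 // size_drop; lia.
by rewrite !nth_default // size_map size_drop; lia.
Qed.

Lemma nth_peeled beta p i :
  nth 0 (peeled beta p) i = nth 0 beta i - (p <= i).
Proof. by rewrite nth_drop_trailing_zeros nth_decremented. Qed.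

Lemma part_peeled beta p i : 0 < i -> part (peeled beta p) i = part beta i - (p < i).
Proof. by case: i => // i _; rewrite /part nth_peeled. Qed.

Lemma sumn_peeled beta p : 0 \notin beta ->
  sumn (peeled beta p) + size (drop p beta) = sumn beta.
Proof.
rewrite /peeled sumn_drop_trailing_zeros => h0.
rewrite -[in RHS](cat_take_drop p beta) !sumn_cat -addnA; congr addn.
have : 0 \notin drop p beta by apply: contra h0; apply: mem_drop.
elim: (drop p beta) => //= x s IH; rewrite inE negb_or => /andP[x0 /IH].
by lia.
Qed.

Lemma P3_loop_shift fuel j beta :
  P3_loop fuel j beta = [seq (j + c.1, c.2) | c <- P3_loop fuel 0 beta].
Proof.
elim: fuel beta => //= fuel IH [|b beta] //.
rewrite map_cat -IH; congr cat; rewrite -map_comp; apply: eq_map => u /=.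
by rewrite add0n.
Qed.

Lemma sorted_geq_nth s i j : sorted geq s -> i <= j -> nth 0 s j <= nth 0 s i.
Proof.
move=> srt ij; case: (ltnP j (size s)) => h; last by rewrite [leqLHS]nth_default.
have tr : transitive geq by move=> x y z /= h1 h2; apply: leq_trans h2 h1.
by apply: (sorted_leq_nth tr leqnn 0 srt); rewrite ?inE //; lia.
Qed.

Lemma P3_loopS fuel beta (l := size beta)
    (p := find (fun u => sorted geq (drop u beta)) (iota 0 l)) :
  beta != [::] -> P3_loop fuel.+1 0 beta =
  [seq (0 + u, part beta u) | u <- rev (iota p.+1 (l - p.+1).+1)] ++
  P3_loop fuel 0 (peeled beta p).
Proof. by case: beta @l @p. Qed.

(** One round lists the last cells of the rows above p. A cell left over that is higher than a
    listed one belongs to a row of length 2 in the decreasing suffix, so all rows between the two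
    have length 2 and the pair is unrelated. *)
Lemma P3_loopP fuel beta : sumn beta <= fuel -> all (fun x => 0 < x <= 2) beta ->
  [/\ uniq (P3_loop fuel 0 beta), P3_loop fuel 0 beta =i cd beta
    & pairwise (precedes beta) (P3_loop fuel 0 beta)].
Proof.
elim: fuel beta => [|fuel IH] beta le_f b12.
  have -> : beta = [::] by case: beta b12 le_f => //= x s; lia.
  by split.
case: (eqVneq beta [::]) => [->|bnz]; first by split.
rewrite P3_loopS //; set l := size beta; set p := find _ _.
have nz : 0 \notin beta by apply/negP => /(allP b12).
have l0 : 0 < l by rewrite lt0n size_eq0.
have has_p : has (fun u => sorted geq (drop u beta)) (iota 0 l).
  apply/hasP; exists l.-1; first by rewrite mem_iota; lia.
  by rewrite (drop_nth 0) ?prednK // drop_oversize.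
have pl : p < l by move: has_p; rewrite has_find size_iota.
have srt : sorted geq (drop p beta).
  by have := nth_find 0 has_p; rewrite -/p nth_iota.
(* By minimality of p the suffix starting one row lower is not decreasing; with parts 1 and 2 this
   means a 1 followed by a 2. *)
have prev : 0 < p -> nth 0 beta p.-1 = 1 /\ nth 0 beta p = 2.
  move=> p0; have := @before_find _ 0 (fun u => sorted geq (drop u beta)) (iota 0 l) p.-1.
  rewrite -/p prednK // leqnn => /(_ isT); rewrite nth_iota; last by lia.
  rewrite add0n (drop_nth 0); last by rewrite -/l; lia.
  move: (srt); rewrite prednK // (drop_nth 0 pl) /= => -> .
  have in12 i : i < l -> 0 < nth 0 beta i <= 2 by move=> h; apply: (allP b12); rewrite mem_nth.
  have := in12 p pl; have := in12 p.-1; rewrite -/l.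
  by rewrite andbT; lia.
clearbody p; clear has_p.
have dec i j : p <= i -> i <= j -> nth 0 beta j <= nth 0 beta i.
  move=> pi ij; have := @sorted_geq_nth _ (i - p) (j - p) srt.
  by rewrite !nth_drop !subnKC ?(leq_trans pi) // leq_sub2r // => ->.
have eL : [seq (0 + u, part beta u) | u <- rev (iota p.+1 (l - p.+1).+1)] =
    [seq (u, part beta u) | u <- rev (iota p.+1 (l - p))].
  by rewrite subnSK.
rewrite eL.
have b12' : all (fun x => 0 < x <= 2) (peeled beta p).
  have z : 0 \notin peeled beta p.
    apply: drop_trailing_zeros_pos => i j ij.
    rewrite !nth_decremented.
    case: (leqP p i) => pi /= h; last first.
      move: h; rewrite subn0 => h; case/negP: nz; apply/(nthP 0); exists i => //.
      exact: ltn_trans pi pl.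
    by have := dec i j pi (ltnW ij); lia.
  apply/allP => x xp; have : x != 0 by apply: contra z => /eqP <-.
  move: xp => /(nthP 0)[i _ <-]; rewrite nth_peeled.
  case: (ltnP i l) => il; last by rewrite nth_default.
  by have := allP b12 _ (mem_nth 0 il); case: (p <= i) => /=; lia.
have sum' : sumn (peeled beta p) <= fuel.
  by have := sumn_peeled p nz; rewrite size_drop -/l; lia.
have [u' m' w'] := IH _ sum' b12'.
have memB c : (c \in [seq (u, part beta u) | u <- rev (iota p.+1 (l - p))]) =
    (p < c.1 <= l) && (c.2 == part beta c.1).
  apply/mapP/idP => [[u]|/andP[h /eqP e]].
    by rewrite mem_rev mem_iota => h -> /=; rewrite eqxx; lia.
  by exists c.1; rewrite ?mem_rev ?mem_iota -?e; [lia|case: (c)].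
have part_gt i : part beta i <> 0 -> 0 < i -> i <= l.
  by move=> h i0; rewrite leqNgt; apply/negP => li; apply: h; rewrite /part nth_default // -/l; lia.
have dec1 i j : p < i -> i <= j -> part beta j <= part beta i.
  by move=> pi ij; rewrite /part; apply: dec; lia.
have le2 i : part beta i <= 2.
  rewrite /part; case: (ltnP i.-1 l) => h; last by rewrite nth_default.
  by have /andP[] := allP b12 _ (mem_nth 0 h).
split.
- rewrite cat_uniq u' andbT; apply/andP; split.
    by rewrite map_inj_uniq ?rev_uniq ?iota_uniq // => x y [].
  apply/hasPn => c; rewrite m' memB; case: c => i j; rewrite mem_cd /=.
  move=> /andP[i0 /andP[j0]]; rewrite part_peeled // => jp.
  by apply/negP => /andP[/andP[pi il] /eqP e]; move: jp; rewrite pi; lia.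
- move=> [i j]; rewrite mem_cat m' memB !mem_cd /=.
  case: (posnP i) => [->|i0] //=; rewrite part_peeled //.
  case: (posnP j) => [->|j0] /=.
    rewrite orbF; apply/negP => /andP[/andP[pi il] /eqP e]; case/negP: nz.
    by rewrite e /part mem_nth // -/l; lia.
  case: (ltnP p i) => pi /=; last by rewrite subn0.
  case: (leqP i l) => il /=; last by rewrite /part nth_default // -/l; lia.
  by have := allP b12 (part beta i) (mem_nth 0 _); rewrite -/l; lia.
rewrite pairwise_cat; apply/and3P; split.
- apply/allrelP => A B; rewrite memB m' => /andP[/andP[pA Al] /eqP eA].
  case: A pA Al eA => a1 a2 /= pA Al eA; case: B => i j; rewrite mem_cd /=.
  move=> /andP[i0 /andP[j0]]; rewrite part_peeled // => jp.
  rewrite /precedes /=; case: (ltngtP a1 i) => ai.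
  + have pi : p < i by lia.
    move: jp; rewrite pi => jp; have := le2 i; have := dec1 a1 i pA (ltnW ai); have := le2 a1.
    move=> h1 h2 h3; rewrite /unrelated /= eA; apply/and3P; split; [lia|lia|].
    apply/twosP => u /andP[h4 h5]; have := dec1 a1 u pA h4.
    by have := dec1 u i (leq_trans pA h4) h5; lia.
  + apply/negP => /and3P[/= _ /eqP h1 /twosP h2].
    by have := h2 a1; rewrite leqnn (ltnW ai) => /(_ isT); lia.
  by move: jp; rewrite -ai pA -eA; lia.
- apply/(pairwiseP (0, 0)) => x y.
  rewrite !inE size_map size_rev size_iota => xs ys xy.
  rewrite !(nth_map 0) ?size_rev ?size_iota // !nth_rev ?size_iota // !nth_iota; try lia.
  rewrite /precedes /=; case: ltngtP => h; try lia.
  apply/negP => /and3P[_ /= /eqP h1 /twosP h2].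
  by have := h2 (p.+1 + (l - p - x.+1)); lia.
apply: (@sub_in_pairwise _ [in P3_loop fuel 0 (peeled beta p)]) w'; last by apply/allP.
move=> A B; rewrite !m' => Ain Bin.
(* Being unrelated means the same before and after the round: a cell of column 2 that is left lies
   in row p or below, and if the other cell lies above row p, then row p, of length 1 in both
   compositions, separates them. *)
have same (C D : cell) : C \in cd (peeled beta p) -> C.1 < D.1 ->
    unrelated (peeled beta p) C D = unrelated beta C D.
  case: C => i j; case: D => i' j' /=; rewrite mem_cd => /andP[i0 /andP[j0 jp]] ii.
  rewrite /unrelated /=; case: (j =P 2) => //= e2; case: (j' =P 1) => //= e1.
  move: jp; rewrite part_peeled //; have := le2 i => le2i jp.
  have ip : i <= p by lia.
  case: (leqP i' p) => i'p.
    apply: eq_in_all => u; rewrite mem_iota => hu; rewrite part_peeled; last by lia.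
    by rewrite ltnNge (_ : u <= p) ?subn0 //; lia.
  have [h1 h2] : nth 0 beta p.-1 = 1 /\ nth 0 beta p = 2 by apply: prev; lia.
  have p1 : part beta p = 1 := h1.
  have ipi : i <= p <= i' by rewrite ip ltnW.
  have p0 : 0 < p by apply: leq_trans i0 ip.
  apply/idP/idP => /twosP /(_ p ipi); rewrite ?part_peeled // ?p1 // ltnn.
  by rewrite subn0.
rewrite /precedes; case: ltngtP => AB //; first by rewrite same.
by rewrite same.
Qed.

(** For consecutive rows of D, from the top. With tameness the lower row u is equally long or longer
    by one, which is what makes the last cells of the two rows related. *)
Definition down (alpha : seq nat) (v u : nat) : bool :=
  (u < v) && (part alpha u <= (part alpha v).+1).

(* seq_1 consists of the last cells of the rows in D, seq_2 of all cells above
   row j0; a composition (1, ..., 1) is treated as if seq_2 were everything. *)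
Record peel (alpha D : seq nat) (j0 : nat) (L : seq cell) : Prop := Peel {
  peel_le : j0 <= size alpha;
  peel_sorted : sorted (down alpha) D;
  peel_ge2 : forall u, u \in D -> 0 < u <= j0 /\ 2 <= part alpha u;
  peel_closed : forall u v, 0 < u < v -> v \in D -> 2 <= part alpha u -> u \in D;
  peel_gap : forall u v, u \in D -> u < v <= j0 -> v \notin D ->
    part alpha v + 2 <= part alpha u;
  peel_rest : j0 < size alpha -> [/\ part alpha j0.+1 = 1,
    forall j, j0 < j -> part alpha j <= 2,
    forall i, 0 < i <= j0 -> 2 <= part alpha i -> i \in D
    & D <> [::] -> part alpha (head 0 D) = 2];
  peel_uniq : uniq L;
  peel_mem : forall c, (c \in L) = (c \in cd alpha) && (j0 < c.1);
  peel_order : pairwise (precedes alpha) L }.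

Lemma part_out alpha i : size alpha < i -> part alpha i = 0.
Proof. by case: i => // i h; rewrite /part nth_default. Qed.

Lemma tame_part alpha i j : tame alpha -> 0 < i -> i < j -> 1 < part alpha i ->
  part alpha j <= part alpha i.
Proof.
by case=> _ h; case: i => // i _; case: j => // j ij; apply: (h i j).
Qed.

Lemma tame_part_gt0 alpha i : tame alpha -> 0 < i <= size alpha -> 0 < part alpha i.
Proof.
case=> h _; case: i => // i ia; rewrite lt0n; apply: contra h => /eqP <-.
exact: mem_nth.
Qed.

Lemma part_drop alpha j i : 0 < i -> part (drop j alpha) i = part alpha (j + i).
Proof. by case: i => // i _; rewrite /part nth_drop addnS. Qed.

Lemma mem_cd_drop alpha j i k : j < i ->
  ((i - j, k) \in cd (drop j alpha)) = ((i, k) \in cd alpha).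
Proof.
move=> ji; rewrite !mem_cd subn_gt0 ji (leq_ltn_trans (leq0n j) ji) part_drop ?subn_gt0 //.
by rewrite subnKC // ltnW.
Qed.

Lemma twos_shift alpha j a b : 0 < a ->
  twos (drop j alpha) a b = twos alpha (j + a) (j + b).
Proof.
move=> a0; apply/twosP/twosP => h u hu.
  by have := h (u - j); rewrite part_drop ?subnKC; [apply|..]; lia.
by rewrite part_drop; [apply: h|]; lia.
Qed.

Lemma P3_loop_drop alpha j : tame alpha -> (forall i, j < i -> part alpha i <= 2) ->
  let L := P3_loop (sumn (drop j alpha)) j (drop j alpha) in
  [/\ uniq L, forall c, (c \in L) = (c \in cd alpha) && (j < c.1)
    & pairwise (precedes alpha) L].
Proof.
move=> ta le2; rewrite /= P3_loop_shift.
have [||u m w] := @P3_loopP (sumn (drop j alpha)) (drop j alpha) => //.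
  apply/(all_nthP 0) => i; rewrite size_drop => ia.
  have := part_drop alpha j (ltn0Sn i); rewrite /part /= => ->.
  have := tame_part_gt0 ta (i := j + i.+1); rewrite /part /=.
  by have := le2 (j + i.+1); rewrite /part /=; lia.
set L0 := P3_loop _ 0 _ in u m w *.
have inj : injective (fun c : cell => (j + c.1, c.2)).
  by move=> [a b] [a' b'] /= [] /addnI -> ->.
split; first by rewrite map_inj_uniq.
- move=> [a b]; apply/mapP/idP => [[[a' b']]|].
    rewrite m => h /= [-> ->]; have a0 : 0 < a' by move: h; rewrite mem_cd => /andP[].
    have lt : j < j + a' by rewrite -[X in X < _]addn0 ltn_add2l.
    by rewrite -(@mem_cd_drop alpha j (j + a') b' lt) addKn h lt.
  case/andP=> h /= ja; exists (a - j, b); first by rewrite m mem_cd_drop.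
  by rewrite /= subnKC // ltnW.
rewrite pairwise_map; apply: (@sub_in_pairwise _ [in L0]) w; last by apply/allP.
move=> [a b] [a' b']; rewrite !m !mem_cd => /andP[a0 _] /andP[a'0 _].
by rewrite /precedes /unrelated /= ltn_add2l eqn_add2l !twos_shift.
Qed.

Lemma P3P alpha i r : tame alpha -> path (down alpha) i r ->
  (forall u, u \in i :: r -> 0 < u <= size alpha /\ 2 <= part alpha u) ->
  (forall u, u \in r -> 3 <= part alpha u) ->
  (forall u, 0 < u < i -> 2 <= part alpha u -> u \in r) ->
  part alpha i = 2 ->
  exists D j0 L, P3 alpha i [seq (u, part alpha u) | u <- i :: r] =
    ([seq (u, part alpha u) | u <- D], L) /\ D <> [::] /\ peel alpha D j0 L.
Proof.
move=> ta pth ge2 ge3 closed pi2.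
rewrite /P3; set f := find _ _; set j := i + f.
have [/andP[i0 ia] _] := ge2 i (mem_head _ _).
have f_le : f <= size alpha - i by rewrite -size_drop find_size.
have ja : j <= size alpha by rewrite /j; lia.
have run u : i <= u <= j -> part alpha u = 2.
  move=> /andP[iu uj]; case: (ltngtP i u) iu => // [iu|<- //] _.
  have := @before_find _ 0 (predC1 (part alpha i)) (drop i alpha) (u - i.+1).
  rewrite -/f nth_drop => /(_ _)/=.
  have -> : i + (u - i.+1) = u.-1 by lia.
  rewrite pi2 => h; apply/eqP; rewrite -[_ == _]negbK; apply/negP => h'.
  have : (nth 0 alpha u.-1 != 2) = false by apply: h; move: uj; rewrite /j; lia.
  by rewrite -/(part alpha u) h'.
have stop : j < size alpha -> part alpha j.+1 <> 2.
  move=> jlt; have := @nth_find _ 0 (predC1 (part alpha i)) (drop i alpha).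
  rewrite -/f nth_drop has_find -/f size_drop -/j pi2 /= => h.
  by apply/eqP; apply: h; move: jlt; rewrite /j; lia.
have le2 u : i < u -> part alpha u <= 2.
  by move=> iu; rewrite -pi2; apply: tame_part => //; rewrite pi2.
have [uL mL oL] := P3_loop_drop ta (fun u (h : j < u) => le2 u (leq_ltn_trans (leq_addr _ _) h)).
have j_i : j - i = f by rewrite /j addKn.
exists (rev (iota i.+1 f) ++ i :: r), j, (P3_loop (sumn (drop j alpha)) j (drop j alpha)).
rewrite j_i map_cat; split=> //; split; first by case: (rev _).
have memD u : (u \in rev (iota i.+1 f) ++ i :: r) = (i <= u <= j) || (u \in r).
  by rewrite mem_cat mem_rev mem_iota inE orbA; congr orb; rewrite /j; lia.
have ri u : u \in r -> u < i.
  move=> ur; have tr : transitive (fun a b : nat => b < a) by move=> x y z /=; lia.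
  have : path (fun a b : nat => b < a) i r by apply: sub_path pth => a b /andP[].
  by move/(order_path_min tr)/allP; apply.
have i_lt_all u : u \in rev (iota i.+1 f) ++ i :: r -> u < i -> u \in r.
  by rewrite memD => /orP[h|//]; lia.
split=> //.
- have : forall g, g <= f -> sorted (down alpha) (rev (iota i.+1 g) ++ i :: r).
    elim=> [|g IH] gf //; rewrite iota_rcons rev_rcons /=.
    have := IH (ltnW gf); case: g gf {IH} => [|g] gf.
      move=> /= ->; rewrite andbT /down; have := run (i.+1 + 0); rewrite pi2 /j; lia.
    rewrite iota_rcons rev_rcons /= => ->; rewrite andbT /down.
    have := run (i.+1 + g.+1); have := run (i.+1 + g); rewrite /j; lia.
  by apply.
- move=> u; rewrite memD => /orP[h|ur].
    by rewrite run //; split=> //; lia.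
  have [|h1 h2] := ge2 u; first by rewrite inE ur orbT.
  by split=> //; have := ri u ur; rewrite /j; lia.
- move=> u v uv; rewrite !memD => vD p2.
  case: (leqP i u) => iu; first by have := ri v; case/orP: vD; lia.
  by rewrite closed ?orbT //; lia.
- move=> u v; rewrite !memD => uD uv; rewrite negb_or => /andP[h1 h2].
  have vi : v < i by lia.
  have ur : u \in r by case/orP: uD => // h; lia.
  have := ge3 u ur.
  have : ~ (2 <= part alpha v) by move=> p2; case/negP: h2; apply: closed => //; lia.
  by lia.
move=> jlt; split.
- have := stop jlt; have := le2 j.+1; have := tame_part_gt0 ta (i := j.+1).
  by rewrite /j; lia.
- by move=> u ju; apply: le2; apply: leq_ltn_trans ju; apply: leq_addr.
- move=> u uj p2; rewrite memD; case: (leqP i u) => iu; first by lia.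
  by rewrite closed ?orbT //; lia.
move=> _; case: f f_le @j ja run stop uL mL oL j_i memD i_lt_all jlt => [|g] f_le j ja run stop *.
  by rewrite /= pi2.
by rewrite iota_rcons rev_rcons /=; apply: run; rewrite /j; lia.
Qed.

(** * The structure of seq(alpha) *)

(** The loop invariant: [i :: r] lists the rows chosen so far, the latest first, and every row below
    row i of length at least 2 is among them. *)
Lemma P12P alpha fuel i r : tame alpha -> size alpha - i < fuel ->
  path (down alpha) i r ->
  (forall u, u \in i :: r -> 0 < u <= size alpha /\ 2 <= part alpha u) ->
  (forall u, u \in r -> 3 <= part alpha u) ->
  (forall u, 0 < u < i -> 2 <= part alpha u -> u \in r) ->
  exists D j0 L, P12 fuel alpha i [seq (u, part alpha u) | u <- i :: r] =
    ([seq (u, part alpha u) | u <- D], L) /\ D <> [::] /\ peel alpha D j0 L.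
Proof.
move=> ta; elim: fuel i r => // fuel IH i r fi pth ge2 ge3 closed /=.
have [/andP[i0 ia] p2] := ge2 i (mem_head _ _).
case: (leqP 3 (part alpha i)) => p3; last first.
  by apply: P3P => //; lia.
have ge3' u : u \in i :: r -> 3 <= part alpha u by rewrite inE => /orP[/eqP -> //|/ge3].
have le_i u : u \in i :: r -> part alpha i <= part alpha u.
  rewrite inE => /orP[/eqP -> //|ur].
  have ui : u < i.
    have tr : transitive (fun a b : nat => b < a) by move=> x y z /=; lia.
    have : path (fun a b : nat => b < a) i r by apply: sub_path pth => a b /andP[].
    by move/(order_path_min tr)/allP; apply.
  have [h1 h2] : 0 < u <= size alpha /\ 2 <= part alpha u by apply: ge2; rewrite inE ur orbT.
  by apply: tame_part ui _ => //; case/andP: h1.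
case e : [seq _ <- _ | _] => [|j js].
  have none j : i < j -> part alpha j + 2 <= part alpha i.
    move=> ij; case: (leqP j (size alpha)) => ja; last by rewrite part_out //; lia.
    have : j \notin [seq j <- iota i.+1 (size alpha - i) | part alpha i - 1 <= part alpha j] by rewrite e.
    by rewrite mem_filter mem_iota; lia.
  exists (i :: r), (size alpha), [::]; split=> //; split=> //; split=> //.
  - move=> u v /andP[u0 uv] vD pu.
    case: (ltngtP u i) => ui; last by rewrite ui mem_head.
      by rewrite inE closed ?orbT // u0.
    have vi : v <= i.
      move: vD; rewrite inE => /orP[/eqP -> //|vr].
      have tr : transitive (fun a b : nat => b < a) by move=> x y z /=; lia.
      have : path (fun a b : nat => b < a) i r by apply: sub_path pth => a b /andP[].
      by move/(order_path_min tr)/allP => h; apply: ltnW; apply: h.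
    by lia.
  - move=> u v uD /andP[uv va] vD; case: (ltngtP v i) => vi.
    + have : ~ (2 <= part alpha v).
        move=> pv; case/negP: vD; rewrite inE closed ?orbT //; lia.
      by have := ge3' u uD; lia.
    + by apply: leq_trans (none v vi) (le_i u uD).
    by case/negP: vD; rewrite vi mem_head.
  - by rewrite ltnn.
  by move=> [a b]; rewrite in_nil mem_cd; apply/esym/negP => /andP[/andP[_ h] lt]; move: h;
    rewrite part_out //; lia.
have [jin js_sorted] : j \in [seq j <- iota i.+1 (size alpha - i) | part alpha i - 1 <= part alpha j]
    /\ forall u, i < u < j -> part alpha u < part alpha i - 1.
  split; first by rewrite e mem_head.
  move=> u /andP[iu uj]; rewrite ltnNge; apply/negP => h.
  have srt : sorted ltn [seq j <- iota i.+1 (size alpha - i) | part alpha i - 1 <= part alpha j].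
    exact: sorted_filter ltn_trans _ _ (iota_ltn_sorted _ _).
  have jlt : j < i.+1 + (size alpha - i).
    have : j \in [seq j <- iota i.+1 (size alpha - i) | part alpha i - 1 <= part alpha j] by rewrite e mem_head.
    by rewrite mem_filter mem_iota => /andP[_ /andP[]].
  have : u \in j :: js.
    by rewrite -e mem_filter h mem_iota iu /= (ltn_trans uj jlt).
  rewrite inE => /orP[/eqP eu|uin]; first by rewrite eu ltnn in uj.
  move: srt; rewrite e /= => /(order_path_min ltn_trans)/allP /(_ u uin) /=.
  by rewrite ltnNge (ltnW uj).
move: jin; rewrite mem_filter mem_iota => /andP[pj /andP[ij ja]].
have pj2 : 2 <= part alpha j by lia.
rewrite -[_ :: _ :: _]/([seq (u, part alpha u) | u <- j :: i :: r]).
apply: IH => //.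
- by lia.
- by rewrite /= pth andbT /down ij; lia.
- by move=> u; rewrite inE => /orP[/eqP ->|/ge2 //]; split=> //; lia.
move=> u uj pu; case: (ltngtP u i) => ui; last by rewrite ui mem_head.
  by rewrite inE closed ?orbT //; lia.
(* A row u of length at least 2 between i and j would by tameness be at least as long as row j,
   hence long enough to be chosen before j. *)
have := js_sorted u; have : part alpha j <= part alpha u by apply: (tame_part ta); lia.
by lia.
Qed.

Lemma max_part_mem (alpha : seq nat) : alpha != [::] -> max_part alpha \in alpha.
Proof.
elim: alpha => // a [|b s] IH _; first by rewrite /max_part /= maxn0 mem_head.
rewrite /max_part [foldr _ _ _]/= -/(max_part (b :: s)).
by case: leqP => _; rewrite inE ?eqxx // IH ?orbT.
Qed.

(** D must consist of rows of length at least 2, so it is empty here and the cells of seq_1 play the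
    part of L. *)
Lemma peel_ones (alpha : seq nat) : alpha != [::] -> (forall i, 0 < i <= size alpha -> part alpha i = 1) ->
  peel alpha [::] 0 [seq (u, part alpha u) | u <- rev (iota 1 (size alpha))].
Proof.
move=> nz one; split=> //.
- move=> _; split=> //; first by apply: one; rewrite /= lt0n size_eq0.
    move=> j j0; case: (leqP j (size alpha)) => h; last by rewrite part_out.
    by rewrite one // j0.
  by move=> i; lia.
- by rewrite map_inj_uniq ?rev_uniq ?iota_uniq // => x y [].
- move=> [i j]; rewrite mem_cd; apply/mapP/idP => [[u]|].
    by rewrite mem_rev mem_iota => h [-> ->] /=; rewrite one ?one //=; lia.
  move=> /andP[/andP[i0 jp] _]; exists i.
    rewrite mem_rev mem_iota i0 /= add1n ltnS leqNgt; apply/negP => h.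
    by move: jp; rewrite part_out //; lia.
  have h : i <= size alpha.
    by rewrite leqNgt; apply/negP => h; move: jp; rewrite part_out //; lia.
  by rewrite one ?i0 //; move: jp; rewrite one ?i0 // => jp; congr pair; lia.
apply/(pairwiseP (0, 0)) => x y.
rewrite !inE size_map size_rev size_iota => xs ys xy.
rewrite !(nth_map 0) ?size_rev ?size_iota // !nth_rev ?size_iota // !nth_iota ?subnS //; try lia.
have lt : 1 + (size alpha - y).-1 < 1 + (size alpha - x).-1 by lia.
rewrite /precedes /= ltnNge (ltnW lt) (gtn_eqF lt) /=.
apply/negP => /and3P[/= h1 _ _]; move: h1; rewrite one //.
by lia.
Qed.

Lemma peel_exists (alpha : seq nat) : tame alpha -> alpha != [::] ->
  exists D j0 L, [/\ seq_cells alpha = L ++ [seq (u, part alpha u) | u <- D],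
    seq_cells alpha <> [::] & peel alpha D j0 L].
Proof.
move=> ta nz; have mem := max_part_mem nz.
set i := (index (max_part alpha) alpha).+1.
have pi : part alpha i = max_part alpha by rewrite /part nth_index.
have ia : 0 < i <= size alpha by rewrite /= index_mem.
have e12 : seq12 alpha = P12 (size alpha) alpha i [:: (i, part alpha i)].
  by rewrite /i; case: (alpha) nz.
case: (leqP 2 (max_part alpha)) => m2.
  have [||u|//|u|D [j0 [L [e [Dnz p]]]]] := @P12P alpha (size alpha) i [::] ta.
  - by rewrite -subSn; lia.
  - by [].
  - by rewrite inE => /eqP ->; rewrite pi.
  (* A row of length at least 2 below row i bounds its length, hence is also a largest part, against
     the choice of i as the first one. *)
  - move=> /andP[u0 ui] pu; have := tame_part ta u0 ui pu.
    have le := leq_max_part (mem_nth 0 _ : nth 0 alpha u.-1 \in alpha).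
    rewrite pi => h; have ua : u.-1 < size alpha by lia.
    have := @before_find _ 0 (pred1 (max_part alpha)) alpha u.-1.
    rewrite -[find _ _]/(index _ _) => /(_ _) /=.
    have eu : nth 0 alpha u.-1 = max_part alpha.
      by apply/eqP; rewrite eqn_leq h le.
    by rewrite eu eqxx => h1; have // : true = false by apply: h1; move: ui; rewrite /i; lia.
  exists D, j0, L; rewrite /seq_cells /seq2 /seq1 e12 e; split=> //=.
  by case: (D) Dnz => // d D' _; case: (L).
have one j : 0 < j <= size alpha -> part alpha j = 1.
  move=> h; have := tame_part_gt0 ta h.
  have : part alpha j <= max_part alpha by apply: leq_max_part; apply: mem_nth; move: h; case: (j).
  by lia.
have i1 : i = 1.
  rewrite /i (_ : max_part alpha = 1); last by rewrite -pi one.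
  by have := one 1; case: (alpha) nz => //= a s _; rewrite /part /= => ->.
have eP : P12 (size alpha) alpha i [:: (i, part alpha i)] =
    ([seq (u, part alpha u) | u <- rev (iota 1 (size alpha))], [::]).
  rewrite i1; case es : (size alpha) => [|l]; first by case: (alpha) nz es.
  rewrite /= one ?es //= /P3.
  set f := find _ _; have -> : f = l.
    apply/eqP; rewrite eqn_leq.
    have sz : size (drop 1 alpha) = l by rewrite size_drop es subn1.
    rewrite -{1}sz find_size /= leqNgt; apply/negP => fl.
    have := @nth_find _ 0 (predC1 (part alpha 1)) (drop 1 alpha).
    rewrite has_find -/f sz => /(_ fl) /=; rewrite nth_drop one ?es //.
    by have := one (1 + f).+1; rewrite /part /= es => ->.
  rewrite addKn drop_oversize ?es ?add1n //=; congr pair.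
  by rewrite rev_cons map_rcons -cats1 one ?es.
exists [::], 0, [seq (u, part alpha u) | u <- rev (iota 1 (size alpha))].
rewrite /seq_cells /seq2 /seq1 e12 eP /= cats0; split=> //.
  by move=> h; have := congr1 size h; rewrite size_map size_rev size_iota; case: (alpha) nz.
exact: peel_ones.
Qed.

(** * Peeling off seq(alpha) *)

Definition cell_compatible (alpha : seq nat) (g : cell -> nat) : Prop :=
  compatible alpha (fun i j => g (i.+1, j.+1)).

Lemma cell_compatibleP alpha g :
  (forall i j, 0 < i -> 0 < j < part alpha i -> g (i, j) < g (i, j.+1)) ->
  (forall i i', 0 < i < i' -> i' <= size alpha -> part alpha i = 1 -> g (i, 1) < g (i', 1)) ->
  (forall i i' j, 0 < i < i' -> part alpha i = part alpha i' ->
    0 < j <= part alpha i' -> g (i, j) < g (i', j)) ->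
  (forall i i' j, 0 < i < i' -> part alpha i' < part alpha i ->
    0 < j <= part alpha i' -> g (i, j.+1) < g (i', j)) ->
  cell_compatible alpha g.
Proof.
move=> h1 h2 h3 h4; split.
- by move=> i j h; apply: h1.
- by move=> i i' /andP[h h'] e; apply: h2.
- by move=> i i' j h e h'; apply: h3.
- by move=> i i' j h e h'; apply: h4.
Qed.

Section CellCompatible.

Variables (alpha : seq nat) (g : cell -> nat).
Hypothesis cg : cell_compatible alpha g.

Lemma cell_row i j : 0 < i -> 0 < j < part alpha i -> g (i, j) < g (i, j.+1).
Proof. by case: i => // i _; case: j => // j; apply: (compatible_row cg). Qed.

Lemma cell_one i i' : 0 < i < i' -> i' <= size alpha -> part alpha i = 1 ->
  g (i, 1) < g (i', 1).
Proof.
case: i => // i; case: i' => // i' h h' e; apply: (compatible_one cg) e.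
by rewrite h' andbT.
Qed.

Lemma cell_eq i i' j : 0 < i < i' -> part alpha i = part alpha i' ->
  0 < j <= part alpha i' -> g (i, j) < g (i', j).
Proof.
by case: i => // i; case: i' => // i'; case: j => // j h e h'; apply: (compatible_eq cg).
Qed.

Lemma cell_gt i i' j : 0 < i < i' -> part alpha i' < part alpha i ->
  0 < j <= part alpha i' -> g (i, j.+1) < g (i', j).
Proof.
by case: i => // i; case: i' => // i'; case: j => // j h e h'; apply: (compatible_gt cg).
Qed.

Lemma cell_le i j j' : 0 < i -> 0 < j <= j' -> j' <= part alpha i -> g (i, j) <= g (i, j').
Proof.
move=> i0 /andP[j0]; elim: j' => [|j' IH]; first by case: (j).
rewrite leq_eqVlt => /orP[/eqP -> //|jj'] jp; apply: leq_trans (IH _ (ltnW jp)) _ => //.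
by apply: ltnW; apply: cell_row => //; lia.
Qed.

End CellCompatible.

Lemma pairwise_index (T : eqType) (r : rel T) s x y : pairwise r s -> x \in s -> y \in s ->
  index x s < index y s -> r x y.
Proof.
move=> pw xs ys lt; rewrite -(nth_index x xs) -(nth_index x ys).
by apply: (pairwiseP x pw); rewrite ?inE ?index_mem.
Qed.

Lemma size_cd alpha : size (cd alpha) = sumn alpha.
Proof.
rewrite /cd size_allpairs_dep; congr sumn.
apply: (@eq_from_nth _ 0); rewrite size_map size_iota // => i ia.
by rewrite (nth_map 0) ?size_iota // nth_iota // size_iota.
Qed.

Lemma uniq_cd alpha : uniq (cd alpha).
Proof.
apply: allpairs_uniq_dep; first exact: iota_uniq.
  by move=> i _; apply: iota_uniq.
by move=> [a b] [a' b'] _ _ [-> ->].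
Qed.

Section Peel.

Variables (alpha D : seq nat) (j0 : nat) (L : seq cell).
Hypotheses (ta : tame alpha) (pl : peel alpha D j0 L).
Let S := L ++ [seq (u, part alpha u) | u <- D].

(** A necessary condition for A to be listed before B: above row j0 the order of seq_2, elsewhere
    rows from top to bottom. *)
Definition peel_before (A B : cell) : bool :=
  if j0 < B.1 then (j0 < A.1) && precedes alpha A B else B.1 < A.1.

Lemma peel_pairwise : pairwise peel_before S.
Proof.
have trans : transitive (fun a b : nat => b < a) by move=> x y z /=; lia.
rewrite pairwise_cat; apply/and3P; split.
- apply/allrelP => A B; rewrite (peel_mem pl) => /andP[_ lt] /mapP[u /(peel_ge2 pl)[/andP[_ h] _] ->].
  by rewrite /peel_before /= ltnNge h /= (leq_ltn_trans h lt).
- apply: (@sub_in_pairwise _ [in L]) (peel_order pl); last by apply/allP.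
  by move=> A B; rewrite !(peel_mem pl) /peel_before => /andP[_ ->] /andP[_ ->].
rewrite pairwise_map; have : pairwise (fun a b : nat => b < a) D.
  by rewrite -(sorted_pairwise trans); apply: sub_sorted (peel_sorted pl) => a b /andP[].
apply: (@sub_in_pairwise _ [in D]); last by apply/allP.
move=> u v uD /(peel_ge2 pl)[/andP[_ h] _] lt; rewrite /peel_before /=.
by rewrite ltnNge h.
Qed.

Lemma mem_peel i j : ((i, j) \in S) =
  ((i, j) \in cd alpha) && ((j0 < i) || (i \in D) && (j == part alpha i)).
Proof.
rewrite mem_cat (peel_mem pl) /=.
have -> : ((i, j) \in [seq (u, part alpha u) | u <- D]) = (i \in D) && (j == part alpha i).
  apply/mapP/andP => [[u uD [-> ->]]|[iD /eqP ->]]; first by rewrite uD eqxx.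
  by exists i.
case: (boolP (i \in D)) => iD /=; last by rewrite !orbF.
case: eqP => [->|_]; rewrite ?orbF ?orbT ?andbT // mem_cd.
by have [/andP[-> _] p2] := peel_ge2 pl iD; rewrite leqnn (ltnW p2).
Qed.

Lemma uniq_peel : uniq S.
Proof.
have trans : transitive (fun a b : nat => b < a) by move=> x y z /=; lia.
rewrite cat_uniq (peel_uniq pl) /=; apply/andP; split.
  apply/hasPn => c /mapP[u /(peel_ge2 pl)[/andP[_ h] _] ->].
  by rewrite (peel_mem pl) /= ltnNge h andbF.
rewrite map_inj_uniq => [|x y [] //].
have := @sorted_uniq _ (fun a b : nat => b < a) trans; apply; first by move=> x; apply: ltnn.
by apply: sub_sorted (peel_sorted pl) => a b /andP[].
Qed.

Lemma peel_index A B : A \in S -> B \in S -> A <> B -> ~~ peel_before A B ->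
  index B S < index A S.
Proof.
move=> As Bs AB nb; rewrite ltnNge leq_eqVlt negb_or; apply/andP; split.
  by apply/eqP => e; apply: AB; rewrite -(nth_index A As) e nth_index.
by apply: contra nb; apply: pairwise_index => //; apply: peel_pairwise.
Qed.

(** Neighbouring rows of D have equal lengths or lengths differing by one, so [cell_eq] or [cell_gt]
    relates their last cells; the rest is transitivity. *)
Lemma peel_desc u v : u \in D -> v \in D -> u < v ->
  forall g, cell_compatible alpha g -> g (u, part alpha u) < g (v, part alpha v).
Proof.
move=> uD vD uv g cg.
pose r v u := (u < v) && (g (u, part alpha u) < g (v, part alpha v)).
have trans : transitive r by move=> x y z; rewrite /r; lia.
have : sorted r D.
  apply: (@sub_in_sorted _ [in D]) (peel_sorted pl); last by apply/allP.
  move=> b a bD aD /andP[ab le]; rewrite /r ab /=.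
  have [/andP[a0 _] pa] := peel_ge2 pl aD; have [_ pb] := peel_ge2 pl bD.
  have le' := tame_part ta a0 ab pa.
  case: (ltngtP (part alpha b) (part alpha a)) le' => // [lt _|e _].
    have -> : part alpha a = (part alpha b).+1 by lia.
    by apply: (cell_gt cg); rewrite ?a0 //; lia.
  by rewrite -e; apply: (cell_eq cg); rewrite ?a0 ?e //; lia.
rewrite (sorted_pairwise trans) => pw.
case: (ltngtP (index u D) (index v D)) => h.
- by have /andP[] := pairwise_index pw uD vD h; lia.
- by have /andP[] := pairwise_index pw vD uD h.
by move: uv; rewrite -(nth_index 0 uD) h nth_index ?ltnn.
Qed.

(** A row of length at least 2 below a row of D is in D, so its last cell belongs to the chain of
    [peel_desc]; a row of length 1 is below everything higher by [cell_one]. *)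
Lemma above_chain i p v g : (i, p) \in cd alpha -> v \in D -> i < v ->
  cell_compatible alpha g -> g (i, p) < g (v, part alpha v).
Proof.
rewrite mem_cd => /andP[i0 ip] vD iv cg.
have [/andP[v0 vj] pv] := peel_ge2 pl vD.
case: (leqP 2 (part alpha i)) => pi.
  have iD : i \in D by apply: (peel_closed pl _ vD pi); rewrite i0.
  apply: leq_ltn_trans (peel_desc iD vD iv cg); apply: (cell_le cg) => //.
have [-> p1] : p = 1 /\ part alpha i = 1 by lia.
apply: leq_trans (cell_one cg (i := i) (i' := v) _ _ p1) _; first by rewrite i0.
  exact: leq_trans vj (peel_le pl).
by apply: (cell_le cg) => //; lia.
Qed.

(** The chain of [peel_desc] ends in the cell (w, 2) of the top row of D. That row has length 2 and
    row j0.+1 has length 1, so the path continues through (j0.+1, 1), which is below all higher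
    cells. *)
Lemma above_rest i p j q g : (i, p) \in cd alpha -> (j, q) \in cd alpha -> i <= j0 ->
  j0 < j -> cell_compatible alpha g -> g (i, p) < g (j, q).
Proof.
rewrite !mem_cd => /andP[i0 ip] /andP[jpos jq] ij j0j cg.
have ja : j <= size alpha.
  by rewrite leqNgt; apply/negP => h; move: jq; rewrite part_out //; lia.
have [r1 r2 r3 r4] := peel_rest pl (leq_trans j0j ja).
have col1 : g (j, 1) <= g (j, q) by apply: (cell_le cg) => //; lia.
apply: leq_trans col1.
case: (leqP 2 (part alpha i)) => pi; last first.
  have [-> p1] : p = 1 /\ part alpha i = 1 by lia.
  by apply: (cell_one cg) => //; rewrite i0 (leq_ltn_trans ij).
have iD : i \in D by apply: r3; rewrite ?i0.
have Dnz : D <> [::] by case: (D) iD.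
set w := head 0 D in r4.
have wD : w \in D by rewrite /w; case: (D) Dnz => // *; apply: mem_head.
have [/andP[w0 wj] pw] := peel_ge2 pl wD.
have iw : g (i, p) <= g (w, 2).
  apply: (@leq_trans (g (i, part alpha i))); first by apply: (cell_le cg).
  rewrite -(r4 Dnz); case: (ltngtP i w) => h; last by rewrite h.
    by apply: ltnW; apply: peel_desc.
  have trans : transitive (fun a b : nat => b < a) by move=> x y z /=; lia.
  have : sorted (fun a b : nat => b < a) D by apply: sub_sorted (peel_sorted pl) => a b /andP[].
  move: iD h; rewrite /w; case: (D) => //= x s; rewrite inE => /orP[/eqP ->|xs].
    by rewrite ltnn.
  by move=> h /(order_path_min trans)/allP /(_ i xs) /=; rewrite ltnNge ltnW.
apply: leq_ltn_trans iw _; apply: (@leq_trans (g (j0.+1, 1))).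
  by apply: (cell_gt cg); rewrite ?w0 ?r1 ?(r4 Dnz) // ltnS.
move: j0j; rewrite leq_eqVlt => /orP[/eqP <- //|lt].
by apply: ltnW; apply: (cell_one cg).
Qed.

Hypothesis seqE : seq_cells alpha = S.

Lemma part_tilde i : 0 < i ->
  part (tilde alpha) i = if i <= j0 then part alpha i - (i \in D) else 0.
Proof.
case: i => // i _; rewrite {1}/part /= nth_drop_trailing_zeros.
case: (ltnP i (size alpha)) => ia; last first.
  rewrite nth_default ?size_map ?size_iota // ifF //.
  by apply/negbTE; rewrite -ltnNge ltnS (leq_trans (peel_le pl)).
rewrite (nth_map 0) ?size_iota // nth_iota // add1n seqE.
have inI j : j \in iota 1 (part alpha i.+1) -> (i.+1, j) \in cd alpha.
  by rewrite mem_iota mem_cd add1n ltnS.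
case: (leqP i.+1 j0) => ij; last first.
  apply/eqP; rewrite -leqn0 leqNgt -has_count; apply/hasPn => j jI.
  by rewrite mem_peel inI //= ij negbK.
have e : {in iota 1 (part alpha i.+1), (fun j => (i.+1, j) \notin S) =1
    predC (fun j => (i.+1 \in D) && (j == part alpha i.+1))}.
  by move=> j jI; rewrite /= mem_peel inI //= ltnNge ij.
rewrite (eq_in_count e).
have := count_predC (fun j => (i.+1 \in D) && (j == part alpha i.+1)) (iota 1 (part alpha i.+1)).
rewrite size_iota; suff -> : count (fun j => (i.+1 \in D) && (j == part alpha i.+1))
  (iota 1 (part alpha i.+1)) = (i.+1 \in D).
  by move=> h; rewrite -[in RHS]h addKn.
case: (boolP (i.+1 \in D)) => iD /=; last exact: count_pred0.
rewrite -[count _ _]/(count_mem (part alpha i.+1) _) count_uniq_mem ?iota_uniq // mem_iota.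
by have [_ p2] := peel_ge2 pl iD; lia.
Qed.

Lemma mem_cd_tilde c : (c \in cd (tilde alpha)) = (c \in cd alpha) && (c \notin S).
Proof.
case: c => i j; rewrite mem_peel !mem_cd; case: (posnP i) => [->|i0] //=.
rewrite part_tilde //; case: (leqP i j0) => ij /=; last first.
  by case: (j) => //= j1; rewrite andbT andbN.
case: (boolP (i \in D)) => iD /=; last by rewrite subn0 andbF andbT.
by have [_ p2] := peel_ge2 pl iD; lia.
Qed.

Lemma tame_tilde : tame (tilde alpha).
Proof.
split.
  rewrite /tilde; set s := map _ _.
  have sE i : nth 0 s i = part (tilde alpha) i.+1.
    by rewrite /part /= nth_drop_trailing_zeros.
  apply: drop_trailing_zeros_pos => i j ij; rewrite !sE !part_tilde //.
  case: (ltnP i j0) => ij0; last by rewrite ltnNge (leq_trans ij0 (ltnW ij)).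
  have := tame_part_gt0 ta (i := i.+1); rewrite (leq_trans ij0 (peel_le pl)) => /(_ isT).
  case: (boolP (i.+1 \in D)) => iD /=; last by rewrite subn0; lia.
  by have [_ p2] := peel_ge2 pl iD; lia.
move=> i j ij; rewrite -[nth 0 _ i]/(part _ i.+1) -[nth 0 _ j]/(part _ j.+1) !part_tilde //.
case: (ltnP i j0) => i_le //; case: (ltnP j j0) => j_le //.
case: (boolP (i.+1 \in D)) => iD /=; case: (boolP (j.+1 \in D)) => jD /= pi.
- by apply: leq_sub2r; apply: tame_part => //; lia.
- by have := peel_gap pl iD (v := j.+1); rewrite jD ltnS ij j_le => /(_ isT isT); lia.
- by rewrite subn0 in pi *; have := tame_part ta (ltn0Sn i) (ij : i.+1 < j.+1) pi; lia.
by rewrite !subn0 in pi *; apply: tame_part.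
Qed.

Lemma sumn_tilde : sumn (tilde alpha) + size S = sumn alpha.
Proof.
rewrite -!size_cd -size_cat; apply: perm_size; apply: uniq_perm.
- rewrite cat_uniq uniq_cd uniq_peel andbT; apply/hasPn => c cS.
  by rewrite mem_cd_tilde /= cS andbF.
- exact: uniq_cd.
move=> c; rewrite mem_cat mem_cd_tilde; case: (boolP (c \in S)) => cS /=.
  by case: c cS => i j; rewrite mem_peel => /andP[->]; rewrite orbT.
by rewrite orbF andbT.
Qed.

(** A pair of rows can change its kind of relation only when exactly one of them is in D. If it is
    the lower one, [peel_gap] keeps it the longer one; if it is the upper one, [peel_closed] gives
    the lower row length 1, and [cell_one] applies. *)
Lemma compatible_tilde g : cell_compatible alpha g -> cell_compatible (tilde alpha) g.
Proof.
move=> cg; have in_j0 i : 0 < i -> 0 < part (tilde alpha) i -> i <= j0.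
  by move=> i0; rewrite part_tilde //; case: (leqP i j0).
have gap i i' : i \in D -> i' \notin D -> i < i' -> i' <= j0 -> part alpha i' + 2 <= part alpha i.
  by move=> iD iD' ii ij; apply: (peel_gap pl iD) => //; rewrite ii.
have closed i i' : i \notin D -> i' \in D -> 0 < i < i' -> part alpha i <= 1.
  by move=> iD iD' ii; rewrite leqNgt; apply: contra iD; apply: (peel_closed pl ii).
apply: cell_compatibleP.
- move=> i j i0 jp; apply: (cell_row cg) => //; move: jp; rewrite part_tilde //.
  by case: ifP; lia.
- move=> i i' ii' ia p1; have i0 : 0 < i by case/andP: ii'.
  have i'0 : 0 < i' by lia.
  have p1' := tame_part_gt0 tame_tilde (i := i'); rewrite i'0 ia in p1'.
  have ij' := in_j0 i' i'0 (p1' isT).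
  have ia' : i' <= size alpha := leq_trans ij' (peel_le pl).
  have pi'0 := tame_part_gt0 ta (i := i'); rewrite i'0 ia' in pi'0; have {}pi'0 := pi'0 isT.
  move: p1; rewrite part_tilde //; case: (leqP i j0) => // ij.
  case: (boolP (i \in D)) => iD /= p1; last by apply: (cell_one cg) => //; lia.
  have p2 : part alpha i = 2 by lia.
  case: (boolP (i' \in D)) => iD'; last by have := gap _ _ iD iD'; lia.
  have [_ p2'] := peel_ge2 pl iD'.
  have le : part alpha i' <= part alpha i by apply: tame_part => //; lia.
  by apply: (cell_eq cg) => //; lia.
- move=> i i' j ii' e jp; have i0 : 0 < i by case/andP: ii'.
  have i'0 : 0 < i' by lia.
  have ij' : i' <= j0 by apply: in_j0 => //; lia.
  have ij : i <= j0 by lia.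
  move: e jp; rewrite !part_tilde // ij ij'.
  case: (boolP (i \in D)) => iD /=; case: (boolP (i' \in D)) => iD' /= e jp.
  + by have [_ p2] := peel_ge2 pl iD; have [_ p2'] := peel_ge2 pl iD'; apply: (cell_eq cg) => //; lia.
  + by have := gap _ _ iD iD'; have [_ p2] := peel_ge2 pl iD; lia.
  + have c1 := closed _ _ iD iD' ii'; have [/andP[_ h] _] := peel_ge2 pl iD'.
    have -> : j = 1 by lia.
    by apply: (cell_one cg) => //; [exact: leq_trans h (peel_le pl)|lia].
  by apply: (cell_eq cg) => //; lia.
move=> i i' j ii' e jp; have i0 : 0 < i by case/andP: ii'.
have i'0 : 0 < i' by lia.
have ij' : i' <= j0 by apply: in_j0 => //; lia.
have ij : i <= j0 by lia.
move: e jp; rewrite !part_tilde // ij ij' => e jp; apply: (cell_gt cg) => //; last by lia.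
move: e jp; case: (boolP (i \in D)) => iD /=; case: (boolP (i' \in D)) => iD' /= e jp; try lia.
by have := closed _ _ iD iD' ii'; lia.
Qed.

End Peel.

(** * Greedy fillings *)

Record greedy (alpha : seq nat) (tau : cell -> nat) : Prop := Greedy {
  greedy_bound : forall c, c \in cd alpha -> 0 < tau c <= sumn alpha;
  greedy_inj : {in cd alpha &, injective tau};
  greedy_compatible : cell_compatible alpha tau;
  greedy_max : forall g, cell_compatible alpha g -> {in cd alpha &, forall A B,
    A.1 < B.1 -> tau A < tau B -> g A < g B} }.

Lemma cell_size alpha i j : (i, j) \in cd alpha -> i <= size alpha.
Proof.
rewrite mem_cd => /andP[i0 jp]; rewrite leqNgt; apply/negP => h.
by move: jp; rewrite part_out //; lia.
Qed.

Section Step.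

Variables (alpha D : seq nat) (j0 : nat) (L : seq cell) (tau : cell -> nat).
Hypotheses (ta : tame alpha) (pl : peel alpha D j0 L).
Let S := L ++ [seq (u, part alpha u) | u <- D].
Hypothesis seqE : seq_cells alpha = S.
Hypothesis gr : greedy (tilde alpha) tau.

(** One unfolding of [tau'_rec], with [tau] for the recursive call. *)
Definition extended (c : cell) : nat :=
  if c \in cd (tilde alpha) then tau c
  else (sumn alpha).+1 - (index c (seq_cells alpha)).+1.

Let inS c : c \in cd alpha -> (c \notin cd (tilde alpha)) = (c \in S).
Proof. by move=> cA; rewrite (mem_cd_tilde pl seqE) cA /= negbK. Qed.

Let ext_tilde c : c \in cd (tilde alpha) -> extended c = tau c.
Proof. by rewrite /extended => ->. Qed.

Let ext_S c : c \in S -> extended c = sumn alpha - index c S.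
Proof.
move=> cS; rewrite /extended seqE ifF ?subSS //.
by rewrite (mem_cd_tilde pl seqE) cS andbF.
Qed.

Let index_lt c : c \in S -> index c S < size S.
Proof. by rewrite index_mem. Qed.

Let sumE := sumn_tilde pl seqE.

Let ext_lt A B : A \in cd (tilde alpha) -> B \in S -> extended A < extended B.
Proof.
move=> At Bs; rewrite ext_tilde // ext_S //.
have /andP[_ h] := greedy_bound gr At; apply: leq_ltn_trans h _.
by rewrite -sumE -/S -addnBA ?index_size // -[X in X < _]addn0 ltn_add2l subn_gt0 index_lt.
Qed.

Let ext_S_lt A B : A \in S -> B \in S -> (extended A < extended B) = (index B S < index A S).
Proof.
move=> As Bs; rewrite !ext_S //.
have := index_lt As; have := index_lt Bs; move: sumE; rewrite -/S.
move: (index A S) (index B S) (size S) (sumn alpha) => a b s n.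
by move=> <-; lia.
Qed.

(** Every cell of S exceeds every remaining cell, so two checks suffice: the inequality for [tau]
    when both cells remain, and the order of listing when A is in S. *)
Let monotone A B : A \in cd alpha -> B \in cd alpha -> A <> B ->
  (A \in cd (tilde alpha) -> B \in cd (tilde alpha) -> tau A < tau B) ->
  (A \in S -> B \in S /\ ~~ peel_before alpha j0 A B) ->
  extended A < extended B.
Proof.
move=> Aa Ba AB h1 h2; case: (boolP (A \in cd (tilde alpha))) => At.
  case: (boolP (B \in cd (tilde alpha))) => Bt.
    by rewrite !ext_tilde //; apply: h1.
  by apply: ext_lt => //; rewrite -inS.
have As : A \in S by rewrite -inS.
by have [Bs nb] := h2 As; rewrite ext_S_lt //; apply: (peel_index pl).
Qed.

Lemma extended_bound c : c \in cd alpha -> 0 < extended c <= sumn alpha.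
Proof.
move=> cA; case: (boolP (c \in cd (tilde alpha))) => ct.
  rewrite ext_tilde //; have /andP[-> h] := greedy_bound gr ct.
  by apply: leq_trans h _; rewrite -sumE leq_addr.
have cS : c \in S by rewrite -inS.
rewrite ext_S // leq_subr andbT subn_gt0; apply: leq_trans (index_lt cS) _.
by rewrite -sumE leq_addl.
Qed.

Lemma extended_inj : {in cd alpha &, injective extended}.
Proof.
move=> A B Aa Ba e.
case: (boolP (A \in cd (tilde alpha))) => At; case: (boolP (B \in cd (tilde alpha))) => Bt.
- by apply: (greedy_inj gr) => //; rewrite -!ext_tilde.
- have Bs : B \in S by rewrite -inS.
  by have := ext_lt At Bs; rewrite e ltnn.
- have As : A \in S by rewrite -inS.
  by have := ext_lt Bt As; rewrite e ltnn.
have As : A \in S by rewrite -inS.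
have Bs : B \in S by rewrite -inS.
have := ext_S_lt As Bs; have := ext_S_lt Bs As; rewrite e ltnn => h1 h2.
have : index A S = index B S by lia.
by move=> h; rewrite -(nth_index A As) h nth_index.
Qed.

Let part_tildeE i j : (i, j) \in cd (tilde alpha) ->
  i <= j0 /\ part (tilde alpha) i = part alpha i - (i \in D).
Proof.
rewrite mem_cd => /andP[i0]; rewrite (part_tilde pl seqE) //.
by case: (leqP i j0) => // _; lia.
Qed.

Lemma extended_compatible : cell_compatible alpha extended.
Proof.
have ct := greedy_compatible gr.
have gap i i' : i \in D -> i' \notin D -> i < i' -> i' <= j0 -> part alpha i' + 2 <= part alpha i.
  by move=> iD iD' ii ij; apply: (peel_gap pl iD) => //; rewrite ii.
have closed i i' : i \notin D -> i' \in D -> 0 < i < i' -> part alpha i <= 1.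
  by move=> iD iD' ii; rewrite leqNgt; apply: contra iD; apply: (peel_closed pl ii).
have mem := mem_peel pl; rewrite -/S in mem.
(* A lower cell may be listed before a higher one only if the pair is unrelated; each relation below
   fails to be such a pair. *)
have before_ij i j i' j' : i < i' -> peel_before alpha j0 (i, j) (i', j') ->
    [/\ j0 < i, j = 2, j' = 1 & twos alpha i i'].
  move=> ii; rewrite /peel_before /precedes /= ii; case: ifP => _.
    by move=> /andP[-> /and3P[/= /eqP -> /eqP ->]].
  by lia.
apply: cell_compatibleP.
- move=> i j i0 jp.
  have Aa : (i, j) \in cd alpha by rewrite mem_cd; lia.
  have Ba : (i, j.+1) \in cd alpha by rewrite mem_cd; lia.
  apply: monotone => // [[]|_|]; first by lia.
    by rewrite mem_cd => /andP[_ h]; apply: (cell_row ct) => //; lia.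
  rewrite mem Aa /= => h; have {}h : j0 < i by case/orP: h => //; lia.
  by rewrite mem Ba h /peel_before /precedes /= h ltnn eqxx ltnNge leqnSn.
- move=> i i' ii' ia p1.
  have p1' := tame_part_gt0 ta (i := i').
  have Aa : (i, 1) \in cd alpha by rewrite mem_cd p1; lia.
  have Ba : (i', 1) \in cd alpha by rewrite mem_cd p1'; lia.
  apply: monotone => // [[]|At Bt|]; first by lia.
    have [_ e] := part_tildeE At.
    apply: (cell_one ct) (cell_size Bt) _ => //; rewrite e p1.
    by move: At; rewrite mem_cd e p1; case: (i \in D) => //; rewrite subnn andbF.
  rewrite mem Aa /= => h; have {}h : j0 < i.
    by case/orP: h => // /andP[/(peel_ge2 pl)[_]]; rewrite p1.
  split; first by rewrite mem Ba (ltn_trans h) //; lia.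
  by apply/negP => /before_ij[|_ //]; lia.
- move=> i i' j ii' e jp.
  have Aa : (i, j) \in cd alpha by rewrite mem_cd; lia.
  have Ba : (i', j) \in cd alpha by rewrite mem_cd; lia.
  have nb : ~~ peel_before alpha j0 (i, j) (i', j).
    by apply/negP => /before_ij[|_ -> //]; lia.
  apply: monotone => // [[]|At Bt|]; first by lia.
    have [ij ei] := part_tildeE At; have [ij' ei'] := part_tildeE Bt.
    apply: (cell_eq ct) => //; last by move: Bt; rewrite mem_cd => /andP[].
    have lt : i < i' by case/andP: ii'.
    rewrite ei ei' e; case: (boolP (i \in D)) => iD; case: (boolP (i' \in D)) => iD' //.
      by have := gap _ _ iD iD' lt ij'; rewrite e; clear; lia.
    have := closed _ _ iD iD' ii'; have [_] := peel_ge2 pl iD'; rewrite e; clear; lia.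
  rewrite mem Aa /= => h; split=> //; rewrite mem Ba /=.
  case/orP: h => [h|/andP[iD /eqP ej]]; first by rewrite (ltn_trans h) //; lia.
  case: (ltnP j0 i') => //= ij'; rewrite ej e eqxx andbT.
  by apply/negPn/negP => iD'; have := gap _ _ iD iD'; lia.
move=> i i' j ii' lt jp.
have Aa : (i, j.+1) \in cd alpha by rewrite mem_cd; lia.
have Ba : (i', j) \in cd alpha by rewrite mem_cd; lia.
have nb : ~~ peel_before alpha j0 (i, j.+1) (i', j).
  apply/negP => /before_ij[|_ _ _ /twosP h]; first by lia.
  by have := h i; have := h i'; lia.
apply: monotone => // [[]|At Bt|]; first by lia.
  have [ij ei] := part_tildeE At; have [ij' ei'] := part_tildeE Bt.
  apply: (cell_gt ct) => //; last by move: Bt; rewrite mem_cd => /andP[].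
  have ii : i < i' by case/andP: ii'.
  rewrite ei ei'; case: (boolP (i \in D)) => iD; case: (boolP (i' \in D)) => iD'.
  - by have [_] := peel_ge2 pl iD'; move: lt; clear; lia.
  - by have := gap _ _ iD iD' ii ij'; clear; lia.
  - by move: lt; clear; lia.
  - by move: lt; clear; lia.
rewrite mem Aa /= => h; split=> //; rewrite mem Ba /=.
case/orP: h => [h|/andP[iD /eqP ej]]; first by rewrite (ltn_trans h) //; lia.
case: (ltnP j0 i') => //= ij'.
case: (boolP (i' \in D)) => iD'; last by have := gap _ _ iD iD'; lia.
by lia.
Qed.

(** All rows above j0 have length at most 2. The delicate case is (i, 2) against (j, 1): a row u of
    length 1 above row i and not above row j then mediates through its only cell. *)
Let unrelated_lt i p j q g : cell_compatible alpha g ->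
  (i, p) \in cd alpha -> (j, q) \in cd alpha -> j0 < i -> i < j ->
  ~~ unrelated alpha (i, p) (j, q) -> g (i, p) < g (j, q).
Proof.
move=> cg Aa Ba j0i ij nu.
have ja := cell_size Ba; move: (Aa) (Ba); rewrite !mem_cd => /andP[i0 ip] /andP[jpos jq].
have [_ le2 _ _] := peel_rest pl (leq_trans j0i (leq_trans (ltnW ij) ja)).
have pi := le2 i j0i; have pj := le2 j (ltn_trans j0i ij).
have col1 : g (j, 1) <= g (j, q) by apply: (cell_le cg) => //; lia.
have iij : 0 < i < j by rewrite i0.
have one : part alpha i = 1 -> g (i, p) < g (j, q).
  move=> p1; have -> : p = 1 by lia.
  exact: leq_trans (cell_one cg iij ja p1) col1.
have [/one //|p2] : part alpha i = 1 \/ part alpha i = 2 by lia.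
have [e1|e1] : p = 1 \/ p = 2 by lia.
  subst p; apply: leq_trans col1.
  have [pj1|pj2] : part alpha j = 1 \/ part alpha j = 2 by lia.
    apply: (@ltn_trans (g (i, 2))); first by apply: (cell_row cg) => //; lia.
    by apply: (cell_gt cg) => //; lia.
  by apply: (cell_eq cg) => //; lia.
subst p; have [eq|eq] : q = 1 \/ q = 2 by lia.
  subst q; move: nu; rewrite /unrelated /= => /allPn[u]; rewrite mem_iota => hu pu.
  have pu0 := tame_part_gt0 ta (i := u); have pu2 := le2 u.
  have pu1 : part alpha u = 1 by lia.
  have iu : i < u.
    by rewrite ltn_neqAle; apply/andP; split; [apply/eqP => e; move: pu1; rewrite -e p2|lia].
  apply: (@leq_trans (g (u, 1))); first by apply: (cell_gt cg); rewrite ?pu1 ?p2 ?i0.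
  have [<- //|uj] : u = j \/ u < j by lia.
  by apply: ltnW; apply: (cell_one cg) => //; lia.
by subst q; apply: (cell_eq cg) => //; lia.
Qed.

Lemma extended_max g : cell_compatible alpha g ->
  {in cd alpha &, forall A B, A.1 < B.1 -> extended A < extended B -> g A < g B}.
Proof.
move=> cg [i p] [j q] Aa Ba ij lt; rewrite /= in ij.
have mem := mem_peel pl; rewrite -/S in mem.
case: (boolP ((i, p) \in cd (tilde alpha))) => At.
  case: (boolP ((j, q) \in cd (tilde alpha))) => Bt.
    apply: (greedy_max gr (compatible_tilde ta pl seqE cg) At Bt) => //.
    by rewrite -!ext_tilde.
  have Bs : (j, q) \in S by rewrite -inS.
  have [ij0 _] := part_tildeE At.
  move: Bs; rewrite mem Ba /= => /orP[j0j|/andP[jD /eqP ->]].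
    exact: (above_rest ta pl Aa Ba ij0 j0j cg).
  exact: (above_chain ta pl Aa jD ij cg).
have As : (i, p) \in S by rewrite -inS.
case: (boolP ((j, q) \in cd (tilde alpha))) => Bt.
  by move: lt; rewrite ltnNge (ltnW (ext_lt Bt As)).
have Bs : (j, q) \in S by rewrite -inS.
move: lt; rewrite ext_S_lt // => lt.
have bef := pairwise_index (peel_pairwise pl) Bs As lt.
case: (leqP i j0) => ij0.
  case: (leqP j j0) => jj0; last exact: (above_rest ta pl Aa Ba ij0 jj0 cg).
  move: Bs; rewrite mem Ba /= ltnNge jj0 /= => /andP[jD /eqP ->].
  exact: (above_chain ta pl Aa jD ij cg).
apply: unrelated_lt => //; move: bef; rewrite /peel_before /= ij0 => /andP[_].
by rewrite /precedes /= ltnNge (ltnW ij) (gtn_eqF ij).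
Qed.

Lemma extended_greedy : greedy alpha extended.
Proof.
split; [exact: extended_bound|exact: extended_inj|exact: extended_compatible|].
exact: extended_max.
Qed.

End Step.

Lemma tau'_greedy fuel alpha : sumn alpha <= fuel -> tame alpha ->
  greedy alpha (tau'_rec fuel alpha).
Proof.
have nil tau : greedy [::] tau.
  split=> //; apply: cell_compatibleP => //.
  - by move=> i j i0; rewrite /part nth_nil; lia.
  - by move=> i i' ii'; rewrite leqn0; lia.
  - by move=> i i' j ii' _; rewrite /part nth_nil; lia.
  - by move=> i i' j ii'; rewrite /part !nth_nil; lia.
elim: fuel alpha => [|fuel IH] alpha le_f ta.
  suff -> : alpha = [::] by apply: nil.
  by case: alpha ta le_f => // a s [/=]; rewrite inE negb_or; lia.
case: (eqVneq alpha [::]) => [->|nz]; first exact: nil.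
have [D [j0 [L [seqE Snz pl]]]] := peel_exists ta nz.
apply: (extended_greedy ta pl seqE); apply: IH; last exact: tame_tilde pl seqE.
have := sumn_tilde pl seqE; rewrite -seqE.
have : 0 < size (seq_cells alpha) by case: (seq_cells alpha) Snz.
by lia.
Qed.

(** * Inversions and the interval *)

Lemma shuffle_tame n alpha : is_composition n alpha -> partition_ones_shuffle alpha ->
  tame alpha.
Proof.
case/andP=> pos _ [la [k [/andP[_ srt] [m [sz e1 e2]]]]]; split.
  by apply/negP => /(allP pos).
elim: alpha m la k sz e1 e2 srt {pos} => [|a s IH] m la k; first by move=> *; rewrite !nth_nil.
case: m => // b m [sz]; case: b => /=; last first.
  move=> e1; case: k => // k [a1 e2] srt [|i] [|j] //= ij; first by rewrite a1.
  exact: IH e1 e2 srt i j ij.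
case: la => // l la [<- e1] e2 srt [|i] [|j] //= ij; last first.
  by apply: (IH m la k sz e1 e2 _ i j ij); move: srt => /=; apply: path_sorted.
move=> a1; case: (ltnP j (size s)) => js; last by rewrite nth_default.
have : nth 0 s j \in mask m s \/ nth 0 s j \in mask (map negb m) s.
  move: (mem_nth 0 js); move: (nth 0 s j) => y.
  elim: (s) m sz {e1 e2 IH js} => // x s' IH' [|b m] //= [sz].
  rewrite inE => /orP[/eqP ->|/(IH' m sz)].
    by case: b; rewrite /= inE eqxx; [left|right].
  by case: b => /=; rewrite !inE => -[] ->; rewrite ?orbT; auto.
rewrite e1 e2 => -[|/nseqP[-> _]]; last exact: ltnW.
have tr : transitive geq by move=> x y z /= h1 h2; apply: leq_trans h2 h1.
by move/(order_path_min tr): srt => /allP; apply.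
Qed.

Lemma insert_column_gt0 k T : 0 < (insert k T).2.
Proof.
rewrite /insert; move: (insertion_order _) => cs; elim: cs k T => //= c cs IH k T.
by case: ifP => _; case: ifP.
Qed.

Lemma new_columns_gt0 P xs : all (ltn 0) (new_columns P xs).
Proof. by elim: xs P => //= x xs IH P; rewrite insert_column_gt0 IH. Qed.

(** * Inversions of words in terms of cells *)

Fixpoint position (alpha : seq nat) (i j : nat) : nat :=
  if alpha is a :: s then
    if i is i'.+1 then a + position s i' j else a - j.+1
  else 0.

Lemma nth_w_r T i j : i < size T -> j < size (nth [::] T i) ->
  nth 0 (w_r T) (position (shape T) i j) = nth 0 (nth [::] T i) j.
Proof.
elim: T i => // r T IH [|i] /= iT jr.
  by rewrite /w_r /= nth_cat size_rev ltn_subrL (leq_ltn_trans _ jr) //= nth_rev; [congr nth|]; lia.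
by rewrite /w_r /= nth_cat size_rev ltnNge leq_addr /= addKn; apply: IH.
Qed.

Lemma position_lt alpha i j : i < size alpha -> j < nth 0 alpha i ->
  position alpha i j < sumn alpha.
Proof. by elim: alpha i => // a s IH [|i] /= ia ja; [lia|have := IH i ia ja; lia]. Qed.

Lemma position_ltn alpha i j i' j' : i < size alpha -> j < nth 0 alpha i ->
  i' < size alpha -> j' < nth 0 alpha i' ->
  (position alpha i j < position alpha i' j') = (i < i') || (i == i') && (j' < j).
Proof.
elim: alpha i i' => // a s IH [|i] [|i'] /= ia ja ia' ja'; try lia.
by rewrite ltn_add2l ltnS eqSS; apply: IH.
Qed.

Lemma position_surj alpha p : p < sumn alpha ->
  exists i j, [/\ i < size alpha, j < nth 0 alpha i & p = position alpha i j].
Proof.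
elim: alpha p => // a s IH p /= pa; case: (ltnP p a) => h.
  by exists 0, (a - p.+1); split=> //=; lia.
have [|i [j [h1 h2 h3]]] := IH (p - a); first by lia.
by exists i.+1, j; split=> //=; lia.
Qed.

Lemma le_LP n (s r : 'S_n) : reflect
  (forall p q, p < q < n -> nth 0 (word s) q < nth 0 (word s) p ->
     nth 0 (word r) q < nth 0 (word r) p) (le_L s r).
Proof.
apply: (iffP subsetP) => [h p q /andP[pq qn]|h [i j]].
  have pn := ltn_trans pq qn.
  rewrite (nth_word s (Ordinal pn)) (nth_word s (Ordinal qn)) ltnS => lt.
  have := h (Ordinal pn, Ordinal qn); rewrite !inE /= pq lt => /(_ isT).
  by rewrite (nth_word r (Ordinal pn)) (nth_word r (Ordinal qn)) ltnS.
rewrite !inE /= => /andP[ij lt]; rewrite ij /=.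
by have := h i j; rewrite !nth_word !ltnS; apply; rewrite ?ij ?ltn_ord.
Qed.

Definition cell_of (T : filling) (i j : nat) : nat := nth 0 (nth [::] T i) j.

Lemma le_words_fillings alpha T T' : shape T = alpha -> shape T' = alpha ->
  (forall p q, p < q < sumn alpha -> nth 0 (w_r T) q < nth 0 (w_r T) p ->
     nth 0 (w_r T') q < nth 0 (w_r T') p) <->
  (forall i j i' j', i < size alpha -> j < nth 0 alpha i -> i' < size alpha ->
     j' < nth 0 alpha i' -> (i < i') || (i == i') && (j' < j) ->
     cell_of T i' j' < cell_of T i j -> cell_of T' i' j' < cell_of T' i j).
Proof.
move=> sT sT'.
have nthT U i j : shape U = alpha -> i < size alpha -> j < nth 0 alpha i ->
    nth 0 (w_r U) (position alpha i j) = cell_of U i j.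
  by move=> sU ia ja; rewrite -sU nth_w_r // -?size_shape -?nth_shape sU.
split=> [h i j i' j' ia ja ia' ja' lt|h p q /andP[pq qn]].
  by rewrite -!nthT //; apply: h; rewrite position_ltn // lt position_lt.
have [i [j [ia ja ep]]] := position_surj (ltn_trans pq qn).
have [i' [j' [ia' ja' eq]]] := position_surj qn.
rewrite ep eq !nthT // in pq *; apply: h => //.
by rewrite position_ltn in pq.
Qed.

Lemma perm_w_r T : perm_eq (w_r T) (flatten T).
Proof.
elim: T => //= r T IH; rewrite /w_r /=; apply: perm_cat => //.
by rewrite perm_rev.
Qed.

Lemma flatten_fill alpha f : flatten (fill alpha f) = [seq f c | c <- cd alpha].
Proof.
rewrite /fill /cd map_allpairs /allpairs_dep /=; congr flatten.
Qed.

Lemma shape_fill alpha f : shape (fill alpha f) = alpha.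
Proof.
rewrite /fill /shape -map_comp; apply: (@eq_from_nth _ 0); rewrite size_map size_iota // => i ia.
by rewrite (nth_map 0) ?size_iota // nth_iota //= size_map size_iota.
Qed.

Lemma cell_of_fill alpha f i j : i < size alpha -> j < nth 0 alpha i ->
  cell_of (fill alpha f) i j = f (i.+1, j.+1).
Proof.
move=> ia ja; rewrite /cell_of /fill (nth_map 0) ?size_iota // nth_iota // add1n.
by rewrite (nth_map 0) ?size_iota // nth_iota.
Qed.

Lemma greedy_perm alpha f : greedy alpha f ->
  perm_eq (w_r (fill alpha f)) (iota 1 (sumn alpha)).
Proof.
move=> gr; apply: perm_trans (perm_w_r _) _; rewrite flatten_fill.
have u : uniq [seq f c | c <- cd alpha].
  by rewrite map_inj_in_uniq ?uniq_cd //; apply: greedy_inj gr.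
apply: uniq_perm => //; first exact: iota_uniq.
apply: (uniq_min_size u _ _).2; last by rewrite size_iota size_map size_cd.
by move=> x /mapP[c /(greedy_bound gr) h ->]; rewrite mem_iota add1n ltnS.
Qed.

Lemma cell_of_T_can alpha i j : i < size alpha -> j < nth 0 alpha i ->
  cell_of (T_can alpha) i j = (sumn (take i alpha) + j).+1.
Proof.
move=> ia ja; rewrite /cell_of /T_can nth_reshape nth_take // nth_drop nth_iota //.
have := position_lt ia ja; elim: (alpha) i ia ja => // a s IH [|i] /= ia ja h; first by lia.
by have := IH i ia ja (position_lt ia ja); lia.
Qed.

Lemma T_can_lower alpha T : shape T = alpha ->
  (forall i j i' j', i < size alpha -> j < nth 0 alpha i -> i' < size alpha ->
     j' < nth 0 alpha i' -> (i < i') || (i == i') && (j' < j) ->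
     cell_of (T_can alpha) i' j' < cell_of (T_can alpha) i j ->
     cell_of T i' j' < cell_of T i j) <->
  (forall i j, j.+1 < nth 0 alpha i -> cell_of T i j < cell_of T i j.+1).
Proof.
move=> sT; split=> [h i j ja|h i j i' j' ia ja ia' ja'].
  have ia : i < size alpha by rewrite ltnNge; apply: contraL ja => ?; rewrite nth_default.
  apply: h => //; rewrite ?eqxx ?ltnSn ?orbT //; first exact: ltnW.
  by rewrite !cell_of_T_can //; [lia|exact: ltnW].
case/orP=> [ii|/andP[/eqP <- jj] _].
  rewrite !cell_of_T_can // ltnS => lt; exfalso; move: lt; apply/negP; rewrite -leqNgt.
  apply: leq_trans (leq_addr _ _).
  have -> : sumn (take i' alpha) = sumn (take i.+1 alpha) + sumn (drop i.+1 (take i' alpha)).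
    by rewrite -[in LHS](cat_take_drop i.+1 (take i' alpha)) sumn_cat take_takel.
  by rewrite (take_nth 0) // sumn_rcons; lia.
elim: j jj ja => // j IH; rewrite ltnS leq_eqVlt => /orP[/eqP -> |jj] ja; first exact: h.
by apply: ltn_trans (h i j ja); apply: IH => //; apply: ltnW.
Qed.

Lemma ent_cell_of N T i j : j < size (nth [::] T i) -> ent N T i j = cell_of T i j.
Proof. by move=> h; apply: set_nth_default. Qed.

(** The relations give the inclusion of inversions because a pair of rows that [tau] does not invert
    is not inverted by any compatible filling. Conversely [tau] satisfies the relations, and T
    inverts no pair that [tau] leaves in order. *)
Lemma compatible_interval alpha T tau N : shape T = alpha -> uniq (flatten T) ->
  all (gtn N) (flatten T) -> greedy alpha tau ->
  compatible alpha (ent N T) <->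
  ((forall i j, j.+1 < nth 0 alpha i -> cell_of T i j < cell_of T i j.+1) /\
   (forall i j i' j', i < size alpha -> j < nth 0 alpha i -> i' < size alpha ->
     j' < nth 0 alpha i' -> (i < i') || (i == i') && (j' < j) ->
     cell_of T i' j' < cell_of T i j ->
     cell_of (fill alpha tau) i' j' < cell_of (fill alpha tau) i j)).
Proof.
move=> sT uT bT gr.
have lenT i : size (nth [::] T i) = nth 0 alpha i by rewrite -nth_shape sT.
have eT i j : j < nth 0 alpha i -> ent N T i j = cell_of T i j.
  by move=> h; rewrite ent_cell_of // lenT.
have in_size i j : j < nth 0 alpha i -> i < size alpha.
  by move=> ja; rewrite ltnNge; apply: contraL ja => ?; rewrite nth_default.
have in_cd i j : j < nth 0 alpha i -> (i.+1, j.+1) \in cd alpha by move=> ja; rewrite mem_cd.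
have inj i j i' j' : j < nth 0 alpha i -> j' < nth 0 alpha i' ->
    ent N T i j = ent N T i' j' -> i = i' /\ j = j'.
  move=> ja ja' e; have NT : N \notin flatten T by apply/negP => /(allP bT) /=; rewrite ltnn.
  have bT1 : all (gtn N.+1) (flatten T) by apply: sub_all bT => x /ltnW.
  (* [distinct_ent] needs a letter that is missing from the filling and below the bound; N serves
     with the bound N.+1, which does not affect the entries of cells. *)
  have := (@distinct_ent N.+1 T N uT (ltnSn N) NT).1 i j i' j'.
  have e1 a b : b < nth 0 alpha a -> ent N.+1 T a b = ent N T a b.
    by move=> h; apply: set_nth_default; rewrite lenT.
  rewrite !e1 // => h; apply: h => //; apply: leq_trans (_ : N <= N.+1) => //.
  by rewrite ent_lt // lenT.
pose g (c : cell) := ent N T c.1.-1 c.2.-1.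
have tau_row i j j' : j < nth 0 alpha i -> j' < j -> tau (i.+1, j'.+1) < tau (i.+1, j.+1).
  move=> ja jj; apply: (@leq_trans (tau (i.+1, j'.+2))).
    by apply: (cell_row (greedy_compatible gr)) => //=; rewrite /part /=; lia.
  by apply: (cell_le (greedy_compatible gr)).
split=> [cT|[rows max]].
  split=> [i j ja|i j i' j' ia ja ia' ja' low lt].
    by rewrite -!eT //; [apply: (compatible_row cT)|apply: ltnW].
  rewrite !cell_of_fill //; case/orP: low => [ii|/andP[/eqP ei jj]]; last first.
    by subst i'; apply: tau_row.
  have cg : cell_compatible alpha g := cT.
  have mx := greedy_max gr cg (in_cd _ _ ja) (in_cd _ _ ja') ii.
  rewrite ltnNge; apply/negP => le; move: lt.
  suff : cell_of T i j < cell_of T i' j' by lia.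
  rewrite -!eT //; apply: mx; rewrite ltn_neqAle le andbT; apply/eqP.
  by move/(greedy_inj gr (in_cd _ _ ja) (in_cd _ _ ja')) => [e _]; move: ii; rewrite e ltnn.
have key i j i' j' : j < nth 0 alpha i -> j' < nth 0 alpha i' -> i < i' ->
    tau (i.+1, j.+1) < tau (i'.+1, j'.+1) -> ent N T i j < ent N T i' j'.
  move=> ja ja' ii lt; rewrite ltnNge leq_eqVlt; apply/negP => /orP[/eqP e|lt'].
    by have [e1 _] := inj _ _ _ _ ja' ja e; move: ii; rewrite e1 ltnn.
  have := max i j i' j' (in_size _ _ ja) ja (in_size _ _ ja') ja'.
  rewrite ii -!eT // => /(_ isT lt'); rewrite !cell_of_fill ?(in_size _ _ ja) ?(in_size _ _ ja') //.
  by lia.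
have cg := greedy_compatible gr; split.
- by move=> i j ja; rewrite !eT //; [apply: rows|apply: ltnW].
- move=> i i' /andP[ii ia'] e; have ia := ltn_trans ii ia'.
  case: (posnP (nth 0 alpha i')) => [z|pos].
    have -> : ent N T i' 0 = N by rewrite /ent nth_default // lenT z.
    by rewrite ent_lt // lenT e.
  by apply: key; rewrite ?e //; apply: (compatible_one cg); rewrite ?ii.
- move=> i i' j ii e ja; apply: key; rewrite ?e //; exact: (compatible_eq cg).
move=> i i' j ii lt ja; apply: key => //; first exact: leq_ltn_trans ja lt.
exact: (compatible_gt cg).
Qed.

Theorem theorem5p12 (n : nat) (alpha : seq nat)
    (alpha_comp : is_composition n alpha)
    (alpha_shuffle : partition_ones_shuffle alpha) :
  K_set n alpha =
    interval_L (perm_of_word n (w_r (T_can alpha)))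
               (perm_of_word n (w_r (tau' alpha))).
Proof.
have ta := shuffle_tame alpha_comp alpha_shuffle.
have sum_n : sumn alpha = n by case/andP: alpha_comp => _ /eqP.
have gr := tau'_greedy (leqnn (sumn alpha)) ta.
apply/setP => s; rewrite !inE.
(* [w_r] reads rows from right to left, so the rows of T are the reversed pieces of the word of s.
   Its reversal, the word inserted for K_alpha, then reads T from the top row down, each row from
   left to right. *)
pose T := map rev (reshape alpha (word s)).
have sT : shape T = alpha.
  by rewrite /T /shape -map_comp (eq_map (@size_rev _)) -/(shape _) reshapeKl // size_word sum_n.
have wT : w_r T = word s.
  by rewrite /w_r /T -map_comp (eq_map (@revK _)) map_id reshapeKr // size_word sum_n.
have perm_word : perm_eq (word s) (iota 1 n).
  have u : uniq (word s).
    by rewrite map_inj_uniq ?enum_uniq // => i j [] /val_inj /perm_inj.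
  apply: uniq_perm => //; first exact: iota_uniq.
  apply: (uniq_min_size u _ _).2; last by rewrite size_iota size_word.
  by move=> x /mapP[i _ ->]; rewrite mem_iota add1n !ltnS ltn_ord.
have pT : perm_eq (flatten T) (iota 1 n).
  by apply: perm_trans perm_word; rewrite -wT perm_sym perm_w_r.
have uT : uniq (flatten T) by rewrite (perm_uniq pT) iota_uniq.
have bT : all (gtn n.+1) (flatten T).
  by apply/allP => x; rewrite (perm_mem pT) mem_iota => /andP[_].
have w_rev : word (longest n * s)%g = flatten (rev T).
  by rewrite word_longest -wT /w_r rev_flatten -map_comp (eq_map (@revK _)) map_id.
have h0 : 0 \notin shape T by rewrite sT; case: ta.
have Kiff : (shape (P_hat (longest n * s)%g) == alpha) &&
    (Q_hat (longest n * s)%g == T_can (rev alpha)) <-> runs T.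
  rewrite /P_hat /Q_hat PQE w_rev -build_inserts /= (runsE h0 bT uT) sT.
  have sz : size (new_columns [::] (flatten (rev T))) = sumn (rev alpha).
    by rewrite size_new_columns size_flatten /shape map_rev -/(shape T) sT.
  split=> [/andP[/eqP -> /eqP e]|[-> ->]].
    by split=> //; apply: records_T_can e => //; apply: new_columns_gt0.
  by rewrite eqxx records_staircase ?eqxx // mem_rev -sT.
have runs_iff : runs T <-> compatible alpha (ent n.+1 T).
  have tT : tame (shape T) by rewrite sT.
  rewrite -sT; split=> [/(runsP tT bT uT)[] //|].
  exact: compatible_runs tT bT uT.
have w0 : word (perm_of_word n (w_r (T_can alpha))) = w_r (T_can alpha).
  by apply: word_perm_of_word; apply: perm_trans (perm_w_r _) _; rewrite flatten_T_can sum_n.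
have w1 : word (perm_of_word n (w_r (tau' alpha))) = w_r (tau' alpha).
  by apply: word_perm_of_word; rewrite -[in iota _ _]sum_n; apply: greedy_perm.
set s0 := perm_of_word n (w_r (T_can alpha)) in w0 *.
set s1 := perm_of_word n (w_r (tau' alpha)) in w1 *.
have low : le_L s0 s <->
    (forall i j, j.+1 < nth 0 alpha i -> cell_of T i j < cell_of T i j.+1).
  rewrite -(T_can_lower sT) -(le_words_fillings (shape_T_can alpha) sT) sum_n wT -w0.
  by split=> [/le_LP //|h]; apply/le_LP.
have high : le_L s s1 <-> 
    (forall p q, p < q < sumn alpha -> nth 0 (w_r T) q < nth 0 (w_r T) p ->
     nth 0 (w_r (tau' alpha)) q < nth 0 (w_r (tau' alpha)) p).
  by rewrite sum_n wT -w1; split=> [/le_LP //|h]; apply/le_LP.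
apply/idP/andP => [/Kiff/runs_iff/(compatible_interval sT uT bT gr)[l h]|[l h]].
  by split; [apply/low|apply/high/(le_words_fillings sT (shape_fill _ _))].
apply/Kiff/runs_iff/(compatible_interval sT uT bT gr); split; first exact/low.
by apply/(le_words_fillings sT (shape_fill _ _))/high.
Qed.
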